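(* For every $H\in[-\infty,1/2]$ the sequence of continuous processes $(X_n)_{n\ge1}$ converges in law, as $n$ tends to $\infty$, to the restriction to $[0,1]$ of the standard Brownian motion.
   Context: $T=\bigcup_{n\ge 0}\{0,1\}^n$ is the set of finite binary words. Let $H\in[-\infty,1/2]$. Let $\epsilon$ be a random variable with values in $\{-1,1\}$, equal to $1$ with probability $(1+2^{H-1})/2$ and to $-1$ with probability $(1-2^{H-1})/2$ (for $H=-\infty$, $2^{H-1}=0$, so $\epsilon$ is symmetric). Let $(\epsilon(w))_{w\in T}$ be independent copies of $\epsilon$. For $w=w_1\cdots w_n$ let $\boldsymbol{\epsilon}(w)=\prod_{k=1}^n\epsilon(w_1\cdots w_k)$. For $n\ge1$ and $0\le k<2^n$ let $\xi^{(n)}_k=\boldsymbol{\epsilon}(w)$, where $w=w_1\cdots w_n\in\{0,1\}^n$ is the unique word with $\sum_{i=1}^n w_i2^{-i}=k2^{-n}$. Let $S^{(n)}_{r}=\sum_{k=0}^{r-1}\xi^{(n)}_k$ for $0\le r\le 2^n$, so $S^{(n)}_0=0$. For $t\in[0,1]$ let $$L_n(t)=S^{(n)}_{[2^nt]}+(2^nt-[2^nt])\,\xi^{(n)}_{[2^nt]}$$ (at $t=1$ the second term is $0$), where $[x]$ is the integer part. That is, $L_n$ is the continuous piecewise linear interpolation of the walk. For finite $H$ put $B_n(t)=2^{-nH}L_n(t)$. Let $\sigma=\sqrt{1+(2^{2-2H}-2)^{-1}}$ if $-\infty<H<1/2$, $\sigma=1/\sqrt2$ if $H=1/2$, and $\sigma=1$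 if $H=-\infty$. The processes $X_n$ are defined by - $X_n=B_n/(\sigma 2^{n(1/2-H)})$ if $-\infty<H<1/2$, i.e. $X_n(t)=L_n(t)/(\sigma\sqrt{2^n})$; - $X_n=B_n/(\sigma\sqrt n)$ if $H=1/2$, i.e. $X_n(t)=L_n(t)/(\sigma\sqrt{n2^n})$; - $X_n(t)=L_n(t)/\sqrt{2^n}$ if $H=-\infty$. Convergence in law is weak convergence of probability measures on $\mathcal{C}([0,1])$, the space of real-valued continuous functions on $[0,1]$ with the uniform norm. *)

(* Defs.v *)
From HB Require Import structures.
From mathcomp Require Import all_boot all_order all_algebra.
From mathcomp Require Import all_classical all_reals all_analysis measurable_realfun.
From mathcomp Require Import ring lra.

Set Implicit Arguments.
Unset Strict Implicit.
Unset Printing Implicit Defensive.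
Import Order.TTheory GRing.Theory Num.Theory.
Import numFieldNormedType.Exports.
Local Open Scope classical_set_scope.
Local Open Scope ring_scope.

Section C01.
Variable R : realType.

Definition I01 : set R := `[0, 1]%classic.

(* C([0,1]): the functions live on the subtype of points of [0,1], so that two
   elements are equal iff they agree on [0,1]; the topology below is that of
   uniform convergence, with balls of the uniform distance (C01_ballE). *)
Definition C01 : Type := continuousType I01 R.

HB.instance Definition _ := Choice.on C01.
HB.instance Definition _ := PseudoMetric.copy C01
  (initial_topology (id : C01 -> arrow_uniform_type I01 R)).
HB.instance Definition _ := isPointed.Build C01 (cst 0 : continuousType I01 R).

Definition C01_fun (f : C01) : I01 -> R := f : continuousType I01 R.
Coercion C01_fun : C01 >-> Funclass.

Lemma C01_ballE (f g : C01) (e : R) :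
  ball f e g <-> forall t, `|f t - g t| < e.
Proof. by []. Qed.

Definition path01 (f : R -> R) (cf : {within `[0, 1], continuous f}) : C01 :=
  (mkcts ((subspace_sigL_continuousP I01 f).1 cf) : continuousType I01 R).

Lemma path01E f cf t : @path01 f cf t = f (val t).
Proof. by []. Qed.
End C01.
Arguments I01 : clear implicits.

Definition borel (T : ptopologicalType) := g_sigma_algebraType (@open T).


Definition weak_cvg (T : ptopologicalType) (R : realType)
    (mu_ : nat -> probability (borel T) R) (mu : probability (borel T) R) :=
  forall f : T -> R, continuous f -> (exists M, forall x, `|f x| <= M) ->
    (\int[mu_ n]_x (f x)%:E)%E @[n --> \oo] --> (\int[mu]_x (f x)%:E)%E.

(* A map into C([0,1]) whose coordinates are all measurable is Borel measurable;
   hence laws of continuous processes are genuine Borel probability measures. *)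
Section measurability_in_C01.
Variable R : realType.

Let clamp (t : R) : R := Num.max 0 (Num.min 1 t).

Let clampI t : clamp t \in I01 R.
Proof.
by apply/mem_set; rewrite /I01 /= in_itv /= le_max lexx ge_max ler01 ge_min lexx.
Qed.

Let clamp_id t : t \in `[0, 1] -> clamp t = t.
Proof.
by rewrite in_itv /= => /andP[t0 t1]; rewrite /clamp min_r// max_r.
Qed.

Let ext (f : C01 R) (t : R) : R := f (exist _ (clamp t) (clampI t)).

Let extE f (t : I01 R) : ext f (val t) = f t.
Proof.
rewrite /ext; congr (f _); apply/val_inj => /=; apply: clamp_id.
by have /set_mem := valP t.
Qed.

Let ext_continuous f : continuous (ext f).
Proof.
move=> t; apply: (@continuous_comp _ (I01 R) _
  (fun u : R => exist _ (clamp u) (clampI u) : I01 R)); last exact: cts_fun.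
apply: continuous_comp_initial => u.
apply: continuous_max; first exact: cvg_cst.
by apply: continuous_min; [exact: cvg_cst|exact: cvg_id].
Qed.

Let near_ext f (e : R) : 0 < e ->
  \forall m \near \oo, forall x, x \in `[0, 1] ->
    forall y, `|y - x| <= m.+1%:R^-1 -> `|ext f y - ext f x| < e.
Proof.
move=> e0.
have /compact_near_coveringP ncov := @segment_compact R 0 1.
have /= := ncov nat \oo (fun m x => forall y, `|y - x| <= m.+1%:R^-1 ->
   `|ext f y - ext f x| < e) _.
move=> /(_ _) /=; apply.
move=> x _.
have /cvgrPdist_lt/(_ (e / 2))[] := @ext_continuous f x; first by rewrite divr_gt0.
move=> d /= d0 hd.
have d2 : 0 < d / 2 by rewrite divr_gt0.
near=> x' m => /= y yx'.
have xx' : `|x - x'| < d / 2.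
  near: x'; exists (d / 2) => //.
have m1 : m.+1%:R^-1 < d / 2.
  near: m; exact: near_infty_natSinv_lt (PosNum d2).

have h1 : `|ext f x - ext f x'| < e / 2 by apply: hd => /=; lra.
have h2 : `|ext f x - ext f y| < e / 2.
  apply: hd => /=; rewrite (_ : x - y = (x - x') - (y - x')); last by ring.
  apply: (le_lt_trans (ler_normB _ _)); rewrite (splitr d); apply: ltrD => //.
  exact: le_lt_trans m1.
rewrite (_ : ext f y - _ = (ext f x - ext f x') - (ext f x - ext f y)); last by ring.
by rewrite (le_lt_trans (ler_normB _ _))//; lra.
Unshelve. all: by end_near. Qed.

Let box (a : nat * nat * seq rat) : set (C01 R) :=
  [set f | forall i : nat, forall r : rat,
    (i <= a.1.1.+1)%N -> (ratr r : R) \in `[0, 1] ->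
    `|ratr r - i%:R / a.1.1.+1%:R| <= a.1.1.+1%:R^-1 :> R ->
    `|ext f (ratr r) - ratr (nth 0 a.2 i)| <= a.1.2.+1%:R^-1].

Let ext_clamp f r s : clamp r = clamp s -> ext f r = ext f s.
Proof. by move=> e; rewrite /ext; congr (f _); exact/val_inj. Qed.

Let ext_dense (f g : C01 R) (c : R) :
  (forall r : rat, (ratr r : R) \in `[0, 1] ->
    `|ext f (ratr r) - ext g (ratr r)| <= c) ->
  forall t, `|f t - g t| <= c.
Proof.
move=> fg t; rewrite -!extE; move: (val t) => y.
have fgT (r : rat) : `|ext f (ratr r) - ext g (ratr r)| <= c.
  have [r0|r0] := ltP (ratr r : R) 0.
    have := fg 0; rewrite rmorph0 in_itv/= lexx ler01 => /(_ isT) fg0.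
    suff /ext_clamp e : clamp (ratr r) = clamp 0 by rewrite !e.
    by rewrite /clamp !min_r ?ler01// ?(ltW (lt_trans r0 _))// max_l ?(ltW r0)// maxxx.
  have [r1|r1] := ltP 1 (ratr r : R).
    have := fg 1; rewrite rmorph1 in_itv/= lexx ler01 => /(_ isT) fg1.
    suff /ext_clamp e : clamp (ratr r) = clamp 1 by rewrite !e.
    by rewrite /clamp minxx min_l ?(ltW r1).
  by apply: fg; rewrite in_itv/= r0.
rewrite leNgt; apply/negP => cy.
pose h y := `|ext f y - ext g y|.
have ch : continuous h.
  move=> z; apply: cvg_norm; apply: cvgB; exact: ext_continuous.
have oO : open (h @^-1` [set z | c < z]).
  by apply: open_comp => [z _|]; [exact: ch|exact: open_gt].
have [x [/= cx [r _ rx]]] :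
    h @^-1` [set z | c < z] `&` (@ratr R @` setT) !=set0.
  by apply: dense_rat => //; exists y.
by move: cx; rewrite -rx ltNge fgT.
Qed.

Let box_base (U : set (C01 R)) f : open U -> U f ->
  exists a, box a f /\ box a `<=` U.
Proof.
move=> oU Uf.
have /nbhs_ballP[e /= e0 fU] : nbhs f U by exact: open_nbhs_nbhs.
have [k _ /(_ _ (leqnn k)) ke] := near_infty_natSinv_lt (PosNum (divr_gt0 e0 (ltr0n _ 2))).
rewrite /= in ke.
have k0 : 0 < k.+1%:R^-1 / 2 :> R by rewrite divr_gt0.
have [m _ /(_ _ (leqnn m)) /= hm] := near_ext f k0.
have hq (x : R) : exists q : rat, `|x - ratr q| < k.+1%:R^-1 / 2.
  move: k0; move: (_ / 2 : R) => a a0.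
  have ax : x - a < x + a by lra.
  have [q] := rat_in_itvoo ax; rewrite in_itv/= => /andP[q1 q2].
  by exists q; rewrite ltr_norml; apply/andP; split; lra.
pose Q x := projT1 (cid (hq x)).
have QP x : `|x - ratr (Q x)| < k.+1%:R^-1 / 2 by rewrite /Q; case: cid.
have fbox i (r : rat) : (i <= m.+1)%N -> (ratr r : R) \in `[0, 1] ->
    `|ratr r - i%:R / m.+1%:R| <= m.+1%:R^-1 :> R ->
    `|ext f (ratr r) - ratr (Q (ext f (i%:R / m.+1%:R)))| <= k.+1%:R^-1.
  move=> im r01 ri.
  have i01 : i%:R / m.+1%:R \in `[0 : R, 1].
    by rewrite in_itv/= divr_ge0//= ler_pdivrMr// mul1r ler_nat.
  have h1 := hm _ i01 _ ri; have h2 := QP (ext f (i%:R / m.+1%:R)).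
  move: h1 h2; move: (ext f _) (ext f _) (ratr (Q _)) (k.+1%:R^-1) => u v w c; rewrite !ltr_norml ler_norml.
  by move=> /andP[? ?] /andP[? ?]; apply/andP; split; lra.
have [q qE] : exists q : seq rat,
    forall i, (i <= m.+1)%N -> nth 0 q i = Q (ext f (i%:R / m.+1%:R)).
  exists (mkseq (fun i => Q (ext f (i%:R / m.+1%:R))) m.+2) => i im.
  by rewrite nth_mkseq.
exists (m, k, q); split; first by move=> i r /= im; rewrite qE//; exact: fbox.
move=> g /= gbox; apply: fU; rewrite C01_ballE => t.
apply: (@le_lt_trans _ _ (k.+1%:R^-1 + k.+1%:R^-1)); last first.
  by move: ke; move: (k.+1%:R^-1) => c; lra.
apply: ext_dense => r r01.
pose i := Num.truncn (ratr r * m.+1%:R : R).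
have [r0 r1] : 0 <= ratr r :> R /\ ratr r <= 1 :> R.
  by move: r01; rewrite in_itv/= => /andP[].
have /andP[i1 i2] := truncn_itv (mulr_ge0 r0 (ler0n R m.+1)).
have im : (i <= m.+1)%N.
  by rewrite -(ler_nat R) (le_trans i1)// ler_piMl.
have ri : `|ratr r - i%:R / m.+1%:R| <= m.+1%:R^-1 :> R.
  rewrite ler_norml; apply/andP; split.
    rewrite (@le_trans _ _ 0) ?oppr_le0//.
    by rewrite subr_ge0 ler_pdivrMr.
  rewrite lerBlDr -[X in X + _]mul1r -mulrDl ler_pdivlMr// addrC natr1.
  exact: ltW.
have := fbox _ _ im r01 ri; have := gbox _ _ im r01 ri.
rewrite /= qE//.
move: (ext f _) (ext g _) (ratr (Q _)) (k.+1%:R^-1) => u v w c.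
rewrite !ler_norml => /andP[? ?] /andP[? ?]; apply/andP; split; lra.
Qed.

Lemma measurable_fun_C01 d (T : measurableType d) (X : T -> C01 R) :
  (forall t : I01 R, measurable_fun setT (fun w => X w t)) ->
  measurable_fun setT (X : T -> borel (C01 R)).
Proof.
move=> mX; apply: (@measurability _ _ _ (borel (C01 R)) setT X (@open (C01 R))) => //.
move=> _ [U oU <-]; rewrite setTI.
rewrite (_ : X @^-1` U =
    \bigcup_(a in [set a | box a `<=` U]) (X @^-1` (box a))); last first.
  apply/seteqP; split => [w /= Uw|w [a aU]]; last exact: aU.
  by have [a [aw aU]] := box_base oU Uw; exists a.
rewrite bigcup_mkcond; apply: countable_bigcupT_measurable; first exact: countableP.
move=> a; case: ifPn => // _.
rewrite (_ : X @^-1` box a = \bigcap_i \bigcap_j (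
   if unpickle j is Some r then
     [set w | (i <= a.1.1.+1)%N -> (ratr r : R) \in `[0, 1] ->
    `|ratr r - i%:R / a.1.1.+1%:R| <= a.1.1.+1%:R^-1 :> R ->
    `|ext (X w) (ratr r) - ratr (nth 0 a.2 i)| <= a.1.2.+1%:R^-1]
    else setT)); last first.
  apply/seteqP; split => [w /= bw i _ j _|w bw i r].
    by case: unpickle => // r; exact: bw.
  by have := bw i I (pickle r) I; rewrite pickleK; exact.
apply: bigcapT_measurable => i; apply: bigcapT_measurable => j.
case: unpickle => // r.
have [?|/negP ?] := boolP (i <= a.1.1.+1)%N; last first.
  by rewrite (_ : [set _ | _] = setT) //; apply/seteqP; split.
have [?|/negP ?] := boolP ((ratr r : R) \in `[0, 1]); last first.
  by rewrite (_ : [set _ | _] = setT) //; apply/seteqP; split.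
have [?|/negP ?] := boolP (`|ratr r - i%:R / a.1.1.+1%:R| <= a.1.1.+1%:R^-1 :> R); last first.
  by rewrite (_ : [set _ | _] = setT) //; apply/seteqP; split.
rewrite (_ : [set _ | _] = (fun w => `|ext (X w) (ratr r) - ratr (nth 0 a.2 i)|) @^-1`
    `]-oo, a.1.2.+1%:R^-1]%classic); last first.
  by apply/seteqP; split => w /=; rewrite in_itv/=; [apply|].
rewrite -[X in measurable X]setTI.
suff : measurable_fun setT (fun w => `|ext (X w) (ratr r) - ratr (nth 0 a.2 i)|) by apply.
apply: measurableT_comp => //; apply: measurable_funD => //.
exact: mX.
Qed.
End measurability_in_C01.

(* Only the values at times in [0,1] matter; times outside [0,1] are ignored by
   cprocess_path. *)
Record cprocess (R : realType) d (T : measurableType d) := CProcess {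
  cprocess_fun :> R -> T -> R;
  cprocess_measurable : forall t, t \in `[0, 1] ->
    measurable_fun setT (cprocess_fun t);
  cprocess_continuous : forall w,
    {within `[0, 1], continuous (fun t => cprocess_fun t w)} }.

Section law.
Context (R : realType) d (T : measurableType d).

Definition cprocess_path (X : cprocess R T) (w : T) : borel (C01 R) :=
  path01 (@cprocess_continuous _ _ _ X w).

Let measurable_cprocess_path X : measurable_fun setT (cprocess_path X).
Proof.
apply: measurable_fun_C01 => t; rewrite /cprocess_path.
exact: (cprocess_measurable X (set_mem (valP t))).
Qed.

HB.instance Definition _ X := isMeasurableFun.Build _ _ _ _ (cprocess_path X)
  (measurable_cprocess_path X).

Definition law (P : probability T R) (X : cprocess R T)
  : probability (borel (C01 R)) R := distribution P (cprocess_path X).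
End law.

Definition cvg_in_law (R : realType) d (T : measurableType d)
    (P : probability T R) (X_ : nat -> cprocess R T)
    d' (T' : measurableType d') (P' : probability T' R) (X : cprocess R T') :=
  weak_cvg (fun n => law P (X_ n)) (law P' X).

Definition mutually_independent (R : realType) d (T : measurableType d)
    (P : probability T R) (I : eqType) (X : I -> T -> R) :=
  forall (s : seq I) (A : I -> set R), uniq s ->
    (forall i, i \in s -> measurable (A i)) ->
    P (\bigcap_(i in [set` s]) (X i @^-1` A i)) =
      (\prod_(i <- s) P (X i @^-1` A i))%E.

Section brownian_motion.
Context (R : realType) d (T : measurableType d) (P : probability T R).

Record standard_brownian_motion (W : R -> {RV P >-> R}) : Prop := {
  sbm_start : {ae P, forall w, W 0 w = 0};
  sbm_continuous : forall w, {within `[0, +oo[, continuous (fun t => W t w)};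
  sbm_gaussian : forall s t, 0 <= s -> s < t -> forall A, measurable A ->
    P ((W t \- W s) @^-1` A) = normal_prob 0 (Num.sqrt (t - s)) A;
  sbm_increments : forall (n : nat) (t : nat -> R), 0 <= t 0%N ->
    (forall i, (i < n)%N -> t i < t i.+1) ->
    mutually_independent P (fun (i : 'I_n) => W (t i.+1) \- W (t i)) }.

Let sbm_continuous01 W : standard_brownian_motion W ->
  forall w, {within `[0, 1], continuous (fun t => W t w)}.
Proof.
move=> hW w; apply: continuous_subspaceW (@sbm_continuous W hW w) => t /=.
by rewrite !in_itv/= andbT => /andP[].
Qed.

Definition sbm01 W (hW : standard_brownian_motion W) : cprocess R T :=
  CProcess (fun t _ => @measurable_funPT _ _ _ _ (W t)) (sbm_continuous01 hW).
End brownian_motion.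

(* Binary digits of k, most significant first: the i-th letter (i = 1..n) is the
   digit of weight 2^(n-i) of k. *)
Definition word (n k : nat) : seq bool :=
  mkseq (fun i => odd (k %/ 2 ^ (n - i.+1))) n.

Lemma size_word n k : size (word n k) = n.
Proof. exact: size_mkseq. Qed.

Lemma word_spec (R : realType) n k : (k < 2 ^ n)%N ->
  \sum_(1 <= i < n.+1) (nth false (word n k) i.-1)%:R * 2 ^- i =
    k%:R * 2 ^- n :> R.
Proof.
move=> kn.
have kE m : (\sum_(j < m) odd (k %/ 2 ^ j) * 2 ^ j + k %/ 2 ^ m * 2 ^ m = k)%N.
  elim: m => [|m IH]; first by rewrite big_ord0 divn1 muln1.
  rewrite big_ord_recr/= -{}[RHS]IH -addnA; congr addn.
  rewrite expnSr divnMA -[in RHS](odd_double_half (k %/ 2 ^ m)) mulnDl; congr addn.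
  by rewrite -muln2 -divn2 -mulnA (mulnC 2%N).
apply: (@mulIf _ (2 ^+ n)); first by rewrite expf_neq0// pnatr_eq0.
rewrite -mulrA mulVf ?expf_neq0 ?pnatr_eq0// mulr1 mulr_suml.
rewrite big_add1/= big_mkord -[in RHS](kE n) divn_small// mul0n addn0.
rewrite natr_sum (reindex_inj rev_ord_inj)/=; apply: eq_bigr => i _.
rewrite nth_mkseq ?rev_ord_proof// natrM natrX -mulrA; congr (_ * _).
  by rewrite subnSK// subKn// ltnW.
rewrite subnSK//; apply: (@mulfI _ (2 ^+ (n - i))).
  by rewrite expf_neq0// pnatr_eq0.
rewrite mulrA mulfV ?expf_neq0 ?pnatr_eq0// mul1r -exprD subnK// ltnW//.
Qed.

Section walk.
Context (R : realType) d (T : measurableType d) (P : probability T R).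

(* 2^(H-1), with 2^(-oo) = 0; the value at +oo is irrelevant. *)
Definition two_pow_subr1 (H : \bar R) : R :=
  match H with h%:E => 2 `^ (h - 1) | _ => 0 end.

Record iid_signs (H : \bar R) (eps : seq bool -> {RV P >-> R}) : Prop := {
  signs_val : forall w x, eps w x = 1 \/ eps w x = -1;
  signs_prob1 : forall w,
    P (eps w @^-1` [set 1]) = ((1 + two_pow_subr1 H) / 2)%:E;
  signs_probN1 : forall w,
    P (eps w @^-1` [set -1]) = ((1 - two_pow_subr1 H) / 2)%:E;
  signs_indep : mutually_independent P (fun w => eps w) }.

Variable eps : seq bool -> {RV P >-> R}.

(* eps w for w the empty word is never used here. *)
Definition beps (w : seq bool) (x : T) : R :=
  \prod_(1 <= k < (size w).+1) eps (take k w) x.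

Definition xi (n k : nat) (x : T) : R := beps (word n k) x.

Definition Ssum (n r : nat) (x : T) : R := \sum_(0 <= k < r) xi n k x.

(* At t = 1 one has r = 2^n and the coefficient of xi n r is 0. *)
Definition Lint (n : nat) (t : R) (x : T) : R :=
  let r := Num.truncn (2 ^+ n * t) in
  Ssum n r x + (2 ^+ n * t - r%:R) * xi n r x.

Definition Bproc (h : R) (n : nat) (t : R) (x : T) : R :=
  2 `^ (- (n%:R * h)) * Lint n t x.

Definition sigma (h : R) : R :=
  if h == 2^-1 then (Num.sqrt 2)^-1
  else Num.sqrt (1 + (2 `^ (2 - 2 * h) - 2)^-1).

(* The last branch is meant for H = -oo, where sigma is 1; H = +oo is junk.
   For n = 0 and H = 1/2 the division by 0 is also junk. *)
Definition Xfun (H : \bar R) (n : nat) (t : R) (x : T) : R :=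
  match H with
  | h%:E => if h == 2^-1 then Bproc h n t x / (sigma h * Num.sqrt n%:R)
            else Bproc h n t x / (sigma h * 2 `^ (n%:R * (2^-1 - h)))
  | _ => Lint n t x / Num.sqrt (2 ^+ n)
  end.

Let LintE n t x : t \in `[0, 1] -> Lint n t x =
  \sum_(0 <= k < 2 ^ n) xi n k x * Num.max 0 (Num.min 1 (2 ^+ n * t - k%:R)).
Proof.
rewrite in_itv/= => /andP[t0 t1]; rewrite /Lint.
set y := 2 ^+ n * t.
have y0 : 0 <= y by rewrite mulr_ge0.
have yn : y <= (2 ^ n)%:R by rewrite natrX ler_piMr.
have /andP[r1 r2] := truncn_itv y0; set r := Num.truncn y in r1 r2 *.
have rn : (r <= 2 ^ n)%N by rewrite -(ler_nat R) (le_trans r1).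
rewrite (@big_cat_nat _ _ _ r)//=; congr +%R.
  rewrite /Ssum [LHS]big_seq [RHS]big_seq; apply: eq_bigr => k.
  rewrite mem_index_iota => /andP[_ kr].
  rewrite min_l ?max_r ?mulr1// lerBrDr addrC natr1.
  by rewrite (le_trans _ r1)// ler_nat.
have [rE|rn'] := eqVneq r (2 ^ n)%N.
  move: r1; rewrite rE => r1; rewrite big_geq// (_ : y - _ = 0) ?mul0r//.
  by apply/eqP; rewrite subr_eq0 eq_le yn.
rewrite big_ltn ?ltn_neqAle ?rn'// big_nat big1 ?addr0.
  rewrite mulrC min_r ?max_r ?subr_ge0//.
  by rewrite lerBlDr addrC natr1 ltW.
move=> k /andP[rk _]; rewrite max_l ?mulr0// ge_min subr_le0.
by rewrite (le_trans (ltW r2)) ?orbT// ler_nat.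
Qed.

Let Lint_continuous n x : {within `[0, 1], continuous (fun t => Lint n t x)}.
Proof.
apply: (@subspace_eq_continuous _ _ _ (fun t : R => \sum_(0 <= k < 2 ^ n)
    xi n k x * Num.max 0 (Num.min 1 (2 ^+ n * t - k%:R)))).
  move=> t /set_mem t01 /=. exact: esym (LintE n x t01).
have cont_max (k : nat) :
    continuous (fun t : R => Num.max 0 (Num.min 1 (2 ^+ n * t - k%:R))).
  move=> t.
  apply: (@continuous_max R R (cst 0) (fun t => Num.min 1 (2 ^+ n * t - k%:R)) t).
    exact: cvg_cst.
  apply: (@continuous_min R R (cst 1) (fun t => 2 ^+ n * t - k%:R) t); first exact: cvg_cst.
  by apply: cvgB; [apply: cvgM; [exact: cvg_cst|exact: cvg_id]|exact: cvg_cst].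
apply: continuous_subspaceT; apply: continuous_big => [|k _ t].
  exact: add_continuous.
by apply: cvgM; [exact: cvg_cst|exact: cont_max].
Qed.

Let xi_measurable n k : measurable_fun setT (xi n k).
Proof. by apply: measurable_prod => i _; exact: measurable_funPT. Qed.

Let Lint_measurable n t : measurable_fun setT (Lint n t).
Proof.
apply: measurable_funD; first by apply: measurable_sum => k.
exact: measurable_funM.
Qed.

Let XfunE H n : exists c, forall t x, Xfun H n t x = c * Lint n t x.
Proof.
rewrite /Xfun /Bproc; case: H => [h| |].
- exists (if h == 2^-1 then 2 `^ (- (n%:R * h)) / (sigma h * Num.sqrt n%:R)
    else 2 `^ (- (n%:R * h)) / (sigma h * 2 `^ (n%:R * (2^-1 - h)))) => t x.
  by case: ifPn => _; rewrite mulrAC.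
- by exists (Num.sqrt (2 ^+ n))^-1 => t x; rewrite mulrC.
- by exists (Num.sqrt (2 ^+ n))^-1 => t x; rewrite mulrC.
Qed.

Let Xfun_measurable H n t : t \in `[0, 1] -> measurable_fun setT (Xfun H n t).
Proof.
have [c cE] := XfunE H n => _.
by rewrite (_ : Xfun H n t = fun x => c * Lint n t x);
  [exact: measurable_funM|apply/funext => x].
Qed.

Let Xfun_continuous H n x : {within `[0, 1], continuous (fun t => Xfun H n t x)}.
Proof.
have [c cE] := XfunE H n.
rewrite (_ : (fun t => Xfun H n t x) = fun t => c * Lint n t x); last first.
  by apply/funext => t.
move=> t; apply: cvgM; first exact: cvg_cst.
exact: Lint_continuous.
Qed.

Definition Xproc (H : \bar R) (n : nat) : cprocess R T :=
  CProcess (@Xfun_measurable H n) (@Xfun_continuous H n).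

End walk.

(* Main.v *)
Require Import Defs.
From HB Require Import structures.
From mathcomp Require Import all_boot all_order all_algebra.
From mathcomp Require Import all_classical all_reals all_analysis.
From mathcomp Require Import measurable_realfun ring lra.

Set Implicit Arguments.
Unset Strict Implicit.
Unset Printing Implicit Defensive.
Import Order.TTheory GRing.Theory Num.Theory.
Import numFieldNormedType.Exports.
Local Open Scope classical_set_scope.
Local Open Scope ring_scope.

(** Write [p = 2 ^ (H - 1)] for the mean of a sign; [H <= 1 / 2] means
    [2 p ^ 2 <= 1]. The walk of generation [m + l] is self-similar
    ([Ex_branch_blocks]): its [2 ^ m] increments over blocks of [2 ^ l] steps are
    independent copies of the total [Z l] of generation [l], each multiplied by
    the product of the signs along a branch of depth [m]. Splitting the total
    into two halves gives recursions for its moments: the mean is [(2 p) ^ l],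
    the second moment [Zsqr] is explicit, which is where [sigma] and the
    logarithmic factor at [H = 1 / 2] come from ([cvg_Xscale]), and the fourth
    moment is at most [9 Zsqr ^ 2] ([fourth_moment_Z]).

    _Tightness._ The fourth moments control the increments at every dyadic level
    after scaling, and chaining over the levels shows that the path is close, in
    expected uniform distance and uniformly in the generation, to the broken line
    through its values at the dyadic times of a fixed level [m]
    ([expected_oscillation]).

    _Central limit theorem._ The dependence between blocks is only through signs
    that can be frozen: once they are, the blocks are independent variables, and
    Lindeberg's replacement exchanges them one at a time for independent copies of
    another law ([branch_iid]). The replaced summand enters up to sign, which
    costs its mean, negligible after normalisation, and not its second moment. For
    a Lipschitz function of the total, smoothed at a small scale so as to have a
    second order expansion ([smooth_lips]), this yields the limit of the law of
    one dyadic increment ([lindeberg], [leaf_clt]). The limit is symmetric, so the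
    signs disappear in it; a second replacement, of whole blocks by Gaussian
    increments, gives the joint law of the increments of level [m]
    ([dyadic_cvg]).

    The replacement is carried out with finitely supported laws, where
    expectations are finite sums and independence is iteration of sums. The walk
    is of this kind ([mean_walk]); a Gaussian sample is approximated by samples of
    finitely many values ([gaussian_discretisation]).

    _Conclusion._ For a bounded Lipschitz functional of the path, replacing both
    the walk and the Brownian path by their interpolations of level [m] reduces
    the convergence to that of the dyadic increments ([cvg_lipschitz]). A bounded
    continuous functional is an increasing limit of Lipschitz ones
    ([lower_lipschitz]), which bounds the lower limit of its expectations; applied
    to the opposite functional, this bounds the upper limit as well. *)


(** * Finitely supported laws *)

Section finite_laws.
Variable R : realFieldType.

Definition fdist (A : Type) := seq (R * A).

Definition Ex A (d : fdist A) (f : A -> R) : R := \sum_(x <- d) x.1 * f x.2.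

(** Probability is required of the functional [Ex d], not of the list [d]: the
    list may repeat values, and only expectations are ever used. *)
Definition is_prob A (d : fdist A) :=
  (forall f, (forall a, 0 <= f a) -> 0 <= Ex d f) /\ Ex d (fun=> 1) = 1.

Definition supported A (d : fdist A) (Q : A -> Prop) :=
  forall f g : A -> R, (forall a, Q a -> f a = g a) -> Ex d f = Ex d g.

Definition fbind A B (d : fdist A) (k : A -> fdist B) : fdist B :=
  flatten [seq [seq (x.1 * y.1, y.2) | y <- k x.2] | x <- d].

Definition fmap A B (h : A -> B) (d : fdist A) : fdist B :=
  [seq (x.1, h x.2) | x <- d].

Definition fdirac A (a : A) : fdist A := [:: (1, a)].

Lemma eq_Ex A (d : fdist A) f g : f =1 g -> Ex d f = Ex d g.
Proof. by move=> fg; apply: eq_bigr => x _; rewrite fg. Qed.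

Lemma Ex_fmap A B (h : A -> B) (d : fdist A) f :
  Ex (fmap h d) f = Ex d (fun a => f (h a)).
Proof. by rewrite /Ex big_map. Qed.

Lemma Ex_fbind A B (d : fdist A) (k : A -> fdist B) f :
  Ex (fbind d k) f = Ex d (fun a => Ex (k a) f).
Proof.
rewrite /Ex /fbind big_flatten big_map; apply: eq_bigr => x _.
by rewrite big_map mulr_sumr; apply: eq_bigr => y _ /=; rewrite mulrA.
Qed.

Lemma Ex_fdirac A (a : A) f : Ex (fdirac a) f = f a.
Proof. by rewrite /Ex big_seq1 mul1r. Qed.

Lemma ExD A (d : fdist A) f g : Ex d (fun a => f a + g a) = Ex d f + Ex d g.
Proof. by rewrite /Ex -big_split; apply: eq_bigr => x _; rewrite mulrDr. Qed.

Lemma ExZ A (d : fdist A) c f : Ex d (fun a => c * f a) = c * Ex d f.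
Proof. by rewrite /Ex mulr_sumr; apply: eq_bigr => x _; rewrite mulrCA. Qed.

Lemma ExN A (d : fdist A) f : Ex d (fun a => - f a) = - Ex d f.
Proof. by rewrite -mulN1r -ExZ; apply: eq_Ex => a; rewrite mulN1r. Qed.

Lemma ExB A (d : fdist A) f g : Ex d (fun a => f a - g a) = Ex d f - Ex d g.
Proof. by rewrite ExD ExN. Qed.

Lemma Ex_sum A (d : fdist A) I (r : seq I) (f : I -> A -> R) :
  Ex d (fun a => \sum_(i <- r) f i a) = \sum_(i <- r) Ex d (f i).
Proof.
elim: r => [|i r IH].
  by rewrite big_nil /Ex big1// => x _; rewrite big_nil mulr0.
by rewrite big_cons -IH -ExD; apply: eq_Ex => a; rewrite big_cons.
Qed.

Lemma Ex_exchange A B (d : fdist A) (d' : fdist B) (f : A -> B -> R) :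
  Ex d (fun a => Ex d' (f a)) = Ex d' (fun b => Ex d (f^~ b)).
Proof.
rewrite /Ex; under eq_bigr do rewrite mulr_sumr.
rewrite exchange_big; apply: eq_bigr => y _.
by rewrite mulr_sumr; apply: eq_bigr => x _; rewrite mulrCA.
Qed.

Section probability_laws.
Context A (d : fdist A).
Hypothesis pd : is_prob d.

Lemma Ex_cst c : Ex d (fun=> c) = c.
Proof. by rewrite -[RHS]mulr1 -pd.2 -ExZ; apply: eq_Ex => a; rewrite mulr1. Qed.

Lemma Ex_ge0 f : (forall a, 0 <= f a) -> 0 <= Ex d f.
Proof. exact: pd.1. Qed.

Lemma Ex_le f g : (forall a, f a <= g a) -> Ex d f <= Ex d g.
Proof.
by move=> fg; rewrite -subr_ge0 -ExB; apply: Ex_ge0 => a; rewrite subr_ge0.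
Qed.

Lemma Ex_norm f : `|Ex d f| <= Ex d (fun a => `|f a|).
Proof.
rewrite ler_norml -ExN; apply/andP; split; apply: Ex_le => a.
  by rewrite lerNl -normrN ler_norm.
exact: ler_norm.
Qed.

Lemma Ex_le_supp Q f g : supported d Q -> (forall a, Q a -> f a <= g a) ->
  Ex d f <= Ex d g.
Proof.
move=> sQ fg; rewrite (sQ f (fun a => if `[< Q a >] then f a else g a)).
  by apply: Ex_le => a; case: asboolP => // /fg.
by move=> a Qa; case: asboolP.
Qed.

End probability_laws.

Lemma is_prob_fdirac A (a : A) : is_prob (fdirac a).
Proof. by split => [f f0|]; rewrite Ex_fdirac. Qed.

Lemma is_prob_fmap A B (h : A -> B) d : is_prob d -> is_prob (fmap h d).
Proof.
by move=> [d0 d1]; split => [f f0|]; rewrite Ex_fmap //; apply: d0.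
Qed.

Lemma is_prob_fbind A B (d : fdist A) (k : A -> fdist B) :
  is_prob d -> (forall a, is_prob (k a)) -> is_prob (fbind d k).
Proof.
move=> pd pk; split => [f f0|]; rewrite Ex_fbind.
  by apply: Ex_ge0 => // a; exact: Ex_ge0.
by rewrite (eq_Ex _ (fun a => (pk a).2)) (Ex_cst pd).
Qed.

Lemma supported_fmap A B (h : A -> B) d (Q : B -> Prop) (Q' : A -> Prop) :
  supported d Q' -> (forall a, Q' a -> Q (h a)) -> supported (fmap h d) Q.
Proof.
by move=> dQ' hQ f g fg; rewrite !Ex_fmap; apply: dQ' => a /hQ /fg.
Qed.

Lemma supported_fbind A B (d : fdist A) (k : A -> fdist B) Q (Q' : A -> Prop) :
  supported d Q' -> (forall a, Q' a -> supported (k a) Q) ->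
  supported (fbind d k) Q.
Proof.
by move=> dQ' kQ f g fg; rewrite !Ex_fbind; apply: dQ' => a /kQ; apply.
Qed.

Lemma supportedT A (d : fdist A) : supported d (fun=> True).
Proof. by move=> f g fg; apply: eq_Ex => a; exact: fg. Qed.

Fixpoint iid A (d : fdist A) n : fdist (seq A) :=
  if n is n.+1 then fbind d (fun a => fmap (cons a) (iid d n))
  else fdirac [::].

Lemma Ex_iid0 A (d : fdist A) f : Ex (iid d 0) f = f [::].
Proof. exact: Ex_fdirac. Qed.

Lemma Ex_iidS A (d : fdist A) n f :
  Ex (iid d n.+1) f = Ex d (fun a => Ex (iid d n) (fun s => f (a :: s))).
Proof. by rewrite Ex_fbind; apply: eq_Ex => a; rewrite Ex_fmap. Qed.

Lemma Ex_iidD A (d : fdist A) m n f :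
  Ex (iid d (m + n)) f =
  Ex (iid d m) (fun s => Ex (iid d n) (fun t => f (s ++ t))).
Proof.
elim: m f => [|m IH] f; first by rewrite add0n Ex_iid0.
by rewrite addSn !Ex_iidS; apply: eq_Ex => a; rewrite IH.
Qed.

Lemma is_prob_iid A (d : fdist A) n : is_prob d -> is_prob (iid d n).
Proof.
move=> pd; elim: n => [|n IH]; first exact: is_prob_fdirac.
by apply: is_prob_fbind => // a; exact: is_prob_fmap.
Qed.

Lemma supported_iid A (d : fdist A) n : supported (iid d n) (fun s => size s = n).
Proof.
elim: n => [|n IH] f g fg; first by rewrite !Ex_iid0 fg.
rewrite !Ex_iidS; apply: eq_Ex => a; apply: IH => s sn.
by apply: fg; rewrite /= sn.
Qed.

End finite_laws.
Arguments fdirac {R A} a.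

(** * Block sums *)

Section block_sums.
Variable R : realFieldType.
Implicit Types s t : seq R.

Definition sumr s : R := \sum_(x <- s) x.

Definition scaleseq (a : R) s := [seq a * x | x <- s].

Fixpoint pairs s := if s is a :: b :: s' then (a + b) :: pairs s' else [::].

Definition blocks l s := iter l pairs s.

Lemma seq2_ind (P : seq R -> Prop) : P [::] -> (forall a, P [:: a]) ->
  (forall a b s, P s -> P (a :: b :: s)) -> forall s, P s.
Proof.
move=> P0 P1 P2 s.
suff [] : P s /\ forall a, P (a :: s) by [].
by elim: s => [|a s [IH1 IH2]]; split => // b; apply: P2.
Qed.

Lemma size_scaleseq a s : size (scaleseq a s) = size s.
Proof. exact: size_map. Qed.

Lemma scaleseq_cat a s t : scaleseq a (s ++ t) = scaleseq a s ++ scaleseq a t.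
Proof. exact: map_cat. Qed.

Lemma scaleseqA a b s : scaleseq a (scaleseq b s) = scaleseq (a * b) s.
Proof. by rewrite /scaleseq -map_comp; apply: eq_map => x /=; rewrite mulrA. Qed.

Lemma scaleseq1 s : scaleseq 1 s = s.
Proof. by rewrite -[RHS]map_id; apply: eq_map => x; rewrite mul1r. Qed.

Lemma sumr_cat s t : sumr (s ++ t) = sumr s + sumr t.
Proof. exact: big_cat. Qed.

Lemma sumr_scaleseq a s : sumr (scaleseq a s) = a * sumr s.
Proof. by rewrite /sumr /scaleseq big_map mulr_sumr. Qed.

Lemma pairs_scaleseq a s : pairs (scaleseq a s) = scaleseq a (pairs s).
Proof. by elim/seq2_ind: s => //= x y s ->; rewrite mulrDr. Qed.

Lemma blocks_scaleseq l a s : blocks l (scaleseq a s) = scaleseq a (blocks l s).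
Proof. by elim: l => //= l ->; rewrite pairs_scaleseq. Qed.

Lemma size_pairs s : size (pairs s) = (size s)./2.
Proof. by elim/seq2_ind: s => //= x y s ->. Qed.

Lemma size_blocks l m s : size s = (2 ^ (m + l))%N -> size (blocks l s) = (2 ^ m)%N.
Proof.
elim: l m => [|l IH] m; first by rewrite addn0.
by rewrite addnS -addSn => /IH /= sE; rewrite size_pairs sE expnS mul2n doubleK.
Qed.

Lemma pairs_cat s t : ~~ odd (size s) -> pairs (s ++ t) = pairs s ++ pairs t.
Proof. by elim/seq2_ind: s => //= x y s IH; rewrite negbK => /IH ->. Qed.

Lemma sumr_pairs s : ~~ odd (size s) -> sumr (pairs s) = sumr s.
Proof.
by elim/seq2_ind: s => //= x y s IH; rewrite negbK => /IH IHs;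
   rewrite /sumr !big_cons -/(sumr _) IHs addrA.
Qed.

Lemma blocks_cat l m s t : size s = (2 ^ (m + l))%N ->
  blocks l (s ++ t) = blocks l s ++ blocks l t.
Proof.
elim: l m => [//|l IH] m; rewrite addnS -addSn => sE.
rewrite /= (IH m.+1)// pairs_cat// (size_blocks sE).
by rewrite expnS mul2n odd_double.
Qed.

Lemma sumr_blocks l m s : size s = (2 ^ (m + l))%N ->
  sumr (blocks l s) = sumr s.
Proof.
elim: l m => [//|l IH] m; rewrite addnS -addSn => sE.
rewrite /= sumr_pairs ?(IH m.+1)// (size_blocks sE).
by rewrite expnS mul2n odd_double.
Qed.

Lemma blocks_all l s : size s = (2 ^ l)%N -> blocks l s = [:: sumr s].
Proof.
move=> sE; have := @size_blocks l 0 s sE; have := @sumr_blocks l 0 s sE.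
by case: blocks => [//|x [|//]]; rewrite /sumr big_seq1 => ->.
Qed.

End block_sums.

(** * The branching vector *)

Section branching.
Variables (R : realFieldType) (p : R).

Definition sign_law : fdist R R := [:: ((1 + p) / 2, 1); ((1 - p) / 2, -1)].

Lemma Ex_sign_law f : Ex sign_law f = (1 + p) / 2 * f 1 + (1 - p) / 2 * f (-1).
Proof. by rewrite /Ex big_cons big_seq1. Qed.

Lemma is_prob_sign_law : `|p| <= 1 -> is_prob sign_law.
Proof.
rewrite ler_norml => /andP[p0 p1]; split => [f f0|]; rewrite Ex_sign_law.
  by apply: addr_ge0; apply: mulr_ge0 => //; lra.
by field.
Qed.

Lemma supported_sign_law : supported sign_law (fun a => a = 1 \/ a = -1).
Proof. by move=> f g fg; rewrite !Ex_sign_law !fg; [|right|left]. Qed.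

(** The values read at the [2 ^ m] vertices of generation [m] of a binary tree
    carrying independent signs, when the product of the signs met along each
    branch is multiplied by an independent draw from [z]. *)
Fixpoint branch (z : fdist R R) m : fdist R (seq R) :=
  if m is m.+1 then
    fbind sign_law (fun a => fbind sign_law (fun b =>
      fbind (branch z m) (fun s =>
        fmap (fun t => scaleseq a s ++ scaleseq b t) (branch z m))))
  else fmap (fun x => [:: x]) z.

Lemma Ex_branch0 z f : Ex (branch z 0) f = Ex z (fun x => f [:: x]).
Proof. exact: Ex_fmap. Qed.

Lemma Ex_branchS z m f : Ex (branch z m.+1) f =
  Ex sign_law (fun a => Ex sign_law (fun b =>
    Ex (branch z m) (fun s => Ex (branch z m) (fun t =>
      f (scaleseq a s ++ scaleseq b t))))).
Proof.
rewrite Ex_fbind; apply: eq_Ex => a; rewrite Ex_fbind; apply: eq_Ex => b.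
by rewrite Ex_fbind; apply: eq_Ex => s; rewrite Ex_fmap.
Qed.

Hypothesis p1 : `|p| <= 1.

Lemma is_prob_branch z m : is_prob z -> is_prob (branch z m).
Proof.
move=> pz; elim: m => [|m IH]; first exact: is_prob_fmap.
apply: is_prob_fbind => [|a]; first exact: is_prob_sign_law.
apply: is_prob_fbind => [|b]; first exact: is_prob_sign_law.
by apply: is_prob_fbind => // s; exact: is_prob_fmap.
Qed.

Lemma supported_branch z m :
  supported (branch z m) (fun s => size s = (2 ^ m)%N).
Proof.
elim: m => [|m IH].
  by apply: supported_fmap; first exact: supportedT.
apply: supported_fbind; first exact: supportedT.
move=> a _; apply: supported_fbind; first exact: supportedT.
move=> b _; apply: supported_fbind; first exact: IH.
move=> s sE; apply: supported_fmap; first exact: IH.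
by move=> t tE; rewrite size_cat !size_scaleseq sE tE addnn expnS mul2n.
Qed.

Definition total_law z m : fdist R R := fmap (@sumr R) (branch z m).

Lemma Ex_total z m f : Ex (total_law z m) f = Ex (branch z m) (fun s => f (sumr s)).
Proof. exact: Ex_fmap. Qed.

Lemma is_prob_total z m : is_prob z -> is_prob (total_law z m).
Proof. by move=> pz; apply: is_prob_fmap; exact: is_prob_branch. Qed.

Lemma Ex_total0 z f : Ex (total_law z 0) f = Ex z f.
Proof.
by rewrite Ex_total Ex_branch0; apply: eq_Ex => x; rewrite /sumr big_seq1.
Qed.

Lemma Ex_totalS z m f : Ex (total_law z m.+1) f =
  Ex sign_law (fun a => Ex sign_law (fun b =>
    Ex (total_law z m) (fun x => Ex (total_law z m) (fun y => f (a * x + b * y))))).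
Proof.
rewrite Ex_total Ex_branchS; apply: eq_Ex => a; apply: eq_Ex => b.
rewrite Ex_total; apply: eq_Ex => s; rewrite Ex_total; apply: eq_Ex => t.
by rewrite sumr_cat !sumr_scaleseq.
Qed.

(** Self-similarity: summing the branching vector of depth [m + l] over blocks
    of length [2 ^ l] gives a branching vector of depth [m], whose leaves are
    the totals of the subtrees of depth [l]. *)
Lemma Ex_branch_blocks z m l f :
  Ex (branch z (m + l)) (fun s => f (blocks l s)) = Ex (branch (total_law z l) m) f.
Proof.
elim: m f => [|m IH] f.
  rewrite add0n Ex_branch0 Ex_total; apply: supported_branch => s sE.
  by rewrite blocks_all.
rewrite addSn !Ex_branchS; apply: eq_Ex => a; apply: eq_Ex => b.
under [RHS]eq_Ex => s do rewrite -IH.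
rewrite -[RHS](IH (fun s' => Ex _ (fun t => f (scaleseq a s' ++ scaleseq b (blocks l t))))).
apply: supported_branch => s sE; apply: eq_Ex => t.
by rewrite (@blocks_cat _ _ m) ?size_scaleseq// !blocks_scaleseq.
Qed.

Lemma Ex_branch_sum_even z m (g : R -> R) : is_prob z -> (forall x, g (- x) = g x) ->
  Ex (branch z m) (fun s => \sum_(x <- s) g x) = (2 ^ m)%:R * Ex z g.
Proof.
move=> pz ge; elim: m => [|m IH].
  by rewrite Ex_branch0 mul1r; apply: eq_Ex => x; rewrite big_seq1.
have gs a s : a = 1 \/ a = -1 ->
    \sum_(x <- scaleseq a s) g x = \sum_(x <- s) g x.
  rewrite big_map => -[] -> ; apply: eq_bigr => x _; first by rewrite mul1r.
  by rewrite mulN1r ge.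
have ps := is_prob_sign_law p1.
have pb := is_prob_branch m pz.
rewrite Ex_branchS -[RHS](Ex_cst ps); apply: supported_sign_law => a /gs ga.
rewrite -[RHS](Ex_cst ps); apply: supported_sign_law => b /gs gb.
under eq_Ex => s do under eq_Ex => t do rewrite big_cat ga gb.
under eq_Ex => s do rewrite ExD (Ex_cst pb) IH.
by rewrite ExD (Ex_cst pb) IH expnS natrM; ring.
Qed.

(** Lindeberg's replacement: the leaves of the branching vector are exchanged
    one at a time for independent draws from [g]. The random signs are frozen
    before the exchange, so a leaf is only ever compared with [g] up to sign. *)
Lemma branch_iid z g m f D c : is_prob z -> is_prob g -> c = 1 \/ c = -1 ->
  (forall s t c, c = 1 \/ c = -1 ->
    `|Ex z (fun x => f (s ++ c * x :: t)) - Ex g (fun x => f (s ++ x :: t))| <= D) ->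
  `|Ex (branch z m) (fun s => f (scaleseq c s)) - Ex (iid g (2 ^ m)) f|
    <= (2 ^ m)%:R * D.
Proof.
move=> pz pg; elim: m f c => [|m IH] f c c1 fD.
  rewrite expn0 mul1r Ex_branch0 Ex_iidS.
  under [X in _ - X]eq_Ex do rewrite Ex_iid0.
  exact: (fD [::] [::]).
have ps := is_prob_sign_law p1.
have pb := is_prob_branch m pz.
have pi := is_prob_iid (2 ^ m) pg.
set E := Ex (iid g (2 ^ m.+1)) f.
suff H a b : a = 1 \/ a = -1 -> b = 1 \/ b = -1 ->
    `|Ex (branch z m) (fun s => Ex (branch z m) (fun t =>
        f (scaleseq c (scaleseq a s ++ scaleseq b t)))) - E| <= (2 ^ m.+1)%:R * D.
  rewrite Ex_branchS -(Ex_cst ps E) -ExB; apply: (le_trans (Ex_norm ps _)).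
  rewrite -[leRHS](Ex_cst ps); apply: (Ex_le_supp ps supported_sign_law) => a a1.
  rewrite -(Ex_cst ps E) -ExB; apply: (le_trans (Ex_norm ps _)).
  rewrite -[leRHS](Ex_cst ps); apply: (Ex_le_supp ps supported_sign_law) => b b1.
  exact: H.
move=> a1 b1.
have ca1 : c * a = 1 \/ c * a = -1.
  by case: c1 => ->; case: a1 => ->; rewrite ?mul1r ?mulN1r ?opprK; [left|right|right|left].
have cb1 : c * b = 1 \/ c * b = -1.
  by case: c1 => ->; case: b1 => ->; rewrite ?mul1r ?mulN1r ?opprK; [left|right|right|left].
pose F s := Ex (iid g (2 ^ m)) (fun t => f (scaleseq (c * a) s ++ t)).
have step1 : `|Ex (branch z m) (fun s => Ex (branch z m) (fun t =>
        f (scaleseq c (scaleseq a s ++ scaleseq b t)))) - Ex (branch z m) F| <= (2 ^ m)%:R * D.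
  rewrite -ExB; apply: (le_trans (Ex_norm pb _)).
  rewrite -[leRHS](Ex_cst pb); apply: Ex_le => // s.
  under [X in X - _]eq_Ex => t do rewrite scaleseq_cat !scaleseqA.
  apply: (IH (fun t => f (scaleseq (c * a) s ++ t))) => // s' t c' c'1.
  by have := fD (scaleseq (c * a) s ++ s') t c' c'1; under eq_Ex do rewrite -catA;
    under [X in _ - X]eq_Ex do rewrite -catA.
have step2 : `|Ex (branch z m) F - E| <= (2 ^ m)%:R * D.
  rewrite /E expnS mul2n -addnn Ex_iidD [X in _ - X]Ex_exchange /F Ex_exchange.
  rewrite -ExB; apply: (le_trans (Ex_norm pi _)).
  rewrite -[leRHS](Ex_cst pi); apply: Ex_le => // t.
  apply: (IH (fun s => f (s ++ t))) => // s' t' c' c'1.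
  by have := fD s' (t' ++ t) c' c'1; under [X in _ -> `|X - _| <= _]eq_Ex do rewrite -catA;
    under [X in _ -> `|_ - X| <= _]eq_Ex do rewrite -catA.
rewrite (_ : _ - E = (Ex (branch z m) (fun s => Ex (branch z m) (fun t =>
        f (scaleseq c (scaleseq a s ++ scaleseq b t)))) - Ex (branch z m) F) +
  (Ex (branch z m) F - E)); last by ring.
apply: (le_trans (ler_normD _ _)).
rewrite expnS mul2n -addnn natrD mulrDl; exact: lerD.
Qed.

End branching.

(** * Moments of the total *)

Section moments.
Variables (R : realFieldType) (p : R).
Hypothesis p2 : 2 * p ^+ 2 <= 1.

Lemma norm_mean_le1 : `|p| <= 1.
Proof.
rewrite -(@expr_le1 _ 2)// -normrX ger0_norm ?sqr_ge0//.
by have := sqr_ge0 p; move: p2; lra.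
Qed.
Let p1 := norm_mean_le1.

(** The value at time [2 ^ l] of the walk of generation [l]. *)
Definition Z l := total_law p (fdirac 1) l.

Definition Zsqr l : R := Ex (Z l) (fun x => x ^+ 2).

Lemma is_prob_Z l : is_prob (Z l).
Proof. by apply: is_prob_total => //; exact: is_prob_fdirac. Qed.
Let pZ := is_prob_Z.

Lemma Ex_ZS l f : Ex (Z l.+1) f =
  Ex (sign_law p) (fun a => Ex (sign_law p) (fun b =>
    Ex (Z l) (fun x => Ex (Z l) (fun y => f (a * x + b * y))))).
Proof. exact: Ex_totalS. Qed.

Lemma Ex_Z0 f : Ex (Z 0) f = f 1.
Proof. by rewrite Ex_total0 Ex_fdirac. Qed.

Lemma mean_Z l : Ex (Z l) (fun x => x) = (2 * p) ^+ l.
Proof.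
elim: l => [|l IH]; first by rewrite Ex_Z0.
have E a b : Ex (Z l) (fun x => Ex (Z l) (fun y => a * x + b * y)) =
    (a + b) * (2 * p) ^+ l.
  transitivity (Ex (Z l) (fun x => a * x + b * (2 * p) ^+ l)).
    by apply: eq_Ex => x; rewrite ExD (Ex_cst (pZ l)) ExZ IH.
  by rewrite ExD (Ex_cst (pZ l)) ExZ IH; ring.
by rewrite Ex_ZS !Ex_sign_law !E exprS; field.
Qed.

Lemma Zsqr0 : Zsqr 0 = 1.
Proof. by rewrite /Zsqr Ex_Z0 expr1n. Qed.

Lemma ZsqrS l : Zsqr l.+1 = 2 * Zsqr l + 2 * p ^+ 2 * ((2 * p) ^+ l) ^+ 2.
Proof.
have E a b : Ex (Z l) (fun x => Ex (Z l) (fun y => (a * x + b * y) ^+ 2)) =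
    a ^+ 2 * Zsqr l + 2 * a * b * ((2 * p) ^+ l) ^+ 2 + b ^+ 2 * Zsqr l.
  transitivity (Ex (Z l) (fun x => a ^+ 2 * x ^+ 2 +
      (2 * a * b * (2 * p) ^+ l) * x + b ^+ 2 * Zsqr l)).
    apply: eq_Ex => x.
    transitivity (Ex (Z l) (fun y => a ^+ 2 * x ^+ 2 + (2 * a * b * x) * y +
        b ^+ 2 * y ^+ 2)); first by apply: eq_Ex => y; ring.
    rewrite !ExD (Ex_cst (pZ l)) !ExZ -/(Zsqr l).
    rewrite mean_Z.
    ring.
  rewrite !ExD (Ex_cst (pZ l)) !ExZ -/(Zsqr l).
  rewrite mean_Z.
  ring.
by rewrite {1}/Zsqr Ex_ZS !Ex_sign_law !E; field.
Qed.

Lemma Zsqr_ge0 l : 0 <= Zsqr l.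
Proof. by apply: (Ex_ge0 (pZ l)) => x; exact: sqr_ge0. Qed.

Lemma le_Zsqr_double l : 2 * Zsqr l <= Zsqr l.+1.
Proof. by rewrite ZsqrS lerDl mulr_ge0 ?sqr_ge0// mulr_ge0 ?sqr_ge0. Qed.

Lemma le_Zsqr_exp l m : 2 ^+ m * Zsqr l <= Zsqr (m + l).
Proof.
elim: m => [|m IH]; first by rewrite mul1r.
rewrite exprS -mulrA addSn; apply: le_trans (le_Zsqr_double _).
by rewrite ler_pM2l.
Qed.

(** The third moments enter only through [E X^3 E Y], which independence turns
    into [E (X^2 * X Y)]; the inequality [2 u v <= u^2 / 3 + 3 v^2] with
    [u = X^2] and [v = X Y] then reproduces the constant [9]. *)
Lemma fourth_moment_Z l : Ex (Z l) (fun x => x ^+ 4) <= 9 * Zsqr l ^+ 2.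
Proof.
elim: l => [|l IH].
  by rewrite Ex_Z0 Zsqr0 !expr1n; lra.
pose E2 g := Ex (Z l) (fun x => Ex (Z l) (fun y => g x y)).
set f4 := Ex (Z l) (fun x => x ^+ 4) in IH.
have E2D g h : E2 (fun x y => g x y + h x y) = E2 g + E2 h.
  by rewrite /E2 -ExD; apply: eq_Ex => x; rewrite ExD.
have E2Z c g : E2 (fun x y => c * g x y) = c * E2 g.
  by rewrite /E2 -ExZ; apply: eq_Ex => x; rewrite ExZ.
have E4l : E2 (fun x y => x ^+ 4) = f4.
  by apply: eq_Ex => x; rewrite (Ex_cst (pZ l)).
have E4r : E2 (fun x y => y ^+ 4) = f4 by rewrite /E2 (Ex_cst (pZ l)).
have E22 : E2 (fun x y => x ^+ 2 * y ^+ 2) = Zsqr l ^+ 2.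
  rewrite expr2 {2}/Zsqr -ExZ; apply: eq_Ex => x.
  by rewrite ExZ mulrC.
have E31 : E2 (fun x y => x ^+ 3 * y) = E2 (fun x y => x * y ^+ 3).
  by rewrite /E2 Ex_exchange; apply: eq_Ex => x; apply: eq_Ex => y; rewrite mulrC.
have E31le : 2 * E2 (fun x y => x ^+ 3 * y) <= 3^-1 * f4 + 3 * Zsqr l ^+ 2.
  rewrite -E22 -E4l -!E2Z -E2D; apply: (Ex_le (pZ l)) => x; apply: (Ex_le (pZ l)) => y.
  rewrite -subr_ge0 (_ : _ - _ = 3^-1 * (x ^+ 2 - 3 * (x * y)) ^+ 2); last by field.
  by rewrite mulr_ge0 ?invr_ge0 ?sqr_ge0.
have E a b : E2 (fun x y => (a * x + b * y) ^+ 4) = (a ^+ 4 + b ^+ 4) * f4 +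
   6 * a ^+ 2 * b ^+ 2 * Zsqr l ^+ 2 +
   4 * (a ^+ 3 * b + a * b ^+ 3) * E2 (fun x y => x ^+ 3 * y).
  transitivity (E2 (fun x y => a ^+ 4 * x ^+ 4 + (b ^+ 4 * y ^+ 4 +
     ((6 * a ^+ 2 * b ^+ 2) * (x ^+ 2 * y ^+ 2) +
     ((4 * a ^+ 3 * b) * (x ^+ 3 * y) + (4 * a * b ^+ 3) * (x * y ^+ 3)))))).
    by apply: eq_Ex => x; apply: eq_Ex => y; ring.
  by rewrite !E2D !E2Z E4l E4r E22 -E31; ring.
rewrite Ex_ZS !Ex_sign_law -!/(E2 _) !E.
set T := E2 _ in E31le *.
rewrite [leLHS](_ : _ = 2 * f4 + 6 * Zsqr l ^+ 2 + 8 * p ^+ 2 * T); last by field.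
have pT : 2 * p ^+ 2 * (2 * T) <= 3^-1 * f4 + 3 * Zsqr l ^+ 2.
  have [T0|T0] := leP T 0.
    apply: (@le_trans _ _ 0).
      by rewrite mulr_ge0_le0 ?pmulr_rle0// mulr_ge0 ?sqr_ge0.
    rewrite addr_ge0// mulr_ge0 ?sqr_ge0// ?invr_ge0//.
    by apply: (Ex_ge0 (pZ l)) => x; rewrite exprn_even_ge0.
  apply: le_trans E31le; rewrite -[leRHS]mul1r ler_wpM2r//.
  by rewrite mulr_ge0// ltW.
have vS : (2 * Zsqr l) ^+ 2 <= Zsqr l.+1 ^+ 2.
  by rewrite ler_sqr ?nnegrE ?mulr_ge0 ?Zsqr_ge0// le_Zsqr_double.
move: vS; rewrite exprMn; move: IH pT; clearbody f4 T.
move: (Zsqr l ^+ 2) (Zsqr l.+1 ^+ 2) => u v; lra.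
Qed.

End moments.

(** * Piecewise linear interpolation *)

Section interpolation.
Variable R : realFieldType.
Implicit Types (y : seq R) (s : R).

Definition clamp s : R := Num.max 0 (Num.min 1 s).

(** The interpolation at time [s] of the walk with successive steps [y]. *)
Fixpoint lin y s : R := if y is a :: y' then a * clamp s + lin y' (s - 1) else 0.

Lemma clamp_ge0 s : 0 <= clamp s. Proof. by rewrite le_max lexx. Qed.

Lemma clamp_le1 s : clamp s <= 1.
Proof. by rewrite ge_max ler01 ge_min lexx. Qed.

Lemma clamp0 s : s <= 0 -> clamp s = 0.
Proof. by move=> s0; rewrite /clamp max_l// ge_min s0 orbT. Qed.

Lemma clamp1 s : 1 <= s -> clamp s = 1.
Proof. by move=> s1; rewrite /clamp min_l// max_r. Qed.

Lemma clamp_id s : 0 <= s -> s <= 1 -> clamp s = s.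
Proof. by move=> s0 s1; rewrite /clamp min_r// max_r. Qed.

Lemma clamp_norm_le1 s : `|clamp s| <= 1.
Proof. by rewrite ger0_norm ?clamp_ge0// clamp_le1. Qed.

Lemma lin0 y s : s <= 0 -> lin y s = 0.
Proof.
by elim: y s => //= a y IH s s0; rewrite clamp0// mulr0 IH ?addr0//; lra.
Qed.

Lemma lin_scaleseq c y s : lin (scaleseq c y) s = c * lin y s.
Proof.
elim: y s => [|a y IH] s /=; first by rewrite mulr0.
by rewrite -/(scaleseq c y) IH mulrDr mulrA.
Qed.

Lemma lin_lipschitz y z z' y' s :
  `|lin (y ++ z :: y') s - lin (y ++ z' :: y') s| <= `|z - z'|.
Proof.
elim: y s => [|a y IH] s /=; last first.
  by rewrite opprD addrACA subrr add0r.
rewrite opprD addrACA subrr addr0 -mulrBl normrM.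
by rewrite -[leRHS]mulr1 ler_wpM2l// clamp_norm_le1.
Qed.

(** On the time interval where two steps are merged, replacing the broken line
    by its chord moves it by at most half the difference of the two steps. *)
Lemma lin_pairs y s B : ~~ odd (size y) -> (forall x, x \in y -> `|x| <= B) ->
  0 <= B -> `|lin y (2 * s) - lin (pairs y) s| <= B.
Proof.
move=> + + B0; elim/seq2_ind: y s => [s _ _|//|a b y IH s].
  by rewrite /= subrr normr0.
rewrite /= negbK => oy yB.
have yB' x : x \in y -> `|x| <= B by move=> xy; rewrite yB// !inE xy !orbT.
have aB : `|a| <= B by rewrite yB// !inE eqxx.
have bB : `|b| <= B by rewrite yB// !inE eqxx orbT.
rewrite (_ : 2 * s - 1 - 1 = 2 * (s - 1)); last by ring.
have [s1|s1] := leP 1 s.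
  rewrite (clamp1 s1) !clamp1; [|lra..].
  rewrite (_ : _ - _ = lin y (2 * (s - 1)) - lin (pairs y) (s - 1)); last by ring.
  exact: IH.
rewrite [lin y _]lin0 ?[lin (pairs y) _]lin0; [|lra..].
rewrite !addr0 (_ : _ - _ = a * (clamp (2 * s) - clamp s) +
  b * (clamp (2 * s - 1) - clamp s)); last by ring.
have h1 : `|clamp (2 * s) - clamp s| <= 2^-1.
  have [s0|s0] := leP s 0; first by rewrite !clamp0 ?subrr ?normr0; lra.
  rewrite (clamp_id (ltW s0) (ltW s1)).
  have [s2|s2] := leP (2 * s) 1; first by rewrite clamp_id ?ler_norml; lra.
  by rewrite (clamp1 (ltW s2)) ler_norml; lra.
have h2 : `|clamp (2 * s - 1) - clamp s| <= 2^-1.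
  have [s0|s0] := leP s 0; first by rewrite !clamp0 ?subrr ?normr0; lra.
  rewrite (clamp_id (ltW s0) (ltW s1)).
  have [s2|s2] := leP (2 * s) 1; first by rewrite clamp0 ?ler_norml; lra.
  by rewrite clamp_id ?ler_norml; lra.
apply: (le_trans (ler_normD _ _)); rewrite !normrM.
apply: (@le_trans _ _ (B * 2^-1 + B * 2^-1)); last by lra.
by apply: lerD; apply: ler_pM.
Qed.

(** Summed over the merging steps: between consecutive dyadic levels the path
    moves by at most the largest increment of the finer level. *)
Lemma lin_blocks n l y s (B : nat -> R) : size y = (2 ^ (n + l))%N ->
  (forall i, 0 <= B i) ->
  (forall i x, (i < l)%N -> x \in blocks i y -> `|x| <= B i) ->
  `|lin y (2 ^+ l * s) - lin (blocks l y) s| <= \sum_(i < l) B i.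
Proof.
move=> yE B0 yB.
suff H m : (m <= l)%N -> `|lin y (2 ^+ l * s) - lin (blocks m y) (2 ^+ (l - m) * s)| <=
    \sum_(i < m) B i by have := H l (leqnn l); rewrite subnn mul1r.
elim: m => [_|m IH ml]; first by rewrite subn0 subrr normr0 big_ord0.
rewrite big_ord_recr/=.
rewrite -[X in `|X|](subrKA (lin (blocks m y) (2 ^+ (l - m) * s))).
apply: (le_trans (ler_normD _ _)); apply: lerD; first exact/IH/ltnW.
rewrite (_ : (l - m)%N = (l - m.+1).+1); last by rewrite subnSK.
rewrite exprS -mulrA; apply: lin_pairs => // [|x]; last exact: yB.
rewrite (@size_blocks _ _ (n + (l - m))) -?addnA ?subnK ?(ltnW ml)//.
by rewrite -(subnSK ml) addnS expnS mul2n odd_double.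
Qed.

Lemma lin_increments (phi : R -> R) e i n s : 0 <= e -> 0 <= s -> s <= n%:R ->
  (forall k (u : R), (i <= k < i + n)%N -> k%:R <= u -> u <= k.+1%:R ->
    `|phi u - phi k%:R| <= e) ->
  `|lin [seq phi k.+1%:R - phi k%:R | k <- iota i n] s - (phi (i%:R + s) - phi i%:R)|
    <= 2 * e.
Proof.
move=> e0; elim: n i s => [|n IH] i s s0 sn phie.
  have -> : s = 0 by apply/eqP; rewrite eq_le s0 sn.
  by rewrite /= addr0 subrr subrr normr0 mulr_ge0.
have phii u : i%:R <= u -> u <= i.+1%:R -> `|phi u - phi i%:R| <= e.
  by apply: phie; rewrite leqnn addnS ltnS leq_addr.
have e1 : `|phi i.+1%:R - phi i%:R| <= e by apply: phii; rewrite ?ler_nat.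
have [s1|s1] := leP s 1.
  rewrite /= clamp_id// lin0 ?addr0; last by lra.
  have := phii (i%:R + s); rewrite lerDl s0 -natr1 lerD2l s1 => /(_ isT isT) e2.
  apply: (le_trans (ler_normB _ _)); rewrite normrM (ger0_norm s0).
  have -> : 2 * e = e + e by ring.
  apply: lerD => //; rewrite -[leRHS]mul1r natr1 mulrC; exact: ler_pM.
rewrite /= clamp1 ?(ltW s1)// mulr1.
have := IH i.+1 (s - 1); rewrite subr_ge0 (ltW s1) lerBlDr natr1 sn.
move=> /(_ isT isT) IH1.
rewrite (_ : _ + _ - _ = lin [seq phi k.+1%:R - phi k%:R | k <- iota i.+1 n] (s - 1)
  - (phi (i.+1%:R + (s - 1)) - phi i.+1%:R)).
  apply: IH1 => k u /andP[ik kn]; apply: phie.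
  by rewrite (ltnW ik) addnS -addSn.
rewrite (_ : i.+1%:R + (s - 1) = i%:R + s); first by ring.
by rewrite -natr1; ring.
Qed.

End interpolation.

(** * Expected oscillation between dyadic levels *)

Section chaining.
Variables (R : realFieldType) (p : R).
Hypothesis p2 : 2 * p ^+ 2 <= 1.
Let p1 := norm_mean_le1 p2.

(** Markov's inequality in disguise: a fourth-power sum dominates a maximum. *)
Lemma norm_le_sum4 (y : seq R) (x lam : R) : 0 < lam -> x \in y ->
  `|x| <= lam + (\sum_(z <- y) z ^+ 4) / lam ^+ 3.
Proof.
move=> lam0 xy.
have h0 (r : seq R) : 0 <= \sum_(z <- r) z ^+ 4.
  by apply: sumr_ge0 => z _; rewrite exprn_even_ge0.
have hx : x ^+ 4 <= \sum_(z <- y) z ^+ 4.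
  by rewrite (perm_big _ (perm_to_rem xy)) big_cons lerDl h0.
have [xl|xl] := leP `|x| lam.
  by apply: (le_trans xl); rewrite lerDl divr_ge0// exprn_ge0// ltW.
apply: (@le_trans _ _ (x ^+ 4 / lam ^+ 3)).
  have xE : x ^+ 4 = `|x| * `|x| ^+ 3.
    by rewrite -exprS -normrX ger0_norm// exprn_even_ge0.
  rewrite ler_pdivlMr ?exprn_gt0// xE ler_wpM2l// lerXn2r ?nnegrE// ltW//.
apply: (@le_trans _ _ ((\sum_(z <- y) z ^+ 4) / lam ^+ 3)).
  by rewrite ler_wpM2r// invr_ge0 exprn_ge0// ltW.
by rewrite lerDr ltW.
Qed.

Let mesh (j : nat) : R := (5 / 6) ^+ j.

Let mesh_gt0 j : 0 < mesh j. Proof. by rewrite exprn_gt0//; lra. Qed.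

(** Chaining. An increment between times of distance [2 ^- j] is compared with
    the threshold [(5 / 6) ^ j]: the thresholds are summable, and the expected
    sum of the [2 ^ j] fourth powers, of order [2 ^- j], still beats the cube
    of the threshold. Hence a bound that does not depend on [l]. *)
Lemma expected_oscillation m l (c K : R) : 0 <= K ->
  (forall i, (i <= l)%N -> c ^+ 2 * Zsqr p i <= K * 2^-1 ^+ (m + l - i)) ->
  exists2 err : seq R -> R,
    (forall y s, size y = (2 ^ (m + l))%N ->
      `|lin (scaleseq c y) (2 ^+ l * s) - lin (blocks l (scaleseq c y)) s| <= err y) &
    Ex (branch p (fdirac 1) (m + l)) err <= 8 * (1 + 9 * K ^+ 2) * (7 / 8) ^+ m.
Proof.
move=> K0 cK.
pose B i (y : seq R) := mesh (m + l - i) +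
  (\sum_(z <- blocks i (scaleseq c y)) z ^+ 4) / mesh (m + l - i) ^+ 3.
have B0 i y : 0 <= B i y.
  rewrite addr_ge0 ?(ltW (mesh_gt0 _))// divr_ge0// ?exprn_ge0 ?(ltW (mesh_gt0 _))//.
  by apply: sumr_ge0 => z _; rewrite exprn_even_ge0.
exists (fun y => \sum_(i < l) B i y) => [y s ys|].
  apply: (@lin_blocks _ m l (scaleseq c y) s (B^~ y)) => [|//|i x il xi].
    by rewrite size_scaleseq.
  exact: norm_le_sum4.
have pb := is_prob_branch p1 (m + l) (is_prob_fdirac R (1 : R)).
have EB i : (i < l)%N -> Ex (branch p (fdirac 1) (m + l)) (B i) <=
    (1 + 9 * K ^+ 2) * (7 / 8) ^+ (m + l - i).
  move=> il; set j := (m + l - i)%N.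
  have mlE : (m + l = j + i)%N by rewrite subnK// (leq_trans (ltnW il))// leq_addl.
  rewrite /B ExD (Ex_cst pb) -/j.
  under [X in _ + X]eq_Ex do rewrite mulrC.
  rewrite ExZ mlE.
  have -> : Ex (branch p (fdirac 1) (j + i))
      (fun y => \sum_(z <- blocks i (scaleseq c y)) z ^+ 4) =
      (2 ^ j)%:R * (c ^+ 4 * Ex (Z p i) (fun x => x ^+ 4)).
    transitivity (Ex (branch p (fdirac 1) (j + i))
       (fun y => \sum_(z <- blocks i y) (c * z) ^+ 4)).
      by apply: eq_Ex => y; rewrite blocks_scaleseq big_map.
    rewrite (Ex_branch_blocks p (fdirac 1) j i (fun s => \sum_(z <- s) (c * z) ^+ 4)).
    rewrite (@Ex_branch_sum_even _ _ p1 _ _ (fun z => (c * z) ^+ 4)).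
    - by congr (_ * _); rewrite -ExZ; apply: eq_Ex => z; rewrite exprMn.
    - exact: is_prob_Z.
    - by move=> x; ring.
  have c4 : c ^+ 4 * Ex (Z p i) (fun x => x ^+ 4) <= 9 * (K * 2^-1 ^+ j) ^+ 2.
    apply: (@le_trans _ _ (c ^+ 4 * (9 * Zsqr p i ^+ 2))).
      by rewrite ler_wpM2l ?exprn_even_ge0// fourth_moment_Z.
    rewrite (_ : _ * (9 * _) = 9 * (c ^+ 2 * Zsqr p i) ^+ 2); last by ring.
    rewrite ler_wpM2l// lerXn2r ?nnegrE//; last exact/cK/ltnW.
      by rewrite mulr_ge0 ?sqr_ge0// Zsqr_ge0.
    by rewrite mulr_ge0// exprn_ge0.
  have le1 : mesh j <= (7 / 8) ^+ j by rewrite lerXn2r ?nnegrE//; lra.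
  (* (5/6)^-3 / 2 = 108/125 is below 7/8, and so is 5/6 *)
  have le2 : (mesh j ^+ 3)^-1 * 2^-1 ^+ j <= (7 / 8) ^+ j.
    rewrite -exprM mulnC exprM -exprVn -exprMn lerXn2r ?nnegrE//.
    by rewrite (_ : (5 / 6) ^- 3 / 2 = 108 / 125 :> R); [lra|field].
  rewrite mulrDl mul1r; apply: lerD => //.
  apply: (@le_trans _ _ ((mesh j ^+ 3)^-1 * ((2 ^ j)%:R * (9 * (K * 2^-1 ^+ j) ^+ 2)))).
    by rewrite ler_wpM2l ?invr_ge0 ?exprn_ge0 ?(ltW (mesh_gt0 _))// ler_wpM2l.
  have -> : (mesh j ^+ 3)^-1 * ((2 ^ j)%:R * (9 * (K * 2^-1 ^+ j) ^+ 2)) =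
     9 * K ^+ 2 * ((mesh j ^+ 3)^-1 * 2^-1 ^+ j) * ((2 ^ j)%:R * 2^-1 ^+ j) by ring.
  rewrite natrX -[X in _ * X]exprMn divff// expr1n mulr1 ler_wpM2l//.
  by rewrite mulr_ge0// sqr_ge0.
rewrite Ex_sum; apply: (@le_trans _ _
    (\sum_(i < l) (1 + 9 * K ^+ 2) * (7 / 8) ^+ (m + l - i))).
  by apply: ler_sum => i _; exact: EB.
rewrite -mulr_sumr (mulrC 8) -mulrA ler_wpM2l//.
  by rewrite addr_ge0// mulr_ge0// sqr_ge0.
rewrite (reindex_inj rev_ord_inj)/=.
rewrite (eq_bigr (fun i : 'I_l => (7 / 8) ^+ m * ((7 / 8) * (7 / 8) ^+ i))); last first.
  move=> i _; rewrite -exprS -exprD; congr (_ ^+ _).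
  by rewrite -addnBA ?leq_subr// subKn.
rewrite -mulr_sumr mulrC ler_wpM2r ?exprn_ge0//.
rewrite -mulr_sumr.
have : (7 / 8 - 1) * \sum_(i < l) (7 / 8 : R) ^+ i = (7 / 8) ^+ l - 1.
  by rewrite subrX1.
have : 0 <= (7 / 8 : R) ^+ l by rewrite exprn_ge0.
by move: (\sum_(i < l) _) => S; lra.
Qed.

End chaining.

(** * Normalisation of the walk *)

Section normalisation.
Variables (R : realType) (p : R).
Hypothesis p2 : 2 * p ^+ 2 <= 1.
Let q := 2 * p ^+ 2.

Definition Zratio n : R := Zsqr p n / 2 ^+ n.

Let q0 : 0 <= q. Proof. by rewrite mulr_ge0 ?sqr_ge0. Qed.
Let exp2_gt0 n : 0 < 2 ^+ n :> R. Proof. by rewrite exprn_gt0. Qed.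

Lemma ZsqrE n : Zsqr p n = 2 ^+ n * Zratio n.
Proof. by rewrite mulrC divfK// gt_eqF. Qed.

Lemma Zratio0 : Zratio 0 = 1.
Proof. by rewrite /Zratio Zsqr0 divr1. Qed.

Lemma ZratioS n : Zratio n.+1 = Zratio n + q ^+ n.+1 / 2.
Proof.
rewrite /Zratio ZsqrS// (_ : ((2 * p) ^+ n) ^+ 2 = (2 * q) ^+ n); last first.
  by rewrite exprAC; congr (_ ^+ n); rewrite /q; ring.
rewrite exprMn -/q !exprS; field.
by rewrite gt_eqF.
Qed.

Lemma le_Zratio m n : (m <= n)%N -> Zratio m <= Zratio n.
Proof.
move=> /subnK <-; elim: (n - m)%N => [|k IH]; first by rewrite add0n.
by rewrite addSn ZratioS (le_trans IH)// lerDl divr_ge0// exprn_ge0.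
Qed.

Lemma Zratio_ge1 n : 1 <= Zratio n.
Proof. by rewrite -Zratio0 le_Zratio. Qed.

Let Zratio_gt0 n : 0 < Zratio n. Proof. exact: lt_le_trans (Zratio_ge1 n). Qed.

(** Valid both for [q < 1] and for [q = 1]: the increments of [Zratio] are
    decreasing, so the last one is at most their average. *)
Lemma exp_le_Zratio n : n.+1%:R * q ^+ n.+1 <= 2 * Zratio n.+1.
Proof.
have qS k : q ^+ k.+1 <= q ^+ k.
  by rewrite exprS ler_piMl// exprn_ge0.
suff H k : (k.+1%:R * q ^+ k.+1) <= 2 * (Zratio k.+1 - 1).
  by apply: (le_trans (H n)); lra.
elim: k => [|k IH].
  by rewrite ZratioS Zratio0 mul1r; lra.
rewrite ZratioS -natr1 mulrDl mul1r.
apply: (@le_trans _ _ (k.+1%:R * q ^+ k.+1 + q ^+ k.+2)); last lra.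
by rewrite lerD2r ler_wpM2l.
Qed.

Lemma Zratio_sub m n : Zratio (m + n) - Zratio n <= m%:R / 2 * q ^+ n.
Proof.
elim: m => [|m IH]; first by rewrite add0n subrr !mul0r.
rewrite addSn ZratioS -[m.+1%:R]natr1.
have : q ^+ (m + n).+1 <= q ^+ n.
  by rewrite -addSn exprD ler_piMl ?exprn_ge0// exprn_ile1.
by move: IH; lra.
Qed.

Variable c : nat -> R.
Hypothesis c_cvg : c n ^+ 2 * Zsqr p n @[n --> \oo] --> (1 : R).

(** The second moment at least doubles with each generation, so the earlier
    ones are controlled by the last one, which is bounded after scaling. *)
Lemma scaled_Zsqr_le : exists2 K, 0 <= K &
  forall n i, (i <= n)%N -> c n ^+ 2 * Zsqr p i <= K * 2^-1 ^+ (n - i).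
Proof.
have /cvg_seq_bounded [M [Mr HM]] : cvgn (fun n => c n ^+ 2 * Zsqr p n).
  by apply/cvg_ex; exists 1.
pose K := Num.max 0 M + 1.
exists K; first by rewrite addr_ge0// le_max lexx.
move=> n i ni.
have cn : c n ^+ 2 * Zsqr p n <= K.
  apply: (le_trans (ler_norm _)); apply: HM => //.
  by rewrite /K (@le_lt_trans _ _ (Num.max 0 M)) ?ltrDl// le_max lexx orbT.
have := le_Zsqr_exp p2 i (n - i); rewrite subnK// => H.
rewrite exprVn ler_pdivlMr// -mulrA.
apply: le_trans cn; rewrite ler_wpM2l ?sqr_ge0// mulrC//.
Qed.

(** [m] generations multiply the second moment by about [2 ^ m]: by
    [exp_le_Zratio] the relative growth of [Zratio] is of order [1 / n]. *)
Lemma cvg_scaled_Zsqr m :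
  c (m + n)%N ^+ 2 * Zsqr p n @[n --> \oo] --> (2^-1 ^+ m : R).
Proof.
have E n : c (m + n)%N ^+ 2 * Zsqr p n = 2^-1 ^+ m *
    ((c (m + n)%N ^+ 2 * Zsqr p (m + n)%N) *
     (1 - (Zratio (m + n) - Zratio n) / Zratio (m + n))).
  rewrite [X in _ = _ * (X * _)](_ : _ = c (m + n)%N ^+ 2 * (2 ^+ m * 2 ^+ n) * Zratio (m + n)); last first.
    by rewrite ZsqrE exprD mulrA.
  rewrite ZsqrE exprVn; field.
  by rewrite !gt_eqF.
under eq_cvg do rewrite E.
have c1 : c (m + n)%N ^+ 2 * Zsqr p (m + n)%N @[n --> \oo] --> (1 : R).
  under eq_cvg do rewrite addnC.
  by have := c_cvg; rewrite -(cvg_shiftn m).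
have c2 : (Zratio (m + n) - Zratio n) / Zratio (m + n) @[n --> \oo] --> (0 : R).
  rewrite -cvg_shiftS /=.
  apply: (@squeeze_cvgr _ _ _ _ (fun=> 0) (fun n => m%:R * n.+1%:R^-1)).
  - near=> n; rewrite divr_ge0 ?subr_ge0 ?le_Zratio ?leq_addl ?(ltW (Zratio_gt0 _))//=.
    rewrite ler_pdivrMr//.
    apply: (le_trans (Zratio_sub _ _)); rewrite -!mulrA ler_wpM2l//.
    apply: (@le_trans _ _ (n.+1%:R^-1 * Zratio n.+1)); last first.
      by rewrite ler_wpM2l// ?invr_ge0// le_Zratio// leq_addl.
    by rewrite ler_pdivlMl//; have := exp_le_Zratio n; lra.
  - exact: cvg_cst.
  - suff : m%:R * n.+1%:R^-1 @[n --> \oo] --> (m%:R * 0 : R) by rewrite mulr0.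
    by apply: cvgMr; exact: cvg_harmonic.
suff : 2^-1 ^+ m * ((c (m + n)%N ^+ 2 * Zsqr p (m + n)%N) *
     (1 - (Zratio (m + n) - Zratio n) / Zratio (m + n))) @[n --> \oo]
     --> (2^-1 ^+ m * (1 * (1 - 0)) : R) by rewrite subr0 !mulr1.
by apply: cvgMr; apply: cvgM => //; apply: cvgB => //; exact: cvg_cst.
Unshelve. all: end_near. Qed.

(** The squared mean is [(2 q) ^ n], which [exp_le_Zratio] bounds by
    twice the second moment divided by [n]. *)
Lemma cvg_scaled_mean m :
  c (m + n)%N * (2 * p) ^+ n @[n --> \oo] --> (0 : R).
Proof.
have := @cvg_scaled_Zsqr m; rewrite -cvg_shiftS => c1.
have c2 : c (m + n)%N ^+ 2 * ((2 * p) ^+ n) ^+ 2 @[n --> \oo] --> (0 : R).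
  rewrite -cvg_shiftS /=.
  apply: (@squeeze_cvgr _ _ _ _ (fun=> 0)
    (fun n => (c (m + n.+1)%N ^+ 2 * Zsqr p n.+1) * (2 * n.+1%:R^-1))).
  - near=> n; rewrite mulr_ge0 ?sqr_ge0//= -mulrA ler_wpM2l ?sqr_ge0//.
    rewrite (_ : ((2 * p) ^+ n.+1) ^+ 2 = 2 ^+ n.+1 * q ^+ n.+1); last first.
      by rewrite exprAC -exprMn; congr (_ ^+ _); rewrite /q; ring.
    rewrite ZsqrE -mulrA ler_wpM2l ?(ltW (exp2_gt0 _))//.
    rewrite mulrA ler_pdivlMr// mulrC (mulrC _ 2).
    exact: exp_le_Zratio.
  - exact: cvg_cst.
  - suff : (c (m + n.+1)%N ^+ 2 * Zsqr p n.+1) * (2 * n.+1%:R^-1) @[n --> \oo]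
      --> (2^-1 ^+ m * (2 * 0) : R) by rewrite !mulr0.
    by apply: cvgM => //; apply: cvgMr; exact: cvg_harmonic.
apply/cvgr0Pnorm_lt => e e0.
have e2 : 0 < e ^+ 2 by rewrite exprn_gt0.
move/cvgr0Pnorm_lt : c2 => /(_ _ e2); apply: filterS => n.
rewrite -exprMn normrX ltr_sqr ?nnegrE//; exact: ltW.
Unshelve. all: end_near. Qed.

End normalisation.

Section scaling_constants.
Variable R : realType.

(** The factor turning [Lint] into [Xfun]. *)
Definition Xscale (H : \bar R) (n : nat) : R :=
  match H with
  | h%:E => if h == 2^-1 then 2 `^ (- (n%:R * h)) / (sigma h * Num.sqrt n%:R)
            else 2 `^ (- (n%:R * h)) / (sigma h * 2 `^ (n%:R * (2^-1 - h)))
  | _ => (Num.sqrt (2 ^+ n))^-1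
  end.

Lemma two_powR_add (a b : R) : 2 `^ (a + b) = 2 `^ a * 2 `^ b :> R.
Proof. by rewrite powRD// pnatr_eq0 implybT. Qed.

Lemma two_pow_sqrE (h : R) : 2 * two_pow_subr1 h%:E ^+ 2 = 2 `^ (2 * h - 1).
Proof.
rewrite /= -powR_mulrn ?powR_ge0// -powRrM.
have {1}-> : (2 : R) = 2 `^ 1 by rewrite powRr1.
by rewrite -two_powR_add; congr (_ `^ _); ring.
Qed.

Lemma two_pow_sqr (H : \bar R) : (H <= (2^-1)%:E)%E ->
  2 * two_pow_subr1 H ^+ 2 <= 1.
Proof.
case: H => [h|//|_] /=; last by rewrite expr0n mulr0.
rewrite lee_fin => h2; rewrite two_pow_sqrE.
by apply: (@le_trans _ _ (2 `^ 0)); [rewrite ler_powR ?ler1n//; lra|rewrite powRr0].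
Qed.

(** [Zratio] sums a geometric progression of ratio [q = 2 ^ (2 H - 1)]: it is
    [1] for [H = -oo], [1 + n / 2] for [H = 1 / 2], and tends to [sigma ^ 2]
    in between. *)
Lemma cvg_Xscale (H : \bar R) : (H <= (2^-1)%:E)%E ->
  Xscale H n ^+ 2 * Zsqr (two_pow_subr1 H) n @[n --> \oo] --> (1 : R).
Proof.
move=> hH; have p2 := two_pow_sqr hH; set p := two_pow_subr1 H in p2 *.
set q := 2 * p ^+ 2 in p2.
have e2 n : 0 < 2 ^+ n :> R by rewrite exprn_gt0.
have q0 : 0 <= q by rewrite mulr_ge0 ?sqr_ge0.
case: H => [h| |] in hH p q p2 q0 *; last 2 first.
- by [].
- suff E n : Xscale -oo%E n ^+ 2 * Zsqr p n = 1.
    by under eq_cvg do rewrite E; exact: cvg_cst.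
  rewrite ZsqrE /= exprVn sqr_sqrtr ?(ltW (e2 n))//.
  have -> : Zratio p n = 1.
    elim: n => [|n IH]; first exact: Zratio0.
    by rewrite ZratioS// IH /p/= expr0n mulr0 expr0n mul0r addr0.
  by rewrite mulr1 mulVf// gt_eqF.
have qE : q = 2 `^ (2 * h - 1) by exact: two_pow_sqrE.
have pow2n (n : nat) : 2 `^ n%:R = 2 ^+ n :> R by rewrite powR_mulrn.
have powsq n : (2 `^ (- (n%:R * h))) ^+ 2 = 2 `^ (- (2 * n%:R * h)) :> R.
  by rewrite -powR_mulrn ?powR_ge0// -powRrM; congr (_ `^ _); ring.
rewrite /Xscale; case: eqVneq => [hE|hn].
  have q1 : q = 1 by rewrite qE hE mulfV ?pnatr_eq0// subrr powRr0.
  have ZE n : Zratio p n = 1 + n%:R / 2.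
    elim: n => [|n IH]; first by rewrite Zratio0 mul0r addr0.
    by rewrite ZratioS// IH -/q q1 expr1n -[n.+1%:R]natr1; field.
  rewrite -cvg_shiftS /=.
  have E n : (2 `^ (- (n.+1%:R * h)) / (sigma h * Num.sqrt n.+1%:R)) ^+ 2 *
      Zsqr p n.+1 = 1 + 2 * n.+1%:R^-1.
    rewrite ZsqrE ZE exprMn powsq exprVn exprMn sqr_sqrtr ?ler0n//.
    rewrite /sigma hE eqxx exprVn sqr_sqrtr//.
    rewrite (_ : 2 `^ (- (2 * n.+1%:R * 2^-1)) = 2 ^- n.+1); last first.
      by rewrite -pow2n -powRN; congr (_ `^ _); field.
    by field; rewrite gt_eqF//= pnatr_eq0.
  under eq_cvg do rewrite E.
  suff : 1 + 2 * n.+1%:R^-1 @[n --> \oo] --> (1 + 2 * 0 : R) by rewrite mulr0 addr0.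
  by apply: cvgD; [exact: cvg_cst|apply: cvgMr; exact: cvg_harmonic].
have h2 : h < 2^-1 by rewrite lt_neqAle hn.
have q1 : q < 1.
  rewrite qE /powR pnatr_eq0/= expR_lt1 nmulr_rlt0; first by rewrite ln_gt0// ltr1n.
  by lra.
have q_gt0 : 0 < q by rewrite qE powR_gt0.
have ZE n : Zratio p n = 1 + q * (1 - q ^+ n) / (2 * (1 - q)).
  elim: n => [|n IH]; first by rewrite Zratio0 expr0 subrr mulr0 mul0r addr0.
  by rewrite ZratioS// IH -/q !exprS; field; rewrite subr_eq0 gt_eqF.
have s2 : sigma h ^+ 2 = 1 + q / (2 * (1 - q)).
  have E : 2 `^ (2 - 2 * h) = 2 / q.
    apply: (@mulIf _ q); rewrite ?gt_eqF// divfK ?gt_eqF// {1}qE -two_powR_add.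
    by rewrite (_ : 2 - 2 * h + (2 * h - 1) = 1); [rewrite powRr1|ring].
  rewrite /sigma (negbTE hn) E.
  have -> : (2 / q - 2)^-1 = q / (2 * (1 - q)).
    by field; rewrite !gt_eqF//; lra.
  by rewrite sqr_sqrtr// addr_ge0// divr_ge0// mulr_ge0// subr_ge0 ltW.
have s2_gt0 : 0 < sigma h ^+ 2.
  by rewrite s2 ltr_wpDr// divr_ge0// mulr_ge0// subr_ge0 ltW.
have E n : (2 `^ (- (n%:R * h)) / (sigma h * 2 `^ (n%:R * (2^-1 - h)))) ^+ 2 *
    Zsqr p n = (sigma h ^+ 2)^-1 * Zratio p n.
  rewrite ZsqrE exprMn powsq exprVn exprMn.
  have -> : 2 ^+ n = (2 `^ (n%:R * (2^-1 - h))) ^+ 2 / 2 `^ (- (2 * n%:R * h)).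
    rewrite -(powR_mulrn 2 (powR_ge0 _ _)) -powRrM -pow2n.
    apply: (canRL (mulfK _)); first by rewrite gt_eqF// powR_gt0.
    by rewrite -two_powR_add; congr (_ `^ _); field.
  move: s2_gt0; move: (sigma h ^+ 2) => s s_gt0.
  have := powR_gt0 (n%:R * (2^-1 - h)) (ltr0Sn R 1).
  have := powR_gt0 (- (2 * n%:R * h)) (ltr0Sn R 1).
  move: (_ `^ _) (_ `^ _) => u v u0 v0; field.
  by rewrite !gt_eqF.
under eq_cvg do rewrite E ZE.
suff : (sigma h ^+ 2)^-1 * (1 + q * (1 - q ^+ n) * (2 * (1 - q))^-1) @[n --> \oo]
    --> ((sigma h ^+ 2)^-1 * (1 + q * (1 - 0) * (2 * (1 - q))^-1) : R).
  by rewrite subr0 mulr1 -s2 mulVf// gt_eqF.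
apply: cvgMr; apply: cvgD; first exact: cvg_cst.
apply: cvgMl; apply: cvgMr; apply: cvgB; first exact: cvg_cst.
by apply: cvg_expr; rewrite ger0_norm.
Qed.

End scaling_constants.

(** * Smoothing Lipschitz functions *)

Section smoothing.
Variable R : realType.
Notation mu := (@lebesgue_measure R).

Definition lips (L : R) (g : R -> R) := forall x y, `|g x - g y| <= L * `|x - y|.

Lemma lips_continuous L g : lips L g -> continuous g.
Proof.
move=> gL x; apply/cvgrPdist_lt => e e0.
have L1 : 0 < `|L| + 1 by rewrite ltr_wpDl.
near=> y.
apply: (le_lt_trans (gL _ _)); apply: (@le_lt_trans _ _ ((`|L| + 1) * `|x - y|)).
  by rewrite ler_wpM2r// (le_trans (ler_norm _))// lerDl.
rewrite -ltr_pdivlMl//; near: y.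
by apply: (@nbhsx_ballx _ R^o); rewrite mulr_gt0// invr_gt0.
Unshelve. all: end_near. Qed.

Lemma antiderivative (g : R -> R) : continuous g ->
  exists G : R -> R, forall x : R, is_derive x 1 G (g x).
Proof.
move=> cg.
have ig (a b : R) : mu.-integrable `[a, b] (EFin \o g).
  apply: continuous_compact_integrable; first exact: segment_compact.
  exact: continuous_subspaceT.
pose G (x : R) := if 0 <= x then (\int[mu]_(t in `]0, x]) g t)%R
           else - (\int[mu]_(t in `]x, 0%R]) g t)%R.
(* left of its base point F n differs from G, so the base point has to vary *)
pose F (n : nat) (x : R) :=
  (\int[mu]_(t in `[(- n.+1%:R)%R, x]) g t)%R - (\int[mu]_(t in `[(- n.+1%:R)%R, 0%R]) g t)%R.
have GF n x : - n.+1%:R <= x -> G x = F n x.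
  move=> nx; rewrite /G /F; case: ifPn => [x0|].
    by rewrite Rintegral_itvB// bnd_simp// oppr_le0.
  rewrite -ltNge => x0.
  by rewrite -opprB Rintegral_itvB// bnd_simp// ltW.
exists G => x; pose n := (Num.truncn `|x|).+1.
have xn : `|x| < n%:R by rewrite /n truncnS_gt.
have nx : - n.+1%:R < x.
  rewrite ltrNl; apply: (le_lt_trans (ler_norm _)); rewrite normrN.
  by apply: (lt_trans xn); rewrite ltr_nat.
apply: (@near_eq_is_derive _ _ _ (F n)) => //.
  near=> y; apply/esym/GF; apply: ltW; near: y.
  exact: lt_nbhsr.
have x1 : x < x + 1 by rewrite ltrDl.
have [D1 D2] := continuous_FTC1_closed x1 (ig (- n.+1%:R) _) nx (cg x).
rewrite /F -[g x]subr0.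
apply: is_deriveB.
rewrite -D2 derive1E; exact: DeriveDef.
Unshelve. all: end_near. Qed.

(** The mean value theorem, without an order between the endpoints. *)
Lemma mean_value (G g : R -> R) (x y : R) :
  (forall x : R, is_derive x 1 G (g x)) ->
  exists2 z, `|z - x| <= `|y - x| & G y - G x = g z * (y - x).
Proof.
move=> dG.
have cG : continuous G.
  by move=> z; apply: differentiable_continuous; apply/derivable1_diffP; exact: ex_derive.
have [xy|yx] := leP x y.
  have [z zI ->] := @MVT_segment _ G g x y xy (fun x _ => dG x) (continuous_subspaceT cG).
  move: zI; rewrite in_itv/= => /andP[xz zy]; exists z => //.
  by rewrite !ger0_norm ?subr_ge0// lerB.
have [z zI E] := @MVT_segment _ G g y x (ltW yx) (fun x _ => dG x) (continuous_subspaceT cG).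
move: zI; rewrite in_itv/= => /andP[xz zy]; exists z.
  by rewrite !ler0_norm ?subr_le0 ?(ltW yx)// !opprB lerB.
by rewrite -opprB E; ring.
Qed.

(** Averaging [g] over [x + u + v] with [u], [v] uniform in [0, dl] costs
    [2 L dl] and gains two derivatives: with [G1' = g] and [G2' = G1] the average
    is the second difference of [G2] over [dl ^ 2], and [G2] has a Taylor
    expansion of order two whose remainder is cubic because [g] is Lipschitz. *)
Lemma smooth_lips (L dl : R) (g : R -> R) : 0 < dl -> 0 <= L -> lips L g ->
  exists h h1 h2 : R -> R, [/\
    (forall x, `|h x - g x| <= 4 * L * dl),
    (forall x u, `|h (x + u) - h x - u * h1 x - u ^+ 2 / 2 * h2 x|
      <= 4 * L / dl ^+ 2 * `|u| ^+ 3),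
    (forall x, `|h1 x| <= 3 * L) &
    (forall x, `|h2 x| <= 2 * L / dl)].
Proof.
move=> dl0 L0 gL.
have [G1 dG1] := antiderivative (lips_continuous gL).
have cG1 : continuous G1.
  by move=> z; apply: differentiable_continuous; apply/derivable1_diffP; exact: ex_derive.
have [G2 dG2] := antiderivative cG1.
have T1 x u : `|G1 (x + u) - G1 x - u * g x| <= L * u ^+ 2.
  have [z] := mean_value x (x + u) dG1; rewrite addrAC subrr add0r => zx ->.
  rewrite (mulrC (g z)) -mulrBr normrM.
  apply: (@le_trans _ _ (`|u| * (L * `|u|))).
    by rewrite ler_wpM2l// (le_trans (gL _ _))// ler_wpM2l.
  by rewrite -real_normK ?num_real// mulrCA -expr2.
have T2 x u : `|G2 (x + u) - G2 x - u * G1 x - u ^+ 2 / 2 * g x| <= L * `|u| ^+ 3.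
  pose D : R -> R := G2 - cst (G1 x) * (id - cst x) -
    cst (g x / 2) * ((id - cst x) ^+ 2).
  have dD (y : R) : is_derive y 1 D (G1 y - G1 x - (y - x) * g x).
    by apply: is_derive_eq; rewrite !scaler0 !addr0 !subr0 /GRing.scale/= !fctE /=; field.
  have [z] := mean_value x (x + u) dD; rewrite addrAC subrr add0r => zx E.
  rewrite (_ : _ - _ = D (x + u) - D x); last first.
    by rewrite /D !fctE /=; ring.
  rewrite E normrM exprSr.
  rewrite mulrA ler_wpM2r//.
  have := T1 x (z - x); rewrite (addrC x) subrK => /le_trans; apply.
  by rewrite ler_wpM2l// -real_normK ?num_real// lerXn2r ?nnegrE.
have d0 : dl != 0 by rewrite gt_eqF.
pose D2 (k : R -> R) x := (k (x + dl + dl) - 2 * k (x + dl) + k x) / dl ^+ 2.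
have gd x : `|g (x + dl) - g x| <= L * dl.
  by apply: (le_trans (gL _ _)); rewrite addrAC subrr add0r gtr0_norm.
have d2 : 0 < dl ^+ 2 by rewrite exprn_gt0.
exists (D2 G2), (D2 G1), (D2 g); split.
- move=> x.
  have Ha := T2 (x + dl) dl; have Hb := T2 x dl; have Hc := T1 x dl.
  have Hd := gd x.
  have -> : D2 G2 x - g x =
     ((G2 (x + dl + dl) - G2 (x + dl) - dl * G1 (x + dl) - dl ^+ 2 / 2 * g (x + dl))
     - (G2 (x + dl) - G2 x - dl * G1 x - dl ^+ 2 / 2 * g x)
     + dl * (G1 (x + dl) - G1 x - dl * g x)
     + dl ^+ 2 / 2 * (g (x + dl) - g x)) / dl ^+ 2 by rewrite /D2; field.
  rewrite normrM normfV [`|dl ^+ 2|]gtr0_norm// ler_pdivrMr//.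
  have E3 : L * `|dl| ^+ 3 = L * dl * dl ^+ 2 by rewrite gtr0_norm//; ring.
  have Hc' : `|dl * (G1 (x + dl) - G1 x - dl * g x)| <= L * dl * dl ^+ 2.
    rewrite normrM gtr0_norm// (_ : L * dl * _ = dl * (L * dl ^+ 2)); last by ring.
    by rewrite ler_pM2l.
  have Hd' : `|dl ^+ 2 / 2 * (g (x + dl) - g x)| <= L * dl * dl ^+ 2.
    rewrite normrM [`|dl ^+ 2 / 2|]gtr0_norm ?divr_gt0// mulrC.
    by apply: ler_pM => //; [rewrite divr_ge0// ltW|rewrite ler_pdivrMr//; lra].
  rewrite (_ : 4 * L * dl * dl ^+ 2 = 4 * (L * dl * dl ^+ 2)); last by ring.
  move: Ha Hb Hc' Hd'; rewrite E3.
  move: (L * dl * dl ^+ 2) => w; rewrite !ler_norml.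
  move=> /andP[? ?] /andP[? ?] /andP[? ?] /andP[? ?]; apply/andP; split; lra.
- move=> x u.
  have -> : D2 G2 (x + u) - D2 G2 x - u * D2 G1 x - u ^+ 2 / 2 * D2 g x =
    ((G2 (x + dl + dl + u) - G2 (x + dl + dl) - u * G1 (x + dl + dl) -
        u ^+ 2 / 2 * g (x + dl + dl)) -
     2 * (G2 (x + dl + u) - G2 (x + dl) - u * G1 (x + dl) - u ^+ 2 / 2 * g (x + dl)) +
     (G2 (x + u) - G2 x - u * G1 x - u ^+ 2 / 2 * g x)) / dl ^+ 2.
    rewrite /D2 (_ : x + u + dl + dl = x + dl + dl + u); last by ring.
    by rewrite (_ : x + u + dl = x + dl + u); [field|ring].
  rewrite normrM normfV [`|dl ^+ 2|]gtr0_norm//.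
  rewrite (_ : 4 * L / dl ^+ 2 * `|u| ^+ 3 = 4 * (L * `|u| ^+ 3) / dl ^+ 2); last by ring.
  rewrite ler_pM2r ?invr_gt0//.
  have := T2 (x + dl + dl) u; have := T2 (x + dl) u; have := T2 x u.
  move: (L * `|u| ^+ 3) => w; rewrite !ler_norml.
  move=> /andP[? ?] /andP[? ?] /andP[? ?]; apply/andP; split; lra.
- move=> x.
  have -> : D2 G1 x =
    ((G1 (x + dl + dl) - G1 (x + dl) - dl * g (x + dl)) - (G1 (x + dl) - G1 x - dl * g x)
     + dl * (g (x + dl) - g x)) / dl ^+ 2 by rewrite /D2; field.
  rewrite normrM normfV [`|dl ^+ 2|]gtr0_norm// ler_pdivrMr// -mulrA.
  have H3 : `|dl * (g (x + dl) - g x)| <= L * dl ^+ 2.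
    rewrite normrM gtr0_norm// (_ : L * _ = dl * (L * dl)); last by ring.
    by rewrite ler_pM2l.
  have := T1 (x + dl) dl; have := T1 x dl; move: H3.
  move: (L * dl ^+ 2) => w; rewrite !ler_norml.
  move=> /andP[? ?] /andP[? ?] /andP[? ?]; apply/andP; split; lra.
move=> x.
have -> : D2 g x = ((g (x + dl + dl) - g (x + dl)) - (g (x + dl) - g x)) / dl ^+ 2.
  by rewrite /D2; field.
rewrite normrM normfV [`|dl ^+ 2|]gtr0_norm// ler_pdivrMr//.
rewrite (_ : 2 * L / dl * dl ^+ 2 = 2 * (L * dl)); last by field.
have := gd (x + dl); have := gd x.
move: (L * dl) => w; rewrite !ler_norml.
by move=> /andP[? ?] /andP[? ?]; apply/andP; split; lra.
Qed.

(** One step of Lindeberg's method: two laws with nearly equal first and second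
    moments and small fourth moments integrate [h (x + .)] nearly equally. The
    cubic remainder is split by [2 |u|^3 <= e u^2 + u^4 / e]. *)
Lemma lindeberg_step (h h1 h2 : R -> R) (M e : R) (z w : fdist R R) x :
  0 < e -> is_prob z -> is_prob w ->
  (forall x u, `|h (x + u) - h x - u * h1 x - u ^+ 2 / 2 * h2 x| <= M * `|u| ^+ 3) ->
  (forall x, `|h1 x| <= M) -> (forall x, `|h2 x| <= M) ->
  `|Ex z (fun u => h (x + u)) - Ex w (fun u => h (x + u))| <=
    M * (`|Ex z (fun u => u) - Ex w (fun u => u)| +
         `|Ex z (fun u => u ^+ 2) - Ex w (fun u => u ^+ 2)| +
         (e * Ex z (fun u => u ^+ 2) + Ex z (fun u => u ^+ 4) / e) +
         (e * Ex w (fun u => u ^+ 2) + Ex w (fun u => u ^+ 4) / e)).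
Proof.
move=> e0 pz pw T h1M h2M.
have M0 : 0 <= M by apply: le_trans (h1M 0).
pose r u := h (x + u) - h x - u * h1 x - u ^+ 2 / 2 * h2 x.
have split_h d : is_prob d -> Ex d (fun u => h (x + u)) = h x + h1 x * Ex d (fun u => u)
    + h2 x / 2 * Ex d (fun u => u ^+ 2) + Ex d r.
  move=> pd; rewrite -{1}(Ex_cst pd (h x)) -!ExZ -!ExD; apply: eq_Ex => u.
  by rewrite /r; field.
have r_le d : is_prob d -> `|Ex d r| <= M * (e * Ex d (fun u => u ^+ 2) + Ex d (fun u => u ^+ 4) / e).
  move=> pd; rewrite [X in M * (_ + X)]mulrC -!ExZ -ExD -ExZ.
  apply: (le_trans (Ex_norm pd _)); apply: Ex_le => // u.
  apply: (le_trans (T x u)); rewrite ler_wpM2l//.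
  rewrite -(@ler_pM2l _ e)//.
  rewrite -[u ^+ 2]real_normK ?num_real// (_ : u ^+ 4 = `|u| ^+ 4); last first.
    by rewrite -normrX ger0_norm// exprn_even_ge0.
  move: (normr_ge0 u); move: `|u| => v v0.
  rewrite -subr_ge0.
  rewrite (_ : _ - _ = v ^+ 2 * ((v - e / 2) ^+ 2 + 3 / 4 * e ^+ 2)); last first.
    by field; rewrite gt_eqF.
  by rewrite mulr_ge0 ?sqr_ge0// addr_ge0 ?sqr_ge0// mulr_ge0 ?sqr_ge0// divr_ge0.
have rz := r_le z pz; have rw := r_le w pw.
rewrite (split_h z pz) (split_h w pw).
set a1 := Ex z _; set a2 := Ex w _; set b1 := Ex z _; set b2 := Ex w _.
have A : `|h1 x * (a1 - a2)| <= M * `|a1 - a2| by rewrite normrM ler_wpM2r.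
have B : `|h2 x / 2 * (b1 - b2)| <= M * `|b1 - b2|.
  rewrite normrM ler_wpM2r// normrM (le_trans _ (h2M x))// ler_piMr//.
  by rewrite ger0_norm; lra.
rewrite (_ : _ - _ = h1 x * (a1 - a2) + h2 x / 2 * (b1 - b2) + (Ex z r - Ex w r)); last by ring.
rewrite !(mulrDr M) -[leRHS]addrA -/b1 -/b2.
move: rz rw A B; rewrite -/b1 -/b2 !mulrDr.
move: (M * `|_|) (M * `|_|) (M * _) (M * _) (M * _) (M * _) => c1 c2 c3 c4 c5 c6.
move: (h1 x * _) (h2 x / 2 * _) (Ex z r) (Ex w r) => k1 k2 k3 k4.
rewrite !ler_norml.
move=> /andP[? ?] /andP[? ?] /andP[? ?] /andP[? ?]; apply/andP; split; lra.
Qed.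

End smoothing.

(** * Lindeberg's bound for the total *)

Section lindeberg.
Variables (R : realType) (p : R).
Hypothesis p2 : 2 * p ^+ 2 <= 1.
Let p1 := norm_mean_le1 p2.

Lemma Ex_branch_fmap_scale z m C (f : seq R -> R) :
  Ex (branch p (fmap ( *%R C) z) m) f = Ex (branch p z m) (fun s => f (scaleseq C s)).
Proof.
elim: m f => [|m IH] f; first by rewrite !Ex_branch0 Ex_fmap.
rewrite !Ex_branchS; apply: eq_Ex => a; apply: eq_Ex => b.
rewrite IH; apply: eq_Ex => s; rewrite IH; apply: eq_Ex => t.
by rewrite scaleseq_cat !scaleseqA ![C * _]mulrC.
Qed.

(** [g] is smoothed at scale [dl], at a cost of order [dl] for each of the two
    sums, and the summands of the smoothed functional are exchanged. *)
Lemma lindeberg (z w : fdist R R) l (L dl e c : R) (g : R -> R) :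
  is_prob z -> is_prob w -> c = 1 \/ c = -1 -> 0 < dl -> 0 < e -> 0 <= L -> lips L g ->
  `|Ex (branch p z l) (fun s => g (c * sumr s)) -
    Ex (iid w (2 ^ l)) (fun s => g (sumr s))| <=
  8 * L * dl + 2 ^+ l * ((3 * L + 2 * L / dl + 4 * L / dl ^+ 2) *
    (`|Ex z (fun u => u)| + `|Ex w (fun u => u)| +
     `|Ex z (fun u => u ^+ 2) - Ex w (fun u => u ^+ 2)| +
     (e * Ex z (fun u => u ^+ 2) + Ex z (fun u => u ^+ 4) / e) +
     (e * Ex w (fun u => u ^+ 2) + Ex w (fun u => u ^+ 4) / e))).
Proof.
move=> pz pw c1 dl0 e0 L0 gL.
have [h [h1 [h2 [hg T h1M h2M]]]] := smooth_lips dl0 L0 gL.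
set M := 3 * L + _ + _.
have M1 : 0 <= 2 * L / dl by rewrite divr_ge0 ?mulr_ge0// ltW.
have M2 : 0 <= 4 * L / dl ^+ 2 by rewrite divr_ge0 ?sqr_ge0// mulr_ge0.
have M0 : 0 <= M by rewrite !addr_ge0// mulr_ge0.
have pb := is_prob_branch p1 l pz.
have pi := is_prob_iid (2 ^ l) pw.
set m1 := Ex z (fun u => u); set n1 := Ex w (fun u => u).
set m2 := Ex z (fun u => u ^+ 2); set n2 := Ex w (fun u => u ^+ 2).
set m4 := Ex z (fun u => u ^+ 4); set n4 := Ex w (fun u => u ^+ 4).
set S := _ + _ + _ + _ + _.
have c2 (c' : R) : c' = 1 \/ c' = -1 -> c' ^+ 2 = 1.
  by case=> ->; rewrite ?sqrrN expr1n.
have step : `|Ex (branch p z l) (fun s => h (c * sumr s)) -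
    Ex (iid w (2 ^ l)) (fun s => h (sumr s))| <= (2 ^ l)%:R * (M * S).
  under eq_Ex => s do rewrite -sumr_scaleseq.
  apply: (@branch_iid _ p p1 z w l (fun s => h (sumr s))) => // s t c' c'1.
  have E d (k : R) : Ex d (fun x => h (sumr (s ++ k * x :: t))) =
      Ex (fmap ( *%R k) d) (fun u => h (sumr s + sumr t + u)).
    rewrite Ex_fmap; apply: eq_Ex => x; congr h.
    by rewrite sumr_cat [sumr (_ :: _)]/sumr big_cons -/(sumr t); ring.
  have Ew : Ex w (fun x => h (sumr (s ++ x :: t))) =
      Ex w (fun u => h (sumr s + sumr t + u)).
    apply: eq_Ex => x; congr h.
    by rewrite sumr_cat [sumr (_ :: _)]/sumr big_cons -/(sumr t); ring.
  rewrite E Ew.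
  apply: (le_trans (lindeberg_step (M := M) (h1 := h1) (h2 := h2) _ e0 _ pw _ _ _)).
  - exact: is_prob_fmap.
  - move=> x u; apply: (le_trans (T x u)); rewrite ler_wpM2r ?exprn_ge0//.
    by rewrite /M lerDr addr_ge0// mulr_ge0.
  - by move=> x; apply: (le_trans (h1M x)); rewrite /M; lra.
  - by move=> x; apply: (le_trans (h2M x)); rewrite /M; lra.
  rewrite ler_wpM2l// /S !Ex_fmap.
  have -> : Ex z (fun a => (c' * a) ^+ 2) = m2.
    by apply: eq_Ex => a; rewrite exprMn (c2 _ c'1) mul1r.
  have -> : Ex z (fun a => (c' * a) ^+ 4) = m4.
    by apply: eq_Ex => a; rewrite exprMn (exprM c' 2 2) (c2 _ c'1) expr1n mul1r.
  have -> : Ex z (fun a => c' * a) = c' * m1 by rewrite ExZ.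
  rewrite !lerD2r; apply: (le_trans (ler_normB _ _)); rewrite normrM lerD2r.
  by case: c'1 => ->; rewrite ?normrN normr1 mul1r.
have errz : `|Ex (branch p z l) (fun s => g (c * sumr s)) -
    Ex (branch p z l) (fun s => h (c * sumr s))| <= 4 * L * dl.
  rewrite -ExB -[leRHS](Ex_cst pb); apply: (le_trans (Ex_norm pb _)).
  by apply: Ex_le => // s; rewrite distrC.
have errw : `|Ex (iid w (2 ^ l)) (fun s => h (sumr s)) -
    Ex (iid w (2 ^ l)) (fun s => g (sumr s))| <= 4 * L * dl.
  rewrite -ExB -[leRHS](Ex_cst pi); apply: (le_trans (Ex_norm pi _)).
  by apply: Ex_le.
move: errz errw step; rewrite natrX.
move: (2 ^+ l * _) => B.
rewrite (_ : 8 * L * dl = 4 * L * dl + 4 * L * dl); last by ring.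
move: (4 * L * dl) => D; rewrite !ler_norml.
move=> /andP[? ?] /andP[? ?] /andP[? ?]; apply/andP; split; lra.
Qed.

End lindeberg.

(** * Independent finitely valued random variables *)

Section finitely_valued.
Context (R : realType) d (T : measurableType d) (P : probability T R).
Variables (I : eqType) (X : I -> T -> R) (V : seq R) (w : R -> R).
Hypothesis mX : forall i v, measurable (X i @^-1` [set v]).
Hypothesis XV : forall i x, X i x \in V.
Hypothesis uV : uniq V.
Hypothesis Xw : forall i v, v \in V -> P (X i @^-1` [set v]) = (w v)%:E.
Hypothesis indepX : mutually_independent P X.

Definition weighted : fdist R R := [seq (w v, v) | v <- V].

Let big_range i : \big[setU/set0]_(v <- V) (X i @^-1` [set v]) = setT.
Proof.
apply/seteqP; split => // x _; rewrite -bigcup_seq.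
by exists (X i x) => //=; exact: XV.
Qed.

(** [f] is an arbitrary function: only finitely many lists occur. *)
Lemma measurable_finite_valued (s : seq I) (f : seq R -> R) (Y : set R) :
  measurable ((fun x => f (map (X^~ x) s)) @^-1` Y).
Proof.
elim: s f => [|i s IH] f.
  have [Yf|Yf] := pselect (Y (f [::])).
    by rewrite (_ : _ @^-1` _ = setT)//; apply/seteqP; split.
  by rewrite (_ : _ @^-1` _ = set0)//; apply/seteqP; split.
rewrite -[X in measurable X]setIT -(big_range i) big_distrr/=.
apply: bigsetU_measurable => v _.
rewrite (_ : _ `&` _ = (fun x => f (v :: map (X^~ x) s)) @^-1` Y `&` X i @^-1` [set v]).
  by apply: measurableI; [exact: (IH (fun t => f (v :: t)))|exact: mX].
by apply/seteqP; split => x /= [Yx xv]; subst v.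
Qed.

Lemma measurable_fun_finite_valued (s : seq I) (f : seq R -> R) :
  measurable_fun setT (fun x => f (map (X^~ x) s)).
Proof. by move=> _ Y mY; rewrite setTI; exact: measurable_finite_valued. Qed.

Let event (s : seq I) (A : I -> set R) := \bigcap_(i in [set` s]) (X i @^-1` A i).

(** Induction on the list [s] of the variables still free; [event] fixes the
    values of those already read, so that independence applies to products of
    preimages only. *)
Let integral_event (s' s : seq I) (A : I -> set R) (f : seq R -> R) :
  uniq (s' ++ s) -> (forall i, i \in s' -> exists v, A i = [set v]) ->
  (\int[P]_(x in event s' A) (f (map (X^~ x) s))%:E)%E =
    (fine (P (event s' A)) * Ex (iid weighted (size s)) f)%:E.
Proof.
have mevent t B : (forall i, i \in t -> exists v, B i = [set v]) ->
    measurable (event t B).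
  elim: t => [|i t IH] tB; first by rewrite /event set_nil bigcap_set0.
  rewrite (_ : event _ _ = (X i @^-1` B i) `&` event t B).
    apply: measurableI; last by apply: IH => j jt; apply: tB; rewrite inE jt orbT.
    by have [v ->] := tB i (mem_head _ _).
  apply/seteqP; split => x.
    move=> H; split; first by apply: H; exact: mem_head.
    by move=> j /= jt; apply: H; rewrite /= inE jt orbT.
  by move=> [H1 H2] j /=; rewrite inE => /predU1P[->//|]; exact: H2.
elim: s s' A f => [|i s IH] s' A f us sA.
  rewrite Ex_iid0 EFinM muleC fineK ?fin_num_measure//; last exact: mevent.
  by rewrite /= integral_cst//; exact: mevent.
have is' : i \notin s'.
  by move: us; rewrite cat_uniq => /and3P[_ /hasPn/(_ i (mem_head _ _))].
pose B v := event s' A `&` X i @^-1` [set v].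
have BU : event s' A = \big[setU/set0]_(v <- V) B v.
  by rewrite -[LHS]setIT -(big_range i) big_distrr.
pose A' v j := if j == i then [set v] else A j.
have A'E v : event (i :: s') (A' v) = B v.
  apply/seteqP; split => x.
    move=> H; split; last by have := H i; rewrite /A' eqxx; apply; exact: mem_head.
    move=> j /= js; have := H j; rewrite /A' (_ : (j == i) = false); last first.
      by apply: contraNF is' => /eqP <-.
    by apply; rewrite /= inE js orbT.
  move=> [H1 H2] j /=; rewrite inE /A' => /predU1P[->|js]; first by rewrite eqxx.
  rewrite (_ : (j == i) = false); first exact: H1.
  by apply: contraNF is' => /eqP <-.
have A'1 v j : j \in i :: s' -> exists v', A' v j = [set v'].
  rewrite inE /A'; case: eqP => [_ _|_ /= /sA//]; by exists v.
have PB v : v \in V -> fine (P (B v)) = fine (P (event s' A)) * w v.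
  move=> vV; rewrite -A'E.
  have uis' : uniq (i :: s') by move: us; rewrite /= is' cat_uniq => /and3P[->].
  rewrite /event indepX//; last by move=> j /(A'1 v)[v' ->].
  rewrite big_cons {1}/A' eqxx Xw// indepX//; last 2 first.
  - by move: uis' => /= /andP[].
  - by move=> j /sA[v' ->].
  rewrite (eq_big_seq (fun j => P (X j @^-1` A j))); last first.
    move=> j js; rewrite /A' (_ : (j == i) = false)//.
    by apply: contraNF is' => /eqP <-.
  rewrite muleC fineM//.
  rewrite -indepX//; last 2 first.
  - by move: uis' => /= /andP[].
  - by move=> j /sA[v' ->].
  by rewrite fin_num_measure//; exact: (mevent s' A).
rewrite {1}BU integral_bigsetU_EFin//; last 3 first.
- by move=> v; rewrite -A'E; apply: mevent; exact: A'1.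
- by move=> u v _ _ [x [[_ /= <-] [_ /= <-]]].
- by apply/measurable_EFinP; apply: measurable_funTS; exact: (measurable_fun_finite_valued (i :: s)).
rewrite [size _]/= Ex_iidS {1}/Ex big_map mulr_sumr -sumEFin big_seq [RHS]big_seq.
apply: eq_bigr => v vV.
transitivity (\int[P]_(x in B v) (f (v :: map (X^~ x) s))%:E)%E.
  by apply: eq_integral => x; rewrite inE => -[_ /= ->].
rewrite -A'E (IH _ _ (fun t => f (v :: t)))//; last 2 first.
- move: us; rewrite -cat1s catA.
  by rewrite (perm_uniq (_ : perm_eq _ ((i :: s') ++ s)))// perm_cat2r perm_catC.
- exact: A'1.
by rewrite A'E PB// mulrA.
Qed.

Lemma integral_finite_valued (s : seq I) (f : seq R -> R) : uniq s ->
  (\int[P]_x (f (map (X^~ x) s))%:E)%E = (Ex (iid weighted (size s)) f)%:E.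
Proof.
move=> us; have := @integral_event [::] s (fun=> setT) f us.
by rewrite /event set_nil bigcap_set0 probability_setT mul1r; exact.
Qed.

End finitely_valued.

(** * Moments of the normal law *)

Section density.
Context d (T : measurableType d) (R : realType).
Variables (mu nu : {measure set T -> \bar R}) (h : T -> R).
Hypothesis h0 : forall x, 0 <= h x.
Hypothesis mh : measurable_fun setT h.
Hypothesis nuE : forall A, measurable A -> nu A = (\int[mu]_(x in A) (h x)%:E)%E.
Import HBNNSimple.

Lemma ge0_integral_density (f : T -> R) : measurable_fun setT f ->
  (forall x, 0 <= f x) ->
  (\int[nu]_x (f x)%:E = \int[mu]_x (f x * h x)%:E)%E.
Proof.
move=> mf f0.
have mEf : measurable_fun setT (EFin \o f) by exact/measurable_EFinP.
pose f_ := nnsfun_approx measurableT mEf.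
have fcvg x : (f_ n x)%:E @[n --> \oo] --> (f x)%:E.
  by apply: (@cvg_nnsfun_approx _ _ _ _ measurableT _ mEf) => // y _; rewrite /= lee_fin.
transitivity (limn (fun n => \int[nu]_x (f_ n x)%:E)%E).
  rewrite -monotone_convergence//.
  - by apply: eq_integral => y _; apply/esym/cvg_lim => //; exact: fcvg.
  - by move=> n; exact/measurable_EFinP/measurable_funP.
  - by move=> n y _; rewrite lee_fin.
  - by move=> y _ m n mn; rewrite lee_fin; exact/lefP/nd_nnsfun_approx.
transitivity (limn (fun n => \int[mu]_x (f_ n x * h x)%:E)%E); last first.
  rewrite -monotone_convergence//.
  - apply: eq_integral => y _; apply/cvg_lim => //.
    have : ((f_ n y)%:E * (h y)%:E)%E @[n --> \oo] --> ((f y)%:E * (h y)%:E)%E.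
      by apply: cvgeZr => //; exact: fcvg.
    exact.
  - by move=> n; apply/measurable_EFinP/measurable_funM => //; exact: measurable_funP.
  - by move=> n y _; rewrite lee_fin mulr_ge0.
  - by move=> y _ m n mn; rewrite lee_fin ler_wpM2r//; exact/lefP/nd_nnsfun_approx.
congr (limn _); apply/funext => n; move: (f_ n) => g.
have mg r : measurable (g @^-1` [set r]) by [].
transitivity (\sum_(k \in range g) \int[nu]_x (k * \1_(g @^-1` [set k]) x)%:E)%E.
  rewrite -ge0_integral_fsum//.
  - by apply: eq_integral => x _; rewrite fsumEFin// -fimfunE.
  - by move=> r; exact/measurable_EFinP/measurable_funM.
  - by move=> r x _; rewrite nnfun_muleindic_ge0.
transitivity (\sum_(k \in range g) \int[mu]_x (k * \1_(g @^-1` [set k]) x * h x)%:E)%E; last first.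
  rewrite -ge0_integral_fsum//.
  - apply: eq_integral => x _; rewrite fsumEFin//; congr EFin.
    by rewrite [in RHS](fimfunE g) mulr_fsuml.
  - move=> r; apply/measurable_EFinP/measurable_funM => //.
    exact: measurable_funM.
  - by move=> r x _; rewrite EFinM mule_ge0 ?nnfun_muleindic_ge0 ?lee_fin.
apply: eq_fsbigr => r; rewrite inE => -[y _ yr].
have r0 : 0 <= r by rewrite -yr.
under eq_integral do rewrite EFinM.
rewrite ge0_integralZl//; last by exact/measurable_EFinP.
rewrite integral_indic// setIT nuE//.
under [RHS]eq_integral do rewrite -mulrA EFinM.
rewrite ge0_integralZl//; last 2 first.
- by apply/measurable_EFinP/measurable_funM.
- by move=> x _; rewrite lee_fin mulr_ge0.
congr (_ * _)%E; rewrite [LHS]integral_mkcond; apply: eq_integral => x _.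
rewrite patchE indicE; case: ifPn => _; first by rewrite mul1r.
by rewrite mul0r.
Qed.

Lemma integral_density (f : T -> R) : measurable_fun setT f ->
  (\int[nu]_x (f x)%:E = \int[mu]_x (f x * h x)%:E)%E.
Proof.
move=> mf; rewrite integralE [RHS]integralE.
have E k x : ((fun x => (k x * h x)%:E)^\+ x = (Num.max (k x) 0 * h x)%:E)%E.
  by rewrite funeposE /= maxr_pMl// mul0r EFin_max.
have E' k x : ((fun x => (k x * h x)%:E)^\- x = (Num.max (- k x) 0 * h x)%:E)%E.
  by rewrite funenegE /= maxr_pMl// mul0r mulNr EFin_max.
have G k : (\int[nu]_x (fun x => (k x)%:E)^\+ x = \int[nu]_x (Num.max (k x) 0)%:E)%E.
  by apply: eq_integral => x _; rewrite funeposE EFin_max.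
have G' k : (\int[nu]_x (fun x => (k x)%:E)^\- x = \int[nu]_x (Num.max (- k x) 0)%:E)%E.
  by apply: eq_integral => x _; rewrite funenegE EFin_max.
rewrite G G' (eq_integral _ _ (fun x _ => E f x)) (eq_integral _ _ (fun x _ => E' f x)).
by congr (_ - _)%E; apply: (@ge0_integral_density (fun x => Num.max _ 0)) => [|x];
  rewrite ?le_max ?lexx ?orbT//; apply: measurable_maxr => //; exact: measurable_funN.
Qed.

Lemma integrable_density (f : T -> R) : measurable_fun setT f ->
  nu.-integrable setT (EFin \o f) -> mu.-integrable setT (fun x => (f x * h x)%:E).
Proof.
move=> mf /integrableP[_ fi]; apply/integrableP; split.
  by apply/measurable_EFinP/measurable_funM.
move: fi; rewrite (ge0_integral_density (f := fun x => `|f x|))//; last exact: measurableT_comp.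
rewrite (eq_integral (fun x => `|(f x * h x)%:E|%E))// => x _.
by rewrite /= normrM (ger0_norm (h0 x)).
Qed.

End density.

Section full_line.
Variable R : realType.
Notation mu := (@lebesgue_measure R).

(** Fundamental theorem of calculus on the whole line, for an antiderivative
    whose values at [n] and [-n] become equal. *)
Lemma integral_derivative0 (F f : R -> R) : (forall x : R, is_derive x 1 F (f x)) ->
  continuous f -> mu.-integrable setT (EFin \o f) ->
  F n%:R - F (- n%:R) @[n --> \oo] --> (0 : R) ->
  (\int[mu]_x (f x)%:E = 0)%E.
Proof.
move=> dF cf fi F0.
have cF : continuous F.
  by move=> z; apply: differentiable_continuous; apply/derivable1_diffP; exact: ex_derive.
have mEf : measurable_fun setT (EFin \o f) by apply/measurable_EFinP; exact: continuous_measurable_fun.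
pose g (n : nat) x := ((EFin \o f) \_ `[- n%:R, n%:R]%classic) x.
have mg n : measurable_fun setT (g n).
  by apply: (measurable_restrictT _ _).1 => //; exact: measurable_funTS.
have [|||_ _ H] := @dominated_convergence _ _ _ mu setT measurableT g (EFin \o f)
  (fun x => `|f x|%:E) mg mEf.
- apply/aeW => x _; apply: cvg_near_cst; near=> n.
  rewrite /g patchE ifT//; apply/mem_set => /=; rewrite in_itv/= -ler_norml.
  near: n; exact: nbhs_infty_ger.
- exact: integrable_norm.
- by apply/aeW => x n _; rewrite /g patchE; case: ifPn; rewrite /= ?normr0// lee_fin.
have E n : (\int[mu]_x g n.+1 x = (F n.+1%:R - F (- n.+1%:R))%:E)%E.
  rewrite /g -integral_mkcond EFinB; apply: continuous_FTC2 => //.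
  - by rewrite gtrN.
  - exact: continuous_subspaceT.
  - split.
    + by move=> x _; exact: ex_derive.
    + by apply: cvg_at_right_filter; exact: cF.
    + by apply: cvg_at_left_filter; exact: cF.
  - by move=> x _; rewrite derive1E; exact: derive_val.
apply: (cvg_unique _ H); first exact: ereal_hausdorff.
rewrite /= -cvg_shiftS /=; under eq_cvg do rewrite E.
apply: cvg_EFin; first exact: nearW.
by move: F0; rewrite -cvg_shiftS.
Unshelve. all: end_near. Qed.

End full_line.

Section normal_moments.
Variables (R : realType) (s : R).
Hypothesis s0 : 0 < s.
Notation mu := (@lebesgue_measure R).
Let nu : probability (measurableTypeR R) R := normal_prob 0 s.
Let h := normal_pdf 0 s.

Let sn0 : s != 0. Proof. by rewrite gt_eqF. Qed.

Let ss0 : s ^+ 2 + s ^+ 2 != 0.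
Proof. by rewrite -mulr2n mulrn_eq0 expf_eq0 (negbTE sn0). Qed.

Let hE x : h x = normal_peak s * expR (- x ^+ 2 / (s ^+ 2 *+ 2)).
Proof. by rewrite /h normal_pdfE// /normal_fun subr0. Qed.

Let h_ge0 x : 0 <= h x. Proof. exact: normal_pdf_ge0. Qed.
Let mh : measurable_fun setT h. Proof. exact: measurable_normal_pdf. Qed.
Let ch : continuous h. Proof. exact: continuous_normal_pdf. Qed.
Let hN x : h (- x) = h x. Proof. by rewrite !hE sqrrN. Qed.

Let nuE (A : set (measurableTypeR R)) : measurable A -> nu A = (\int[mu]_(x in A) (h x)%:E)%E.
Proof. by []. Qed.

Let dh (x : R) : is_derive x 1 h (- (x / s ^+ 2) * h x).
Proof.
pose g : R -> R := cst (normal_peak s) * (expR \o (cst (- (s ^+ 2 *+ 2)^-1) * id ^+ 2)).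
have -> : h = g.
  by apply/funext => y; rewrite hE /g !fctE /=; congr (_ * expR _); rewrite mulNr mulrC mulNr.
apply: is_derive_eq; rewrite !scaler0 !addr0 ?add0r /GRing.scale/= !fctE /=.
rewrite /g !fctE /= mulr2n.
move: (expR _) => E; field.
by rewrite sn0 ss0.
Qed.

(** Bounding [y ^ 2] by [4 exp y] trades the weight [x ^ 4] for a doubling of
    the standard deviation. *)
Let h4_le x : x ^+ 4 * h x <= 512 * s ^+ 4 * normal_pdf 0 (2 * s) x.
Proof.
have s2 : 2 * s != 0 by rewrite mulf_neq0.
rewrite hE [in leRHS]normal_pdfE// /normal_fun subr0.
have -> : normal_peak (2 * s) = normal_peak s / 2.
  rewrite /normal_peak (_ : (2 * s) ^+ 2 * pi *+ 2 = 2 ^+ 2 * (s ^+ 2 * pi *+ 2)); last first.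
    by rewrite exprMn -!mulrA !mulrnAr.
  by rewrite sqrtrM ?sqr_ge0// sqrtr_sqr ger0_norm// invfM mulrC.
set y := x ^+ 2 / (8 * s ^+ 2).
have y0 : 0 <= y by rewrite divr_ge0 ?sqr_ge0// mulr_ge0// sqr_ge0.
have -> : - x ^+ 2 / (s ^+ 2 *+ 2) = - (4 * y).
  by rewrite /y mulr2n; field; rewrite sn0 ss0.
have -> : - x ^+ 2 / ((2 * s) ^+ 2 *+ 2) = - y.
  by rewrite /y mulr2n; field; rewrite sn0 -mulr2n mulrn_eq0 expf_eq0 (negbTE s2).
have -> : x ^+ 4 = 64 * s ^+ 4 * y ^+ 2 by rewrite /y; field; rewrite sn0.
have yE : y ^+ 2 <= 4 * expR y.
  have -> : expR y = expR (y / 2) ^+ 2 by rewrite -expRM_natl -mulrC divfK.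
  have H : y / 2 <= expR (y / 2) by apply: le_trans (expR_ge1Dx _); rewrite lerDr.
  have : (y / 2) ^+ 2 <= expR (y / 2) ^+ 2.
    have y2 : 0 <= y / 2 by lra.
    by rewrite lerXn2r ?nnegrE ?expR_ge0.
  by rewrite exprMn exprVn; lra.
rewrite (_ : 512 * s ^+ 4 * (_ / 2 * _) = 64 * s ^+ 4 * (normal_peak s * (4 * expR (- y)))); last first.
  by field.
rewrite -mulrA ler_pM2l ?mulr_gt0 ?exprn_gt0//.
rewrite mulrCA ler_pM2l ?normal_peak_gt0//.
apply: (@le_trans _ _ (4 * expR y * expR (- (4 * y)))).
  by rewrite ler_wpM2r// expR_ge0.
rewrite -mulrA -expRD ler_pM2l// ler_expR; lra.
Qed.

(** [C] keeps the numeral folded, which unification would compute in unary. *)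
Lemma normal_moment4 (C : R) : C = 512 ->
  (\int[nu]_x (x ^+ 4)%:E <= (C * s ^+ 4)%:E)%E.
Proof.
move=> CE; have C0 : 0 <= C by rewrite CE; exact: ler0n.
have le_C x : x ^+ 4 * h x <= C * s ^+ 4 * normal_pdf 0 (2 * s) x.
  by rewrite CE; exact: h4_le.
move: le_C C0; clear CE => le_C C0.
rewrite (@ge0_integral_density _ (measurableTypeR R) R mu nu h h_ge0 mh nuE (fun x => x ^+ 4)); last 2 first.
- exact: exprn_measurable.
- by move=> x; rewrite exprn_even_ge0.
apply: (@le_trans _ _ (\int[mu]_x (C * s ^+ 4 * normal_pdf 0 (2 * s) x)%:E)%E).
  apply: ge0_le_integral => //.
  - by move=> x _; rewrite lee_fin mulr_ge0// exprn_even_ge0.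
  - by apply/measurable_EFinP/measurable_funM => //; exact: exprn_measurable.
  - by apply/measurable_EFinP/measurable_funM => //; exact: measurable_normal_pdf.
  - by move=> x _; rewrite lee_fin.
under eq_integral do rewrite EFinM.
rewrite ge0_integralZl// ?integral_normal_pdf ?mule1//.
- by apply/measurable_EFinP; exact: measurable_normal_pdf.
- by move=> x _; rewrite lee_fin normal_pdf_ge0.
- by rewrite lee_fin mulr_ge0// exprn_ge0// ltW.
Qed.

Lemma normal_integrable (f : R -> R) : measurable_fun setT f ->
  (forall x, `|f x| <= 1 + x ^+ 4) -> nu.-integrable setT (EFin \o f).
Proof.
move=> mf fle; apply: (@le_integrable _ (measurableTypeR R) R nu setT measurableT _ (fun x => (1 + x ^+ 4)%:E)) => //.
- exact/measurable_EFinP.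
- move=> x _ /=; rewrite lee_fin [leRHS]ger0_norm//.
  by rewrite addr_ge0// exprn_even_ge0.
have i4 : nu.-integrable setT (fun x : R => (x ^+ 4)%:E).
  apply/integrableP; split; first by apply/measurable_EFinP; exact: exprn_measurable.
  apply: le_lt_trans (ltry (512 * s ^+ 4)); apply: le_trans (normal_moment4 erefl).
  rewrite le_eqVlt; apply/orP; left; apply/eqP; apply: eq_integral => x _.
  by rewrite /= ger0_norm// exprn_even_ge0.
apply: (eq_integrable (mu := nu) measurableT (fun x : R => 1%:E + (x ^+ 4)%:E)%E) => //.
apply: integrableD => //.
exact: finite_measure_integrable_cst.
Qed.

Let pow_le (x : R) : `|x| <= 1 + x ^+ 4 /\ `|x ^+ 2| <= 1 + x ^+ 4.
Proof.
have h1 : 0 <= x ^+ 2 by exact: sqr_ge0.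
have h2 := sqr_ge0 (x ^+ 2 - 2^-1).
have h3 : x ^+ 2 <= 3 / 4 + x ^+ 4.
  by rewrite -subr_ge0 (_ : _ - _ = (x ^+ 2 - 2^-1) ^+ 2 + 2^-1); [lra|field].
split; last by rewrite ger0_norm//; lra.
have h4 := sqr_ge0 (x - 2^-1); have h5 := sqr_ge0 (x + 2^-1).
have h6 : x <= x ^+ 2 + 4^-1.
  by rewrite -subr_ge0 (_ : _ - _ = (x - 2^-1) ^+ 2); [|field].
have h7 : - x <= x ^+ 2 + 4^-1.
  by rewrite -subr_ge0 (_ : _ - _ = (x + 2^-1) ^+ 2); [|field].
by rewrite ler_norml; apply/andP; split; lra.
Qed.

Lemma normal_integrable1 : nu.-integrable setT (fun x : R => x%:E).
Proof. by apply: (@normal_integrable id) => // x; case: (pow_le x). Qed.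

Lemma normal_integrable2 : nu.-integrable setT (fun x : R => (x ^+ 2)%:E).
Proof.
apply: (@normal_integrable (fun x => x ^+ 2)) => [|x]; first exact: exprn_measurable.
by case: (pow_le x).
Qed.

Lemma normal_moment1 : (\int[nu]_x x%:E = 0)%E.
Proof.
rewrite (@integral_density _ (measurableTypeR R) R mu nu h h_ge0 mh nuE id)//.
have ih := @integrable_density _ (measurableTypeR R) R mu nu h h_ge0 mh nuE id (@measurable_id _ _ _) normal_integrable1.
apply: (@integral_derivative0 _ (cst (- s ^+ 2) * h) (fun x => x * h x)) => //.
- move=> x; have dhx := dh x.
  apply: is_derive_eq; rewrite ?scaler0 ?addr0 /GRing.scale/= ?fctE /=; move: (h x) => k; by field; rewrite ?sn0.
- by move=> x; apply: cvgM => //; exact: ch.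
- rewrite [X in X @ _](_ : _ = fun=> 0); first exact: cvg_cst.
  by apply/funext => n; rewrite !fctE /= hN subrr.
Qed.

Lemma normal_moment2 : (\int[nu]_x (x ^+ 2)%:E = (s ^+ 2)%:E)%E.
Proof.
have m2 : measurable_fun setT (fun x : R => x ^+ 2) by exact: exprn_measurable.
rewrite (@integral_density _ (measurableTypeR R) R mu nu h h_ge0 mh nuE (fun x => x ^+ 2))//.
have i2 := @integrable_density _ (measurableTypeR R) R mu nu h h_ge0 mh nuE _ m2 normal_integrable2.
have ih : mu.-integrable setT (fun x => (s ^+ 2 * h x)%:E).
  under eq_fun do rewrite EFinM.
  by apply: integrableZl => //; exact: integrable_normal_pdf.
have iB : mu.-integrable setT (fun x => (x ^+ 2 * h x)%:E - (s ^+ 2 * h x)%:E)%E.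
  exact: integrableB.
have E0 : (\int[mu]_x (x ^+ 2 * h x - s ^+ 2 * h x)%:E = 0)%E.
  apply: (@integral_derivative0 _ (cst (- s ^+ 2) * (id * h)) (fun x => x ^+ 2 * h x - s ^+ 2 * h x)).
  - move=> x; have dhx := dh x.
    apply: is_derive_eq; rewrite ?scaler0 ?addr0 /GRing.scale/= ?fctE /=; move: (h x) => k; by field; rewrite ?sn0.
  - move=> x; apply: cvgB; apply: cvgM; try exact: ch; try exact: cvg_cst.
    exact: sqr_continuous.
  - exact: iB.
  - have [K hK] : exists K, forall x, x ^+ 4 * h x <= K.
      have C0 : 0 <= 512 :> R by exact: ler0n.
      move: h4_le C0; move: (512 : R) => C hC C0.
      exists (C * s ^+ 4 * normal_peak (2 * s)) => x.
      apply: le_trans (hC x) _; rewrite ler_wpM2l//.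
        by rewrite mulr_ge0// exprn_ge0// ltW.
      by apply: normal_pdf_ub; rewrite mulf_neq0.
    rewrite -cvg_shiftS /=; apply/norm_cvg0P.
    apply: (@squeeze_cvgr _ _ _ _ (fun=> 0) (fun n => 2 * s ^+ 2 * K * n.+1%:R^-1)).
    + near=> n; rewrite normr_ge0/= !fctE /= hN.
      set m : R := n.+1%:R; have m1 : 1 <= m by rewrite ler1n.
      have m0 : 0 < m by exact: lt_le_trans m1.
      rewrite (_ : _ - _ = - (2 * s ^+ 2 * (m * h m))); last by ring.
      rewrite normrN ger0_norm; last by rewrite !mulr_ge0// ltW.
      rewrite -[leRHS]mulrA ler_wpM2l//; first by rewrite mulr_ge0// sqr_ge0.
      rewrite ler_pdivlMr//; apply: le_trans (hK m).
      rewrite (_ : m ^+ 4 * h m = m * h m * m * m ^+ 2); last by ring.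
      by rewrite ler_peMr ?exprn_ege1// !mulr_ge0// ltW.
    + exact: cvg_cst.
    + suff : 2 * s ^+ 2 * K * n.+1%:R^-1 @[n --> \oo] --> (2 * s ^+ 2 * K * 0 : R).
        by rewrite mulr0.
      by apply: cvgMr; exact: cvg_harmonic.
transitivity (\int[mu]_x ((x ^+ 2 * h x - s ^+ 2 * h x)%:E + (s ^+ 2 * h x)%:E))%E.
  by apply: eq_integral => x _; rewrite -EFinD subrK.
rewrite integralD//.
rewrite E0 add0e; under eq_integral do rewrite EFinM.
rewrite integralZl//; last exact: integrable_normal_pdf.
by rewrite integral_normal_pdf mule1.
Unshelve. all: end_near. Qed.

End normal_moments.

(** * Discretisation of Gaussian samples *)

Section expectation.
Context (R : realType) d (T : measurableType d) (P : probability T R).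

Definition mean (X : T -> R) : R := fine (\int[P]_x (X x)%:E).

Lemma bounded_integrable (X : T -> R) M : measurable_fun setT X ->
  (forall x, `|X x| <= M) -> P.-integrable setT (EFin \o X).
Proof.
move=> mX XM; apply: (@le_integrable _ _ _ _ _ measurableT _ (cst M%:E)).
- exact/measurable_EFinP.
- by move=> x _ /=; rewrite lee_fin (le_trans (XM x))// ler_norm.
- exact: finite_measure_integrable_cst.
Qed.

Lemma meanE (X : T -> R) : P.-integrable setT (EFin \o X) ->
  (\int[P]_x (X x)%:E = (mean X)%:E)%E.
Proof. by move=> iX; rewrite /mean fineK//; exact: integrable_fin_num. Qed.

Lemma meanD (X Y : T -> R) : P.-integrable setT (EFin \o X) ->
  P.-integrable setT (EFin \o Y) -> mean (fun x => X x + Y x) = mean X + mean Y.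
Proof.
move=> iX iY; apply: EFin_inj; rewrite EFinD -!meanE//; last first.
  rewrite (_ : _ \o _ = (fun x => (X x)%:E + (Y x)%:E)%E)//; exact: integrableD.
by rewrite -integralD.
Qed.

Lemma meanZ c (X : T -> R) : P.-integrable setT (EFin \o X) ->
  mean (fun x => c * X x) = c * mean X.
Proof.
move=> iX; apply: EFin_inj; rewrite EFinM -!meanE//; last first.
  rewrite (_ : _ \o _ = (fun x => c%:E * (X x)%:E)%E)//; exact: integrableZl.
by rewrite -integralZl.
Qed.

Lemma meanB (X Y : T -> R) : P.-integrable setT (EFin \o X) ->
  P.-integrable setT (EFin \o Y) -> mean (fun x => X x - Y x) = mean X - mean Y.
Proof.
move=> iX iY; apply: EFin_inj; rewrite EFinB -!meanE//; last first.
  rewrite (_ : _ \o _ = (fun x => (X x)%:E - (Y x)%:E)%E)//; exact: integrableB.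
by rewrite -integralB.
Qed.

Lemma mean_cst c : mean (cst c) = c.
Proof.
rewrite /mean /= integral_cst// -[RHS]/(fine c%:E) -[in RHS](mule1 c%:E).
by congr (fine (_ * _)%E); exact: probability_setT.
Qed.

Lemma le_mean (X Y : T -> R) : P.-integrable setT (EFin \o X) ->
  P.-integrable setT (EFin \o Y) -> (forall x, X x <= Y x) -> mean X <= mean Y.
Proof.
move=> iX iY XY; rewrite -lee_fin -!meanE//; apply: le_integral => //.
by move=> x _; rewrite lee_fin.
Qed.

Lemma norm_mean_le (X Y : T -> R) : P.-integrable setT (EFin \o X) ->
  P.-integrable setT (EFin \o Y) -> (forall x, `|X x| <= Y x) -> `|mean X| <= mean Y.
Proof.
move=> iX iY XY; rewrite ler_norml; apply/andP; split.
  rewrite lerNl -mulN1r -meanZ//; apply: le_mean => // [|x].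
    rewrite (_ : _ \o _ = (fun x => (-1)%:E * (X x)%:E)%E)//; exact: integrableZl.
  by rewrite mulN1r (le_trans _ (XY x))// -normrN ler_norm.
by apply: le_mean => // x; rewrite (le_trans _ (XY x))// ler_norm.
Qed.

Lemma mean_sum I (r : seq I) (X : I -> T -> R) :
  (forall i, P.-integrable setT (EFin \o X i)) ->
  mean (fun x => \sum_(i <- r) X i x) = \sum_(i <- r) mean (X i) /\
  P.-integrable setT (EFin \o (fun x => \sum_(i <- r) X i x)).
Proof.
move=> iX; elim: r => [|i r [IH1 IH2]].
  rewrite (_ : (fun x => _) = cst 0); last by apply/funext => x; rewrite big_nil.
  rewrite big_nil mean_cst; split => //.
  exact: finite_measure_integrable_cst.
rewrite (_ : (fun x => _) = (fun x => X i x + \sum_(j <- r) X j x)); last first.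
  by apply/funext => x; rewrite big_cons.
split; first by rewrite big_cons meanD// IH1.
rewrite (_ : _ \o _ = (fun x => (X i x)%:E + (\sum_(j <- r) X j x)%:E)%E)//.
by apply: integrableD => //; exact: iX.
Qed.

Lemma cvg_mean (X : nat -> T -> R) (Y G : T -> R) :
  (forall n, measurable_fun setT (X n)) -> measurable_fun setT Y ->
  {ae P, forall x, X n x @[n --> \oo] --> Y x} ->
  P.-integrable setT (EFin \o G) -> (forall n x, `|X n x| <= G x) ->
  mean (X n) @[n --> \oo] --> mean Y.
Proof.
move=> mX mY XY iG XG.
have [|||||iY _ H] := @dominated_convergence _ _ _ P setT measurableT
  (fun n x => (X n x)%:E) (EFin \o Y) (EFin \o G).
- by move=> n; exact/measurable_EFinP.
- exact/measurable_EFinP.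
- by apply: filterS XY => x Xx _; apply: cvg_EFin; [exact: nearW|].
- exact: iG.
- by apply/aeW => x n _; rewrite lee_fin.
by apply: fine_cvg; rewrite -meanE.
Qed.

End expectation.

Section discretisation.
Variable R : realType.
Import HBNNSimple.

Let nnsfun_le (f : R -> R) (mf : measurable_fun setT (EFin \o f)) (f0 : forall x, 0 <= f x)
    (fn := nnsfun_approx measurableT mf) x :
  fn K x @[K --> \oo] --> f x /\ forall K, fn K x <= f x.
Proof.
have c : fn K x @[K --> \oo] --> f x.
  apply: (@fine_cvg _ _ _ _ (fun K => (fn K x)%:E)).
  by apply: (@cvg_nnsfun_approx _ _ _ _ measurableT _ mf) => // y _; rewrite /= lee_fin.
split => // K; rewrite -(cvg_lim _ c)//.
apply: nondecreasing_cvgn_le; last by apply/cvg_ex; exists (f x).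
by move=> m n mn; exact/lefP/nd_nnsfun_approx.
Qed.

(** Positive and negative parts are approximated separately, so that [|x|]
    dominates every approximation of [x]. *)
Lemma discretise : exists q : nat -> R -> R, [/\
  (forall K, measurable_fun setT (q K)),
  (forall K, exists V : seq R, uniq V /\ forall x, q K x \in V),
  (forall K x, `|q K x| <= `|x|) &
  (forall x, q K x @[K --> \oo] --> x)].
Proof.
pose fp (x : R) := Num.max x 0; pose fm (x : R) := Num.max (- x) 0.
have fp0 x : 0 <= fp x by rewrite le_max lexx orbT.
have fm0 x : 0 <= fm x by rewrite le_max lexx orbT.
have mp : measurable_fun setT (EFin \o fp).
  by apply/measurable_EFinP; apply: measurable_maxr.
have mm : measurable_fun setT (EFin \o fm).
  by apply/measurable_EFinP; apply: measurable_maxr => //; exact: measurable_funN.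
pose p := nnsfun_approx measurableT mp; pose m := nnsfun_approx measurableT mm.
have [Hp Hm] := (nnsfun_le mp fp0, nnsfun_le mm fm0).
exists (fun K x => p K x - m K x); split.
- by move=> K; apply: measurable_funB; exact: measurable_funP.
- move=> K.
  have : finite_set [set a - b | a in range (p K) & b in range (m K)].
    by apply: finite_image2; exact: fimfunP.
  move=> /finite_seqP[V VE]; exists (undup V); split; first exact: undup_uniq.
  move=> x; rewrite mem_undup.
  have : [set a - b | a in range (p K) & b in range (m K)] (p K x - m K x).
    by exists (p K x); [exists x|exists (m K x); [exists x|]].
  by rewrite VE.
- move=> K x; have [_ /(_ K) Hp'] := Hp x; have [_ /(_ K) Hm'] := Hm x.
  have p0 : 0 <= p K x by [].
  have m0 : 0 <= m K x by [].
  move: Hp' Hm'; rewrite -/p -/m /fp /fm.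
  have /orP[x0|x0] := le_total 0 x.
    rewrite (max_l x0) (max_r (_ : - x <= 0)) ?oppr_le0// => px mx.
    by rewrite (ger0_norm x0) ler_norml; apply/andP; split; lra.
  rewrite (max_r x0) (max_l (_ : 0 <= - x)) ?oppr_ge0// => px mx.
  by rewrite (ler0_norm x0) ler_norml; apply/andP; split; lra.
- move=> x; have [cp _] := Hp x; have [cm _] := Hm x.
  have : p K x - m K x @[K --> \oo] --> fp x - fm x by exact: cvgB.
  suff -> : fp x - fm x = x by [].
  rewrite /fp /fm; have /orP[x0|x0] := le_total 0 x.
    by rewrite (max_l x0) (max_r (_ : - x <= 0)) ?oppr_le0// subr0.
  by rewrite (max_r x0) (max_l (_ : 0 <= - x)) ?oppr_ge0// opprK add0r.
Qed.

End discretisation.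

Definition seqlips (R : realFieldType) (L : R) (f : seq R -> R) :=
  forall s z z' t, `|f (s ++ z :: t) - f (s ++ z' :: t)| <= L * `|z - z'|.

Lemma seqlips_map (R : realFieldType) (L : R) f I (r : seq I) (h h' : I -> R) :
  seqlips L f ->
  `|f (map h r) - f (map h' r)| <= L * \sum_(i <- r) `|h i - h' i|.
Proof.
move=> fL; suff H s : `|f (s ++ map h r) - f (s ++ map h' r)| <=
  L * \sum_(i <- r) `|h i - h' i| by exact: (H [::]).
elim: r s => [|i r IH] s /=; first by rewrite subrr normr0 big_nil mulr0.
rewrite big_cons mulrDr.
rewrite -[X in `|X|](subrKA (f (s ++ h' i :: map h r))).
apply: (le_trans (ler_normD _ _)); apply: lerD; first exact: fL.
by rewrite -!cat_rcons.
Qed.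

Section same_law.
Context (R : realType) d (T : measurableType d) (P : probability T R).
Variables (nu : probability (measurableTypeR R) R) (U : T -> R).
Hypothesis mU : measurable_fun setT U.
Hypothesis PU : forall A, measurable A -> P (U @^-1` A) = nu A.

Lemma mean_comp (g : R -> R) : measurable_fun setT g ->
  nu.-integrable setT (EFin \o g) ->
  P.-integrable setT (EFin \o (g \o U)) /\ mean P (g \o U) = mean nu g.
Proof.
move=> mg ig.
have E (k : R -> \bar R) : (\int[nu]_x k x = \int[pushforward P (U : T -> measurableTypeR R)]_x k x)%E.
  by apply: eq_measure_integral => A mA _; exact/esym/PU.
have mEg : measurable_fun setT (EFin \o g) by exact/measurable_EFinP.
have igU : P.-integrable setT (EFin \o (g \o U)).
  apply/integrableP; split; first by apply/measurable_EFinP; exact: measurableT_comp.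
  move/integrableP : ig => [_]; rewrite E ge0_integral_pushforward//.
  exact: measurableT_comp.
split => //; rewrite /mean E integral_pushforward//.
Qed.

End same_law.

Section gaussian_sample.
Variable R : realType.

(** Rounding a normal sample to finitely many values turns its independence
    into an identity between finite sums. The laws [D K] and the errors [eta K],
    the mean distance of a coordinate to its rounding, depend on the standard
    deviation only, so one choice serves samples of all sizes. *)
Lemma gaussian_discretisation (s C : R) : 0 < s -> C = 512 ->
  exists (D : nat -> fdist R R) (eta : nat -> R),
  [/\ (forall K, is_prob (D K)),
      Ex (D K) (fun x => x) @[K --> \oo] --> (0 : R),
      Ex (D K) (fun x => x ^+ 2) @[K --> \oo] --> (s ^+ 2 : R),
      (forall K, Ex (D K) (fun x => x ^+ 4) <= C * s ^+ 4) &
      eta K @[K --> \oo] --> (0 : R) /\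
      forall d (T : measurableType d) (P : probability T R) N (U : 'I_N -> T -> R)
        (f : seq R -> R) L M,
        (forall i, measurable_fun setT (U i)) ->
        (forall i A, measurable A -> P (U i @^-1` A) = normal_prob 0 s A) ->
        mutually_independent P U ->
        0 <= L -> seqlips L f -> (forall u, `|f u| <= M) ->
        forall K, `|Ex (iid (D K) N) f - mean P (fun x => f (map (U^~ x) (enum 'I_N)))|
          <= L * N%:R * eta K].
Proof.
move=> s0 CE.
pose nu : probability (measurableTypeR R) R := normal_prob 0 s.
have [q [mq qV qle qcvg]] := discretise R.
have [V VP] := choice qV.
pose w K v := fine (nu (q K @^-1` [set v])).
have mqv K v : measurable (q K @^-1` [set v]).
  by rewrite -[X in measurable X]setTI; exact: (mq K).
have wE K v : nu (q K @^-1` [set v]) = (w K v)%:E.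
  by rewrite /w fineK// fin_num_measure//; exact: mqv.
pose D K := weighted (V K) (w K).
have DE K g : Ex (D K) g = mean nu (fun x => g (q K x)).
  have ind : mutually_independent nu (fun _ : unit => q K).
    move=> [|[] [|[] r]] A//= _ _.
      by rewrite set_nil bigcap_set0 big_nil probability_setT.
    by rewrite set_cons1 bigcap_set1 big_seq1.
  have := @integral_finite_valued _ _ _ nu unit (fun=> q K) (V K) (w K)
    (fun=> mqv K) (fun _ x => (VP K).2 x) (VP K).1 (fun _ v _ => wE K v) ind [:: tt]
    (fun l => g (head 0 l)) isT.
  move=> /(congr1 fine)/esym E.
  transitivity (Ex (iid (D K) 1) (fun l => g (head 0 l))); last exact: E.
  by rewrite Ex_iidS; apply: eq_Ex => a; rewrite Ex_iid0.
have pD K : is_prob (D K).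
  split => [g g0|]; rewrite DE; last exact: mean_cst.
  by apply: fine_ge0; apply: integral_ge0 => x _; rewrite lee_fin.
pose eta K := mean nu (fun x => `|q K x - x|).
have mid : measurable_fun setT (fun x : R => x) by exact: measurable_id.
have i1 : nu.-integrable setT (EFin \o (fun x : R => x)) by exact: normal_integrable1.
have i2 : nu.-integrable setT (EFin \o (fun x : R => x ^+ 2)) by exact: normal_integrable2.
have mqx K : measurable_fun setT (fun x : R => `|q K x - x|).
  by apply: measurableT_comp => //; apply: measurable_funB.
have mqX n K : measurable_fun setT (fun x : R => q K x ^+ n).
  by apply: measurable_funX.
have ieta K : nu.-integrable setT (EFin \o (fun x => `|q K x - x|)).
  apply: (@le_integrable _ _ _ nu _ measurableT _ (EFin \o (fun x : R => 2 * x))).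
  - apply/measurable_EFinP; exact: mqx.
  - move=> x _ /=; rewrite lee_fin normr_id normrM (ger0_norm (_ : 0 <= 2))//.
    by rewrite mulr2n mulrDl mul1r (le_trans (ler_normB _ _))// lerD2r.
  - rewrite (_ : _ \o _ = (fun x => 2%:E * x%:E)%E)//; exact: integrableZl.
exists D, eta; split => //.
- under eq_cvg do rewrite DE.
  suff : mean nu (fun x => q K x) @[K --> \oo] --> mean nu (fun x => x).
    by rewrite [mean nu (fun x => x)](_ : _ = 0)// /mean normal_moment1.
  apply: (@cvg_mean _ _ _ nu q (fun x => x) (fun x => `|x|)) => //.
  - exact/aeW.
  - exact: integrable_norm i1.
- under eq_cvg do rewrite DE.
  suff : mean nu (fun x => q K x ^+ 2) @[K --> \oo] --> mean nu (fun x => x ^+ 2).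
    by rewrite [mean nu (fun x => x ^+ 2)](_ : _ = s ^+ 2)// /mean normal_moment2.
  apply: (@cvg_mean _ _ _ nu (fun K x => q K x ^+ 2) (fun x => x ^+ 2) (fun x => x ^+ 2)) => //.
  - by move=> K; exact: mqX.
  - by apply/aeW => x; apply: cvgM; exact: qcvg.
  - by move=> K x; rewrite normrX -[leRHS]real_normK ?num_real// lerXn2r ?nnegrE.
- move=> K; rewrite DE -lee_fin; apply: le_trans (normal_moment4 s0 CE).
  have q4 x : 0 <= q K x ^+ 4 by rewrite exprn_even_ge0.
  have le4 x : q K x ^+ 4 <= x ^+ 4.
    rewrite -[leLHS]ger0_norm// -[leRHS]ger0_norm ?exprn_even_ge0// !normrX.
    by rewrite lerXn2r ?nnegrE.
  rewrite -meanE; last first.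
    have [M VM] : exists M, forall x, `|q K x ^+ 4| <= M.
      exists (\sum_(v <- V K) `|v ^+ 4|) => x.
      by rewrite (big_rem (q K x)) ?(VP K).2//= lerDl sumr_ge0.
    by apply: (@bounded_integrable _ _ _ nu (fun x => q K x ^+ 4) M) => //; exact: mqX.
  apply: ge0_le_integral => //.
  - by move=> x _; rewrite lee_fin.
  - by apply/measurable_EFinP; exact: mqX.
  - by apply/measurable_EFinP; exact: exprn_measurable.
  - by move=> x _; rewrite lee_fin.
split.
  suff : eta K @[K --> \oo] --> mean nu (cst 0) by rewrite mean_cst.
  apply: (@cvg_mean _ _ _ nu (fun K x => `|q K x - x|) (cst 0) (fun x => 2 * `|x|)) => //.
  - apply/aeW => x; apply/norm_cvg0P => /=.
    by apply/subr_cvg0; exact: qcvg.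
  - rewrite (_ : _ \o _ = (fun x => 2%:E * `|x%:E|)%E)//.
    by apply: integrableZl => //; exact: integrable_norm i1.
  - move=> K x; rewrite normr_id mulr2n mulrDl mul1r.
    by rewrite (le_trans (ler_normB _ _))// lerD2r.
move=> d T P N U f L M mU PU indU L0 fL fM.
pose X K i x := q K (U i x).
have mX K i : measurable_fun setT (X K i) by apply: measurableT_comp.
have mXv K i v : measurable (X K i @^-1` [set v]).
  by rewrite -[X in measurable X]setTI; apply: (mX K i).
have indX K : mutually_independent P (X K).
  move=> r A ur mA; have := indU r (fun i => q K @^-1` A i) ur.
  by apply => i ir; rewrite -[X in measurable X]setTI; apply: (mq K) => //; exact: mA.
have PX K i v : v \in V K -> P (X K i @^-1` [set v]) = (w K v)%:E.
  by move=> _; rewrite -wE; apply: PU; exact: mqv.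
have XV K i x : X K i x \in V K by exact: (VP K).2.
pose F K x := f (map ((X K)^~ x) (enum 'I_N)).
pose F0 x := f (map (U^~ x) (enum 'I_N)).
have mF K : measurable_fun setT (F K).
  exact: (measurable_fun_finite_valued (mXv K) (XV K)).
have FF0 K x : `|F K x - F0 x| <= L * \sum_(i <- enum 'I_N) `|X K i x - U i x|.
  exact: seqlips_map.
have cF x : F K x @[K --> \oo] --> F0 x.
  apply/subr_cvg0/norm_cvg0P.
  apply: (@squeeze_cvgr _ _ _ _ (fun=> 0)
    (fun K => L * \sum_(i <- enum 'I_N) `|X K i x - U i x|)).
  - by apply: nearW => K; rewrite normr_ge0 FF0.
  - exact: cvg_cst.
  - suff : L * \sum_(i <- enum 'I_N) `|X K i x - U i x| @[K --> \oo]
       --> L * \sum_(i <- enum 'I_N) 0 by rewrite big1_eq mulr0.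
    apply: cvgMr; apply: cvg_big => [|i _]; first exact: add_continuous.
    by apply/norm_cvg0P/subr_cvg0; exact: qcvg.
have mF0 : measurable_fun setT F0.
  by apply: (@measurable_fun_cvg _ _ _ _ F) => // x _; exact: cF.
have iF0 : P.-integrable setT (EFin \o F0) by apply: (@bounded_integrable _ _ _ P _ M) => // x; exact: fM.
move=> K.
have iF : P.-integrable setT (EFin \o F K) by apply: (@bounded_integrable _ _ _ P _ M) => // x; exact: fM.
have -> : Ex (iid (D K) N) f = mean P (F K).
  have := integral_finite_valued (mXv K) (XV K) (VP K).1 (PX K) (indX K) f (enum_uniq 'I_N).
  by rewrite size_enum_ord => /(congr1 fine)/esym.
rewrite -meanB//.
have H i : P.-integrable setT (EFin \o (fun x => `|X K i x - U i x|)) /\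
    mean P (fun x => `|X K i x - U i x|) = eta K.
  exact: (mean_comp (mU i) (PU i) (mqx K) (ieta K)).
have [S1 S2] := mean_sum (enum 'I_N) (fun i => (H i).1).
have iL : P.-integrable setT (EFin \o (fun x => L * \sum_(i <- enum 'I_N) `|X K i x - U i x|)).
  rewrite (_ : _ \o _ = (fun x => L%:E * (\sum_(i <- enum 'I_N) `|X K i x - U i x|)%:E)%E)//.
  exact: integrableZl.
apply: (@le_trans _ _ (mean P (fun x => L * \sum_(i <- enum 'I_N) `|X K i x - U i x|))).
  apply: norm_mean_le => //.
  rewrite (_ : _ \o _ = (fun x => (F K x)%:E - (F0 x)%:E)%E)//; exact: integrableB.
rewrite meanZ// S1 -mulrA ler_wpM2l//.
rewrite (eq_bigr (fun=> eta K)) => [|i _]; last exact: (H i).2.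
by rewrite big_enum/= sumr_const card_ord mulr_natl.
Qed.

End gaussian_sample.

(** * Convergence of the dyadic increments *)

Section finite_dimensional.
Variables (R : realType) (p : R).
Hypothesis p2 : 2 * p ^+ 2 <= 1.
Let p1 := norm_mean_le1 p2.
Variable c : nat -> R.
Hypothesis c_cvg : c n ^+ 2 * Zsqr p n @[n --> \oo] --> (1 : R).
Context d' (T' : measurableType d') (P' : probability T' R).
Variable W : R -> {RV P' >-> R}.
Hypothesis hW : standard_brownian_motion W.

(** The law, up to sign, of one dyadic increment of level [m] of the normalised
    walk of generation [m + n]. *)
Definition leaf m n : fdist R R := fmap ( *%R (c (m + n))) (Z p n).

Lemma is_prob_leaf m n : is_prob (leaf m n).
Proof. by apply: is_prob_fmap; exact: is_prob_Z. Qed.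

Lemma Ex_branch_scaled m n C f :
  Ex (branch p (fdirac 1) (m + n)) (fun u => f (blocks n (scaleseq C u))) =
  Ex (branch p (fmap ( *%R C) (Z p n)) m) f.
Proof.
rewrite Ex_branch_fmap_scale -(Ex_branch_blocks p (fdirac 1) m n).
by apply: eq_Ex => u; rewrite blocks_scaleseq.
Qed.

Lemma Ex_leaf m l n (f : R -> R) :
  Ex (leaf m (l + n)) f = Ex (branch p (leaf (m + l) n) l) (fun s => f (sumr s)).
Proof.
rewrite /leaf addnA -Ex_branch_scaled Ex_fmap Ex_total.
apply: supported_branch => u uE.
by rewrite (@sumr_blocks _ n l) ?size_scaleseq// sumr_scaleseq.
Qed.

Definition increment (h a : R) : T' -> R := W (a + h) \- W a.

Lemma increments_law h N : 0 < h ->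
  let U := fun i : 'I_N => increment h (i%:R * h) in
  [/\ (forall i, measurable_fun setT (U i)),
      (forall i A, measurable A -> P' (U i @^-1` A) = normal_prob 0 (Num.sqrt h) A) &
      mutually_independent P' U].
Proof.
move=> h0 U; split.
- move=> i; apply: measurable_funB; exact: measurable_funPT.
- move=> i A mA.
  have g0 : 0 <= i%:R * h by rewrite mulr_ge0// ltW.
  have gh : i%:R * h < i%:R * h + h by rewrite ltrDl.
  have := sbm_gaussian hW g0 gh mA.
  by rewrite [X in Num.sqrt X]addrAC subrr add0r.
have := sbm_increments hW (n := N) (t := fun i => i%:R * h).
rewrite mul0r lexx => /(_ isT).
have lt_grid i : (i < N)%N -> i%:R * h < i.+1%:R * h by rewrite ltr_pM2r// ltr_nat.
move=> /(_ lt_grid).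
congr mutually_independent; apply/funext => i; apply/funext => x.
by rewrite /U /increment /= -natr1 mulrDl mul1r.
Qed.

Lemma sum_increments h N x :
  sumr [seq increment h (i%:R * h) x | i : 'I_N <- enum 'I_N] = W (N%:R * h) x - W 0 x.
Proof.
rewrite /sumr big_map big_enum/=.
elim: N => [|N IH]; first by rewrite big_ord0 mul0r subrr.
rewrite big_ord_recr/= IH /increment /= -[in RHS]natr1 mulrDl mul1r; ring.
Qed.

(** Central limit theorem for the total, uniformly over Lipschitz functions. The
    summands are the totals of the [2 ^ l] subtrees at depth [l], which is chosen
    first, from the accuracy; for this fixed [l] the error coming from the means
    and second moments vanishes as the generation grows. *)
Lemma leaf_clt m (L e : R) : 0 <= L -> 0 < e ->
  \forall n \near \oo, forall (g : R -> R) M sg, lips L g -> (forall x, `|g x| <= M) ->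
    sg = 1 \/ sg = -1 ->
    `|Ex (leaf m n) (fun x => g (sg * x)) - mean P' (g \o increment (2^-1 ^+ m) 0)| <= e.
Proof.
move=> L0 e0.
have [C CE] : exists C : R, C = 512 by exists 512.
have C0 : 0 <= C by rewrite CE; exact: ler0n.
pose dl := e / (32 * (L + 1)).
have L1 : 0 < L + 1 by lra.
have dl0 : 0 < dl by rewrite divr_gt0// mulr_gt0.
have Ldl : 8 * L * dl <= e / 4.
  rewrite /dl (_ : 8 * L * _ = e / 4 * (L / (L + 1))); last by field; rewrite gt_eqF.
  by rewrite ler_piMr ?divr_ge0 ?(ltW e0)// ler_pdivrMr//; lra.
pose M' := 3 * L + 2 * L / dl + 4 * L / dl ^+ 2.
have M'0 : 0 <= M'.
  by rewrite !addr_ge0 ?mulr_ge0 ?invr_ge0 ?exprn_ge0 ?(ltW dl0).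
have M'1 : 0 < M' + 1 by lra.
pose et := e / (8 * (M' + 1)).
have et0 : 0 < et by rewrite divr_gt0// mulr_gt0.
have Met : M' * (2 * et) <= e / 4.
  rewrite /et (_ : M' * _ = e / 4 * (M' / (M' + 1))); last by field; rewrite gt_eqF.
  by rewrite ler_piMr ?divr_ge0 ?(ltW e0)// ler_pdivrMr//; lra.
pose B := M' * (9 + C) / et.
have B0 : 0 <= B by rewrite divr_ge0 ?(ltW et0)// mulr_ge0// addr_ge0.
have [l Bl] : exists l, B * 2^-1 ^+ l <= e / 4.
  have : B * 2^-1 ^+ l @[l --> \oo] --> (B * 0 : R).
    by apply: cvgMr; apply: cvg_expr; rewrite ger0_norm ?invr_ge0//; lra.
  rewrite mulr0 => /cvgr0_norm_le/(_ _ (divr_gt0 e0 (ltr0n _ 4)))[l _ /(_ l (leqnn l))].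
  by move=> H; exists l; apply: le_trans (ler_norm _) H.
pose v : R := 2^-1 ^+ (m + l).
have v0 : 0 < v by rewrite exprn_gt0.
have lv : 2 ^+ l * v <= 1.
  rewrite /v exprD mulrCA -exprMn mulfV// expr1n mulr1.
  by rewrite exprn_ile1// invf_le1//; lra.
have vl : v <= 2^-1 ^+ l.
  by rewrite /v exprD ler_piMl ?exprn_ge0// exprn_ile1// invf_le1//; lra.
pose bnd (a b b4 : R) := 8 * L * dl + 2 ^+ l * (M' * (`|a| + `|0 : R| + `|b - v| +
  (et * b + b4 / et) + (et * v + C * v ^+ 2 / et))).
pose a k := Ex (leaf (m + l) k) (fun u => u).
pose b k := Ex (leaf (m + l) k) (fun u => u ^+ 2).
pose b4 k := Ex (leaf (m + l) k) (fun u => u ^+ 4).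
have aE k : a k = c (m + l + k) * (2 * p) ^+ k.
  by rewrite /a Ex_fmap ExZ mean_Z.
have bE k : b k = c (m + l + k) ^+ 2 * Zsqr p k.
  by rewrite /b Ex_fmap -ExZ; apply: eq_Ex => x; rewrite exprMn.
have b4le k : b4 k <= 9 * b k ^+ 2.
  rewrite /b4 Ex_fmap.
  under eq_Ex do rewrite exprMn.
  rewrite ExZ bE (_ : 9 * _ ^+ 2 = c (m + l + k) ^+ 4 * (9 * Zsqr p k ^+ 2)); last by ring.
  by rewrite ler_wpM2l ?exprn_even_ge0// fourth_moment_Z.
have bnd_cvg : bnd (a k) (b k) (9 * b k ^+ 2) @[k --> \oo] --> bnd 0 v (9 * v ^+ 2).
  have ac : a k @[k --> \oo] --> (0 : R).
    by under eq_cvg do rewrite aE; exact: cvg_scaled_mean.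
  have bc : b k @[k --> \oo] --> v.
    by under eq_cvg do rewrite bE; exact: cvg_scaled_Zsqr.
  apply: cvgD; first exact: cvg_cst.
  apply: cvgMr; apply: cvgMr; apply: cvgD; last exact: cvg_cst.
  apply: cvgD; last first.
    apply: cvgD; first exact: cvgMr.
    by apply: cvgMl; apply: cvgMr; apply: cvgM.
  apply: cvgD; last by apply: cvg_norm; apply: cvgB => //; exact: cvg_cst.
  by apply: cvgD; [exact: cvg_norm|exact: cvg_cst].
have bnd_lt : bnd 0 v (9 * v ^+ 2) < e.
  rewrite /bnd subrr !normr0 !add0r.
  have -> : 2 ^+ l * (M' * (et * v + 9 * v ^+ 2 / et + (et * v + C * v ^+ 2 / et))) =
     M' * (2 * et) * (2 ^+ l * v) + B * v * (2 ^+ l * v).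
    by rewrite /B; field; rewrite gt_eqF.
  have h1 : M' * (2 * et) * (2 ^+ l * v) <= e / 4.
    apply: le_trans Met; rewrite ler_piMr//.
    by rewrite mulr_ge0// mulr_ge0// ltW.
  have h2 : B * v * (2 ^+ l * v) <= e / 4.
    apply: (@le_trans _ _ (B * v)).
      by rewrite ler_piMr// mulr_ge0// ltW.
    by apply: le_trans Bl; rewrite ler_wpM2l.
  by lra.
have [k0 _ Hk] := @cvgr_lt _ _ _ _ _ _ bnd_cvg _ bnd_lt.
exists (l + k0)%N => // n /= nk g M sg gL gM sg1.
have [k kk0 ->] : exists2 k, (k0 <= k)%N & n = (l + k)%N.
  exists (n - l)%N; first by rewrite leq_subRL// (leq_trans _ nk)// leq_addr.
  by rewrite subnKC// (leq_trans _ nk)// leq_addr.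
have {}Hk := Hk k kk0.
have sv : 0 < Num.sqrt v by rewrite sqrtr_gt0.
have s2 : Num.sqrt v ^+ 2 = v by rewrite sqr_sqrtr// ltW.
have [D [eta [pD D1 D2 D4 [eta0 Deta]]]] := gaussian_discretisation sv CE.
have [mU lawU indU] := increments_law (2 ^ l) v0.
have gS : seqlips L (fun s => g (sumr s)).
  move=> s z z' t; apply: (le_trans (gL _ _)).
  rewrite !sumr_cat [sumr (z :: t)]/sumr [sumr (z' :: t)]/sumr !big_cons.
  by rewrite (_ : _ - _ = z - z')//; ring.
have Dg := Deta _ _ _ _ _ (fun s => g (sumr s)) L M mU lawU indU L0 gS (fun s => gM _).
have meanE' : mean P' (fun x => g (sumr [seq increment v (i%:R * v) x | i : 'I_(2 ^ l) <- enum 'I_(2 ^ l)])) =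
    mean P' (g \o increment (2^-1 ^+ m) 0).
  congr (mean P'); apply/funext => x /=; rewrite sum_increments /increment /= add0r.
  rewrite (_ : (2 ^ l)%:R * v = 2^-1 ^+ m)// natrX /v exprD mulrCA -exprMn mulfV//.
  by rewrite expr1n mulr1.
rewrite {}meanE' in Dg.
rewrite Ex_leaf.
pose r K := 8 * L * dl + 2 ^+ l * (M' * (`|a k| + `|Ex (D K) (fun u => u)| +
  `|b k - Ex (D K) (fun u => u ^+ 2)| + (et * b k + b4 k / et) +
  (et * Ex (D K) (fun u => u ^+ 2) + C * v ^+ 2 / et))) + L * (2 ^ l)%:R * eta K.
have rc : r K @[K --> \oo] --> bnd (a k) (b k) (b4 k) + L * (2 ^ l)%:R * 0.
  rewrite s2 in D2.
  apply: cvgD; last by apply: cvgMr.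
  apply: cvgD; first exact: cvg_cst.
  apply: cvgMr; apply: cvgMr; apply: cvgD; last first.
    by apply: cvgD; [exact: cvgMr|exact: cvg_cst].
  apply: cvgD; last exact: cvg_cst.
  apply: cvgD; last by apply: cvg_norm; apply: cvgB => //; exact: cvg_cst.
  by apply: cvgD; [exact: cvg_cst|exact: cvg_norm].
have le_r K : `|Ex (branch p (leaf (m + l) k) l) (fun s => g (sg * sumr s)) -
    mean P' (g \o increment (2^-1 ^+ m) 0)| <= r K.
  have Hl := lindeberg p2 l (is_prob_leaf (m + l) k) (pD K) sg1 dl0 et0 L0 gL.
  rewrite -[X in `|X|](subrKA (Ex (iid (D K) (2 ^ l)) (fun s => g (sumr s)))).
  apply: (le_trans (ler_normD _ _)); apply: lerD; last exact: Dg.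
  apply: (le_trans Hl); rewrite lerD2l ler_wpM2l ?exprn_ge0// ler_wpM2l// lerD2l lerD2l.
  rewrite ler_wpM2r ?invr_ge0 ?(ltW et0)//; apply: (le_trans (D4 K)).
  by rewrite (exprM _ 2 2) s2.
apply: (@le_trans _ _ (bnd (a k) (b k) (b4 k))).
  rewrite mulr0 addr0 in rc.
  by apply: (cvgr_to_ge rc); exact: nearW.
apply/ltW/(le_lt_trans _ Hk).
rewrite /bnd lerD2l ler_wpM2l ?exprn_ge0// ler_wpM2l// lerD2r lerD2l lerD2l.
by rewrite ler_wpM2r ?invr_ge0 ?(ltW et0).
Qed.

(** The [2 ^ m] coordinates are exchanged one at a time; as a function of a
    single coordinate [f] is Lipschitz, so [leaf_clt] bounds each exchange. *)
Lemma dyadic_cvg m (L e : R) (h := 2^-1 ^+ m : R) : 0 <= L -> 0 < e ->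
  \forall n \near \oo, forall (f : seq R -> R) M, seqlips L f ->
    (forall u, `|f u| <= M) ->
    `|Ex (branch p (leaf m n) m) f - mean P'
      (fun x => f [seq increment h (i%:R * h) x | i : 'I_(2 ^ m) <- enum 'I_(2 ^ m)])| <= e.
Proof.
move=> L0 e0; set N := (2 ^ m)%N.
have N0 : 0 < N%:R :> R by rewrite ltr0n expn_gt0.
have h0 : 0 < h by rewrite exprn_gt0.
have := leaf_clt m L0 (divr_gt0 e0 N0); apply: filterS => n Hn f M fL fM.
have sh : 0 < Num.sqrt h by rewrite sqrtr_gt0.
have [D [eta [pD _ _ _ [eta0 Deta]]]] := gaussian_discretisation sh erefl.
have [mU lawU indU] := increments_law N h0.
have Df := Deta _ _ _ _ _ f L M mU lawU indU L0 fL fM.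
have [mU1 lawU1 indU1] := increments_law 1 h0.
set EW := mean P' _ in Df *.
have step K : `|Ex (branch p (leaf m n) m) f - Ex (iid (D K) N) f| <=
    N%:R * (e / N%:R + L * eta K).
  rewrite -(eq_Ex _ (fun s => congr1 f (scaleseq1 s))).
  apply: (@branch_iid _ _ p1 (leaf m n) (D K) m f) => //.
  - exact: is_prob_leaf.
  - by left.
  move=> s t sg sg1.
  pose g x := f (s ++ x :: t).
  have gL : lips L g by move=> x y; exact: fL.
  have gM x : `|g x| <= M by exact: fM.
  have H1 := Hn g M sg gL gM sg1.
  pose g1 u := g (head 0 u).
  have g1L : seqlips L g1.
    move=> [|y u] z z' u'; first exact: fL.
    by rewrite /g1 /= subrr normr0 mulr_ge0.
  have /(_ K) H2 := Deta _ _ _ _ _ g1 L M mU1 lawU1 indU1 L0 g1L (fun u => gM _).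
  rewrite mulr1 (_ : Ex (iid (D K) 1) g1 = Ex (D K) g) in H2; last first.
    by rewrite Ex_iidS; apply: eq_Ex => x; rewrite Ex_iid0.
  rewrite [X in _ - X](_ : _ = mean P' (g \o increment h 0)) in H2; last first.
    congr (mean P'); apply/funext => x /=.
    by rewrite /g1 enum_ordSl /= mul0r.
  rewrite -[X in `|X|](subrKA (mean P' (g \o increment h 0))).
  apply: (le_trans (ler_normD _ _)); apply: lerD; first exact: H1.
  by rewrite distrC.
have rc : N%:R * (e / N%:R + L * eta K) + L * N%:R * eta K @[K --> \oo] -->
    N%:R * (e / N%:R + L * 0) + L * N%:R * 0.
  apply: cvgD; last exact: cvgMr.
  by apply: cvgMr; apply: cvgD; [exact: cvg_cst|exact: cvgMr].
rewrite !mulr0 !addr0 (mulrC N%:R) divfK ?gt_eqF// in rc.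
apply: (cvgr_to_ge rc); apply: nearW => K.
rewrite -[X in `|X|](subrKA (Ex (iid (D K) N) f)).
by apply: (le_trans (ler_normD _ _)); apply: lerD.
Qed.

End finite_dimensional.

(** * The walk as a branching vector *)

Lemma wordS n k : word n.+1 k = odd (k %/ 2 ^ n) :: word n k.
Proof.
rewrite /word /mkseq /= subSS subn0; congr (_ :: _).
by rewrite (iotaDl 1 0) -map_comp; apply: eq_map => i /=; rewrite subSS.
Qed.

Lemma word_add n k : word n (2 ^ n + k) = word n k.
Proof.
apply/eq_in_map => i; rewrite mem_iota add0n /= => ni.
rewrite -{1}(subnKC ni) expnD divnMDl ?expn_gt0// oddD.
by rewrite expnS oddM.
Qed.

Section walk_vector.
Variables (R : realType) (p : R).
Context d (T : measurableType d) (P : probability T R).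
Variable eps : seq bool -> {RV P >-> R}.

(** The nonempty words of length at most [n], read below [w] in depth-first
    order: the order in which the recursion of [branch] draws the signs. *)
Fixpoint subtree n (w : seq bool) : seq (seq bool) :=
  if n is n.+1 then
    (rcons w false :: subtree n (rcons w false)) ++
    (rcons w true :: subtree n (rcons w true))
  else [::].

Fixpoint subtree_size n : nat :=
  if n is n.+1 then (subtree_size n).+1 + (subtree_size n).+1 else 0.

Lemma size_subtree n w : size (subtree n w) = subtree_size n.
Proof. by elim: n w => //= n IH w; rewrite size_cat /= !IH. Qed.

Lemma mem_subtree n w u : u \in subtree n w ->
  (size w < size u)%N /\ take (size w) u = w.
Proof.
elim: n w => //= n IH w.
have sub b : u \in subtree n (rcons w b) -> (size w < size u)%N /\ take (size w) u = w.
  move=> /IH; rewrite size_rcons => -[su tu]; split; first exact: ltnW.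
  by rewrite -[RHS](take_size_cat [:: b] erefl) cats1 -tu take_takel.
have rc b : (size w < size (rcons w b))%N /\ take (size w) (rcons w b) = w.
  by rewrite size_rcons ltnSn -cats1 take_size_cat.
rewrite inE mem_cat inE => /or3P[/eqP ->|/sub//|/orP[/eqP->|/sub//]]; exact: rc.
Qed.

Lemma uniq_subtree n w : uniq (subtree n w).
Proof.
elim: n w => //= n IH w.
have notin b : rcons w b \notin subtree n (rcons w b).
  by apply/negP => /mem_subtree[]; rewrite ltnn.
have last_letter b u : u \in rcons w b :: subtree n (rcons w b) -> nth false u (size w) = b.
  rewrite inE => /predU1P[->|/mem_subtree]; first by rewrite nth_rcons ltnn eqxx.
  rewrite size_rcons => -[_ tu].
  by rewrite -(nth_take _ (ltnSn (size w))) tu nth_rcons ltnn eqxx.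
have disj b u : u \in rcons w b :: subtree n (rcons w b) ->
    u \notin rcons w (~~ b) :: subtree n (rcons w (~~ b)).
  by move=> /last_letter ub; apply/negP => /last_letter; rewrite ub; case: (b).
rewrite -[_ && _]/(uniq ((rcons w false :: subtree n (rcons w false)) ++
  (rcons w true :: subtree n (rcons w true)))) cat_uniq.
apply/and3P; split; [by rewrite /= notin IH| |by rewrite /= notin IH].
by apply/hasPn => u; apply: (disj true).
Qed.

Fixpoint walk_of_signs n (l : seq R) : seq R :=
  if n is n.+1 then
    let m := subtree_size n in
    scaleseq (head 0 l) (walk_of_signs n (take m (behead l))) ++
    scaleseq (nth 0 l m.+1) (walk_of_signs n (drop m.+2 l))
  else [:: 1].

Lemma Ex_walk_of_signs n (f : seq R -> R) :
  Ex (iid (sign_law p) (subtree_size n)) (fun l => f (walk_of_signs n l)) =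
  Ex (branch p (fdirac 1) n) f.
Proof.
elim: n f => [|n IH] f; first by rewrite Ex_iid0 Ex_branch0 Ex_fdirac.
rewrite [subtree_size _]/= Ex_iidD Ex_branchS Ex_iidS; apply: eq_Ex => a.
under [RHS]eq_Ex => b do rewrite -IH.
rewrite [RHS]Ex_exchange; apply: supported_iid => s sE.
rewrite Ex_iidS; apply: eq_Ex => b; rewrite -IH; apply: supported_iid => t tE.
congr f; rewrite /=; congr (scaleseq _ (walk_of_signs _ _) ++ scaleseq _ (walk_of_signs _ _)).
- by rewrite take_size_cat.
- by rewrite nth_cat sE ltnn subnn.
- by rewrite -cat_rcons drop_size_cat// size_rcons sE.
Qed.

Definition branch_product n w (u : seq bool) (x : T) : R :=
  \prod_(1 <= k < n.+1) eps (w ++ take k u) x.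

Definition walk_vector n x : seq R := [seq xi eps n k x | k <- iota 0 (2 ^ n)].

Lemma walk_of_signsE n w x :
  walk_of_signs n [seq eps v x | v <- subtree n w] =
  [seq branch_product n w (word n k) x | k <- iota 0 (2 ^ n)].
Proof.
elim: n w => [|n IH] w; first by rewrite /= /branch_product big_geq.
have H b : scaleseq (eps (rcons w b) x) [seq branch_product n (rcons w b) (word n k) x | k <- iota 0 (2 ^ n)]
    = [seq branch_product n.+1 w (b :: word n k) x | k <- iota 0 (2 ^ n)].
  rewrite /scaleseq -map_comp; apply: eq_map => k /=.
  rewrite /branch_product [RHS]big_ltn//= take0 cats1; congr (_ * _).
  by rewrite [RHS]big_add1 /=; apply: eq_bigr => i _; rewrite cat_rcons.
rewrite expnS mul2n -addnn iotaD map_cat /=.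
rewrite map_cat /= take_size_cat ?size_map ?size_subtree// IH H.
congr (_ ++ _).
  apply/eq_in_map => k; rewrite mem_iota add0n /= => kn.
  by rewrite wordS divn_small.
rewrite nth_cat size_map size_subtree ltnn subnn /=.
rewrite -cat_rcons drop_size_cat ?size_rcons ?size_map ?size_subtree// IH H.
rewrite (addnC 0%N) iotaDl -map_comp.
apply/eq_in_map => k; rewrite mem_iota add0n /= => kn.
by rewrite wordS word_add -{1}(mul1n (2 ^ n)%N) divnMDl ?expn_gt0// divn_small.
Qed.

Lemma walk_vectorE n x :
  walk_vector n x = walk_of_signs n [seq eps v x | v <- subtree n [::]].
Proof.
rewrite walk_of_signsE; apply: eq_map => k.
by rewrite /xi /beps size_word.
Qed.

Hypothesis eps_val : forall w x, eps w x = 1 \/ eps w x = -1.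
Hypothesis eps_prob1 : forall w, P (eps w @^-1` [set 1]) = ((1 + p) / 2)%:E.
Hypothesis eps_probN1 : forall w, P (eps w @^-1` [set -1]) = ((1 - p) / 2)%:E.
Hypothesis eps_indep : mutually_independent P (fun w => eps w).

Let meps w v : measurable (eps w @^-1` [set v]).
Proof.
rewrite -[X in measurable X]setTI; exact: (@measurable_funPT _ _ _ _ (eps w)).
Qed.

Let eps_mem w x : eps w x \in [:: 1; -1].
Proof. by rewrite !inE; case: (eps_val w x) => ->; rewrite eqxx ?orbT. Qed.

Lemma mean_walk n (f : seq R -> R) :
  mean P (fun x => f (walk_vector n x)) = Ex (branch p (fdirac 1) n) f.
Proof.
have fE x : f (walk_vector n x) = (fun l => f (walk_of_signs n l))
    (map (eps^~ x) (subtree n [::])) by rewrite walk_vectorE.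
have -> : (fun x => f (walk_vector n x)) = fun x => (fun l => f (walk_of_signs n l))
    (map (eps^~ x) (subtree n [::])) by apply/funext.
have u2 : uniq [:: 1; -1 : R].
  by rewrite /= inE andbT; apply/eqP; lra.
pose w (v : R) := if v == 1 then (1 + p) / 2 else (1 - p) / 2.
have wE i v : v \in [:: 1; -1] -> P (eps i @^-1` [set v]) = (w v)%:E.
  rewrite !inE /w => /orP[]/eqP->; first by rewrite eqxx eps_prob1.
  rewrite eps_probN1 (_ : (-1 == 1) = false)//; apply/eqP; lra.
have := integral_finite_valued (X := fun w => eps w) meps eps_mem u2 wE eps_indep
  (fun l => f (walk_of_signs n l)) (uniq_subtree n [::]).
rewrite size_subtree /mean => ->; rewrite [fine _]/=.
rewrite -Ex_walk_of_signs; congr (Ex (iid _ _) _).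
rewrite /weighted /= /w eqxx (_ : (-1 == 1) = false)//; apply/eqP; lra.
Qed.

End walk_vector.

(** * Paths *)

Section paths.
Variable R : realType.

Lemma continuous_lin (u : seq R) : continuous (lin u).
Proof.
elim: u => [|a u IH] s; first exact: cvg_cst.
apply: cvgD.
  apply: cvgMr; apply: (@continuous_max R R (cst 0) (fun t => Num.min 1 t) s).
    exact: cvg_cst.
  apply: (@continuous_min R R (cst 1) id s); first exact: cvg_cst.
  exact: cvg_id.
apply: (@continuous_comp _ _ _ (fun t : R => t - 1) (lin u)); last exact: IH.
by apply: cvgB; [exact: cvg_id|exact: cvg_cst].
Qed.

Lemma continuous_lin_scaled m (u : seq R) :
  {within `[0, 1], continuous (fun t => lin u (2 ^+ m * t))}.
Proof.
apply: continuous_subspaceT => t.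
apply: (@continuous_comp _ _ _ (fun t : R => 2 ^+ m * t) (lin u)); last exact: continuous_lin.
by apply: cvgMr; exact: cvg_id.
Qed.

Definition linpath m (u : seq R) : C01 R := path01 (@continuous_lin_scaled m u).

Lemma lin_truncn (F : nat -> R) i n s : 0 <= s -> s <= n%:R ->
  lin [seq F k | k <- iota i n] s =
  \sum_(i <= k < i + Num.truncn s) F k + (s - (Num.truncn s)%:R) * F (i + Num.truncn s)%N.
Proof.
elim: n i s => [|n IH] i s s0 sn.
  have -> : s = 0 by apply/eqP; rewrite eq_le s0 sn.
  by rewrite truncn0 addn0 big_geq// subrr mul0r addr0.
have [s1|s1] := ltP s 1.
  have -> : Num.truncn s = 0%N by apply: truncn_def; rewrite s0.
  by rewrite addn0 big_geq// subr0 add0r /= clamp_id ?(ltW s1)// lin0 ?addr0 1?mulrC//; lra.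
have s1' : 0 <= s - 1 by rewrite subr_ge0.
have E : Num.truncn s = (Num.truncn (s - 1)).+1.
  apply: truncn_def; have /andP[h1 h2] := truncn_itv s1'.
  by rewrite -[X in X <= _]natr1 -[X in _ < X]natr1; apply/andP; split; lra.
rewrite /= clamp1// mulr1 IH ?s1'//; last by rewrite lerBlDr natr1.
rewrite E -[in RHS]addSnnS [in RHS]big_ltn; last by rewrite ltn_addr.
by rewrite addrA; congr (_ + _ * _); rewrite -[in RHS]natr1; ring.
Qed.

Definition lipschitzC01 (k : R) (F : C01 R -> R) := forall (f g : C01 R) (e : R),
  (forall t, `|f t - g t| <= e) -> `|F f - F g| <= k * e.

Lemma lipschitzC01_ext k F (f g : C01 R) : lipschitzC01 k F -> (forall t, f t = g t) -> F f = F g.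
Proof.
move=> Fk fg; apply/eqP; rewrite -subr_eq0 -normr_le0 -(mulr0 k).
by apply: Fk => t; rewrite fg subrr normr0.
Qed.

Lemma lipschitzC01_continuous k F : lipschitzC01 k F -> continuous F.
Proof.
move=> Fk f; have FF : Filter (nbhs f) := @nbhs_filter _ f; apply/(@cvgrPdist_le _ _ _ (nbhs f) FF) => e e0.
have k1 : 0 < `|k| + 1 by rewrite ltr_wpDl.
have ek : 0 < e / (`|k| + 1) by rewrite divr_gt0.
have := nbhsx_ballx f _ ek; apply: filterS => g /= /C01_ballE fg.
apply: le_trans (Fk _ _ _ (fun t => ltW (fg t))) _.
apply: (@le_trans _ _ ((`|k| + 1) * (e / (`|k| + 1)))).
  by rewrite ler_wpM2r ?(ltW ek)// (le_trans (ler_norm _))// lerDl.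
by rewrite mulrC divfK// gt_eqF.
Qed.

Lemma measurable_continuousC01 (F : C01 R -> R) : continuous F ->
  measurable_fun setT (F : borel (C01 R) -> R).
Proof.
move=> cF; apply: (measurability _ (RGenOInfty.measurableE R)) => //.
move=> _ [_ [r ->] <-]; rewrite setTI.
apply: sub_sigma_algebra; apply: open_comp => [f _|]; first exact: cF.
by rewrite set_itvE; exact: open_gt.
Qed.

Lemma linpath_lipschitz m u z z' v t :
  `|linpath m (u ++ z :: v) t - linpath m (u ++ z' :: v) t| <= `|z - z'|.
Proof. exact: lin_lipschitz. Qed.

End paths.

Section walk_path.
Context (R : realType) d (T : measurableType d) (P : probability T R).
Variable eps : seq bool -> {RV P >-> R}.

Lemma Xfun_scale (H : \bar R) n t x : Xfun eps H n t x = Xscale H n * Lint eps n t x.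
Proof.
rewrite /Xfun /Bproc /Xscale; case: H => [h| |]; last 2 first.
- by rewrite mulrC.
- by rewrite mulrC.
by case: ifPn => _; rewrite mulrAC.
Qed.

Lemma Xproc_pathE (H : \bar R) n x t :
  cprocess_path (Xproc eps H n) x t =
  linpath n (scaleseq (Xscale H n) (walk_vector eps n x)) t.
Proof.
rewrite /cprocess_path /linpath !path01E lin_scaleseq.
rewrite -[LHS]/(Xfun eps H n (val t) x) Xfun_scale; congr (_ * _).
have := set_mem (valP t); rewrite /I01 /= in_itv/= => /andP[t0 t1].
by rewrite lin_truncn ?mulr_ge0//; last by rewrite natrX ler_piMr.
Qed.

End walk_path.

Section brownian_path.
Context (R : realType) d (T : measurableType d) (P : probability T R).
Variable W : R -> {RV P >-> R}.
Hypothesis hW : standard_brownian_motion W.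

Lemma uniform_continuity x (e : R) : 0 < e -> \forall m \near \oo, forall a b : R,
  0 <= a -> a <= 1 -> 0 <= b -> `|b - a| <= 2^-1 ^+ m -> `|W b x - W a x| <= e.
Proof.
move=> e0.
have /subspace_continuousP cW := @sbm_continuous _ _ _ _ _ hW x.
have /compact_near_coveringP ncov := @segment_compact R 0 1.
have := ncov nat \oo (fun m a => 0 <= a -> forall b, 0 <= b -> `|b - a| <= 2^-1 ^+ m ->
   `|W b x - W a x| <= e) _.
suff H : forall a : R, `[0, 1]%classic a -> \forall a' \near a & m \near \oo,
    0 <= a' -> forall b, 0 <= b -> `|b - a'| <= 2^-1 ^+ m -> `|W b x - W a' x| <= e.
  move=> /(_ _ H) /=; apply: filterS => m Hm a b a0 a1 b0 ab.
  by apply: (Hm a); rewrite /= ?in_itv/= ?a0.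
move=> a; rewrite /= in_itv/= => /andP[a0 a1].
have e2 : 0 < e / 2 by rewrite divr_gt0.
have : `[0, +oo[%classic a by rewrite /= in_itv/= a0.
move=> /cW /cvgrPdist_lt /(_ _ e2) /nbhs_ballP[dl /= dl0 hdl].
have d2 : 0 < dl / 2 by rewrite divr_gt0.
near=> a' m => /= a'0 b b0 ba'.
have aa' : `|a - a'| < dl / 2 by near: a'; exact: (@nbhsx_ballx _ R^o).
have m1 : 2^-1 ^+ m < dl / 2.
  near: m.
  have : (2^-1 : R) ^+ m @[m --> \oo] --> (0 : R).
    by apply: cvg_expr; rewrite ger0_norm ?invr_ge0//; lra.
  by move=> /cvgr_lt; apply.
have h1 : `|W a x - W a' x| < e / 2.
  by apply: hdl; rewrite /= ?in_itv/= ?a'0//; apply: lt_trans aa' _; lra.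
have h2 : `|W a x - W b x| < e / 2.
  have : `|a - b| < dl.
    rewrite (_ : a - b = (a - a') - (b - a')); last by ring.
    by apply: (le_lt_trans (ler_normB _ _)); lra.
  by move=> /hdl; apply; rewrite /= in_itv/= b0.
rewrite (_ : _ - _ = (W a x - W a' x) - (W a x - W b x)); last by ring.
by apply: (le_trans (ler_normB _ _)); lra.
Unshelve. all: end_near. Qed.

Definition interpolated_path m x : C01 R :=
  linpath m [seq increment W (2^-1 ^+ m) (i%:R * 2^-1 ^+ m) x | i : 'I_(2 ^ m) <- enum 'I_(2 ^ m)].

Lemma measurable_interpolated_path m :
  measurable_fun setT (interpolated_path m : T -> borel (C01 R)).
Proof.
apply: measurable_fun_C01 => t; rewrite /interpolated_path.
under eq_fun do rewrite /linpath path01E.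
move: (2 ^+ m * val t) => s; elim: (enum _) s => [|i r IH] s.
  exact: measurable_cst.
apply: (@measurable_funD _ _ _ _ (fun x => _ * clamp s) (fun x => lin _ (s - 1)));
  last exact: IH.
apply: measurable_funM => //; apply: measurable_funB; exact: measurable_funPT.
Qed.

Lemma interpolated_path_cvg x (e : R) : W 0 x = 0 -> 0 < e ->
  \forall m \near \oo, forall t,
    `|interpolated_path m x t - cprocess_path (sbm01 hW) x t| <= e.
Proof.
move=> W0 e0; have e2 : 0 < e / 2 by rewrite divr_gt0.
have := uniform_continuity x e2; apply: filterS => m Hm t.
rewrite /interpolated_path /linpath path01E -[cprocess_path _ _ _]/(W (val t) x).
have := set_mem (valP t); rewrite /I01 /= in_itv/=; move: (val t) => s /andP[s0 s1].
set h : R := 2^-1 ^+ m.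
have h0 : 0 < h by rewrite exprn_gt0.
have Nh : (2 ^ m)%:R * h = 1 by rewrite natrX -exprMn mulfV// expr1n.
pose phi u := W (u * h) x.
have -> : [seq increment W h (i%:R * h) x | i : 'I_(2 ^ m) <- enum 'I_(2 ^ m)] =
    [seq phi k.+1%:R - phi k%:R | k <- iota 0 (2 ^ m)].
  rewrite -val_enum_ord -map_comp; apply: eq_map => i /=.
  by rewrite /phi /increment /= -natr1 mulrDl mul1r.
have := @lin_increments R phi (e / 2) 0 (2 ^ m) (2 ^+ m * s) (ltW e2).
rewrite mulr_ge0// natrX ler_piMr// => /(_ isT isT).
have p0 : phi 0 = 0 by rewrite /phi mul0r.
have ps : phi (2 ^+ m * s) = W s x.
  by rewrite /phi mulrAC -natrX Nh mul1r.
rewrite add0r p0 ps subr0 (_ : 2 * (e / 2) = e); last by field.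
apply => k u /andP[_ km] ku uk.
have k1 : k%:R * h <= 1.
  by rewrite -[leRHS]Nh ler_pM2r// ler_nat ltnW.
apply: Hm => //; rewrite ?mulr_ge0 ?(ltW h0) ?(le_trans _ ku)//.
rewrite -mulrBl normrM (gtr0_norm h0) ler_piMl ?(ltW h0)//.
by rewrite ger0_norm ?subr_ge0// lerBlDr addrC natr1.
Qed.

Lemma cvg_interpolated k M (F : C01 R -> R) : 0 <= k -> lipschitzC01 k F ->
  (forall f, `|F f| <= M) ->
  mean P (F \o interpolated_path m) @[m --> \oo] -->
  mean P (F \o (cprocess_path (sbm01 hW) : T -> C01 R)).
Proof.
move=> k0 Fk FM.
have mF := measurable_continuousC01 (lipschitzC01_continuous Fk).
apply: (@cvg_mean _ _ _ P (fun m => F \o interpolated_path m) _ (cst M)).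
- by move=> m; exact: (measurableT_comp mF (@measurable_interpolated_path m)).
- exact: (measurableT_comp mF (@measurable_funPT _ _ _ _ (cprocess_path (sbm01 hW)))).
- apply: filterS (sbm_start hW) => x W0; apply/cvgrPdist_le => e e0.
  have k1 : 0 < k + 1 by lra.
  have := interpolated_path_cvg W0 (divr_gt0 e0 k1); apply: filterS => m Hm.
  rewrite distrC; apply: (le_trans (Fk _ _ _ Hm)).
  by rewrite mulrA ler_pdivrMr// mulrC ler_pM2l//; lra.
- exact: finite_measure_integrable_cst.
- by move=> m x; exact: FM.
Qed.

End brownian_path.

(** * Lipschitz functionals of the walk *)

Section lipschitz_functionals.
Variables (R : realType) (H : \bar R).
Hypothesis hH : (H <= (2^-1)%:E)%E.
Context d (T : measurableType d) (P : probability T R).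
Variable eps : seq bool -> {RV P >-> R}.
Hypothesis heps : iid_signs H eps.
Context d' (T' : measurableType d') (P' : probability T' R).
Variable W : R -> {RV P' >-> R}.
Hypothesis hW : standard_brownian_motion W.

Let p := two_pow_subr1 H.
Let c := Xscale H.
Let p2 : 2 * p ^+ 2 <= 1. Proof. exact: two_pow_sqr. Qed.
Let p1 := norm_mean_le1 p2.
Let c_cvg : c n ^+ 2 * Zsqr p n @[n --> \oo] --> (1 : R).
Proof. exact: cvg_Xscale. Qed.

Let walk_path n x : C01 R := cprocess_path (Xproc eps H n) x.
Let brownian_path x : C01 R := cprocess_path (sbm01 hW) x.

Lemma mean_walk_path k (F : C01 R -> R) n : lipschitzC01 k F ->
  mean P (F \o walk_path n) =
  Ex (branch p (fdirac 1) n) (fun u => F (linpath n (scaleseq (c n) u))).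
Proof.
move=> Fk.
rewrite -(mean_walk (signs_val heps) (signs_prob1 heps) (signs_probN1 heps)
  (signs_indep heps) n (fun u => F (linpath n (scaleseq (c n) u)))).
congr (mean P); apply/funext => x /=.
by apply: (lipschitzC01_ext Fk) => t; exact: Xproc_pathE.
Qed.

(** Coarse graining at a fixed dyadic level [m] costs a geometrically small
    error, uniformly in the generation; at level [m] only finitely many
    increments matter, and these converge. *)
Lemma cvg_lipschitz k M (F : C01 R -> R) : 0 <= k -> lipschitzC01 k F ->
  (forall f, `|F f| <= M) ->
  mean P (F \o walk_path n) @[n --> \oo] --> mean P' (F \o brownian_path).
Proof.
move=> k0 Fk FM; apply/cvgrPdist_le => e e0.
have e3 : 0 < e / 3 by rewrite divr_gt0.
have [K K0 cK] := scaled_Zsqr_le p2 c_cvg.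
have [m [m1 m2]] : exists m,
    k * (8 * (1 + 9 * K ^+ 2) * (7 / 8) ^+ m) <= e / 3 /\
    `|mean P' (F \o brownian_path) - mean P' (F \o interpolated_path W m)| <= e / 3.
  have h1 : k * (8 * (1 + 9 * K ^+ 2) * (7 / 8) ^+ m) @[m --> \oo] -->
      k * (8 * (1 + 9 * K ^+ 2) * (0 : R)).
    by apply: cvgMr; apply: cvgMr; apply: cvg_expr; rewrite ger0_norm; lra.
  rewrite !mulr0 in h1.
  have h2 := @cvg_interpolated _ _ _ _ _ hW k M F k0 Fk FM.
  have /cvgrPdist_le/(_ _ e3) {}h2 := h2.
  have /cvgr0_norm_le/(_ _ e3) {}h1 := h1.
  have [m _ Hm] := filterI h1 h2; exists m.
  have [h3 h4] := Hm m (leqnn m); split => //.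
  exact: le_trans (ler_norm _) h3.
have [l0 _ Hl] := dyadic_cvg p2 c_cvg hW m k0 e3.
exists (m + l0)%N => // n /= nl.
have [l ll0 ->] : exists2 l, (l0 <= l)%N & n = (m + l)%N.
  exists (n - m)%N; first by rewrite leq_subRL// (leq_trans _ nl)// leq_addr.
  by rewrite subnKC// (leq_trans _ nl)// leq_addr.
have {}Hl := Hl l ll0.
pose f u := F (linpath m u).
have fL : seqlips k f.
  by move=> s z z' t; apply: Fk => v; exact: linpath_lipschitz.
have fM u : `|f u| <= M by exact: FM.
have {}Hl := Hl f M fL fM.
rewrite (mean_walk_path _ Fk).
set A := Ex _ _.
have cKi i : (i <= l)%N -> c (m + l)%N ^+ 2 * Zsqr p i <= K * 2^-1 ^+ (m + l - i).
  by move=> il; apply: cK; rewrite (leq_trans il)// leq_addl.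
have [err err1 err2] := expected_oscillation p2 K0 cKi.
have pb : is_prob (branch p (fdirac 1) (m + l)).
  by apply: is_prob_branch => //; exact: is_prob_fdirac.
have osc : `|A - Ex (branch p (leaf p c m l) m) f| <= e / 3.
  rewrite -Ex_branch_scaled /A -ExB; apply: (le_trans (Ex_norm pb _)).
  apply: le_trans m1.
  apply: (@le_trans _ _ (Ex (branch p (fdirac 1) (m + l)) (fun u => k * err u))).
    apply: (Ex_le_supp pb (@supported_branch _ _ _ _)) => u uE.
    apply: Fk => t; rewrite /linpath !path01E.
    have -> : 2 ^+ (m + l) * val t = 2 ^+ l * (2 ^+ m * val t) by rewrite exprD; ring.
    exact: err1.
  by rewrite ExZ ler_wpM2l.
rewrite (_ : _ - A = (mean P' (F \o brownian_path) - mean P' (F \o interpolated_path W m)) +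
  (mean P' (F \o interpolated_path W m) - Ex (branch p (leaf p c m l) m) f) +
  (Ex (branch p (leaf p c m l) m) f - A)); last by ring.
apply: (@le_trans _ _ (e / 3 + e / 3 + e / 3)); last by lra.
apply: (le_trans (ler_normD _ _)); apply: lerD; last by rewrite distrC.
by apply: (le_trans (ler_normD _ _)); apply: lerD => //; rewrite distrC.
Qed.

End lipschitz_functionals.

(** * From Lipschitz to continuous functionals *)

Section lipschitz_approximation.
Variable R : realType.

Let zeroI : (0 : R) \in I01 R.
Proof. by apply/mem_set; rewrite /I01 /= in_itv/= lexx ler01. Qed.
Let t0 : I01 R := exist _ 0 zeroI.

(** Uniform distance truncated at 1, so that the supremum is taken over a
    bounded set. *)
Definition dist1 (f g : C01 R) : R :=
  sup [set Num.min 1 `|f t - g t| | t in [set: I01 R]].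

Let dist1_has_sup (f g : C01 R) : has_sup [set Num.min 1 `|f t - g t| | t in [set: I01 R]].
Proof.
split; first by exists (Num.min 1 `|f t0 - g t0|), t0.
by exists 1 => _ [t _ <-]; rewrite ge_min lexx.
Qed.

Lemma dist1_ge (f g : C01 R) t : Num.min 1 `|f t - g t| <= dist1 f g.
Proof. by apply: sup_ubound; [exact: (dist1_has_sup f g).2|exists t]. Qed.

Lemma dist1_le (f g : C01 R) e : (forall t, Num.min 1 `|f t - g t| <= e) -> dist1 f g <= e.
Proof.
move=> fg; apply: ge_sup; first exact: (dist1_has_sup f g).1.
by move=> _ [t _ <-].
Qed.

Lemma dist1_ge0 f g : 0 <= dist1 f g.
Proof. by apply: le_trans (dist1_ge f g t0); rewrite le_min ler01 normr_ge0. Qed.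

Lemma dist1_triangle (f g : C01 R) e h : (forall t, `|f t - g t| <= e) -> dist1 f h <= e + dist1 g h.
Proof.
move=> fg; apply: dist1_le => t.
have e0 : 0 <= e by apply: le_trans (fg t0).
apply: (@le_trans _ _ (e + Num.min 1 `|g t - h t|)); last by rewrite lerD2l dist1_ge.
have ft : `|f t - h t| <= e + `|g t - h t|.
  by rewrite -(subrKA (g t)) (le_trans (ler_normD _ _))// lerD2r.
by rewrite /Num.min; case: ifPn; case: ifPn; rewrite -?leNgt; lra.
Qed.

Variables (F : C01 R -> R) (M : R).
Hypothesis FM : forall f, `|F f| <= M.

(** The largest function below [F] that is [k]-Lipschitz for [dist1]. *)
Definition lower_lipschitz (k : R) (f : C01 R) : R :=
  inf [set F g + k * dist1 f g | g in [set: C01 R]].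

Let low_has_inf k f : 0 <= k -> has_inf [set F g + k * dist1 f g | g in [set: C01 R]].
Proof.
move=> k0; split; first by exists (F f + k * dist1 f f), f.
exists (- M) => _ [g _ <-].
have := FM g; rewrite ler_norml => /andP[h _].
by rewrite (le_trans h)// lerDl mulr_ge0// dist1_ge0.
Qed.

Lemma lower_lipschitz_le k f : 0 <= k -> lower_lipschitz k f <= F f.
Proof.
move=> k0.
have d0 : dist1 f f = 0.
  apply/eqP; rewrite eq_le dist1_ge0 andbT; apply: dist1_le => t.
  by rewrite subrr normr0 min_r.
have -> : F f = F f + k * dist1 f f by rewrite d0 mulr0 addr0.
by apply: ge_inf; [exact: (low_has_inf f k0).2|exists f].
Qed.

Lemma lower_lipschitz_ge k f r : 0 <= k -> (forall g, r <= F g + k * dist1 f g) ->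
  r <= lower_lipschitz k f.
Proof.
move=> k0 H; apply: lb_le_inf; first exact: (low_has_inf f k0).1.
by move=> _ [g _ <-].
Qed.

Lemma lower_lipschitz_norm k f : 0 <= k -> `|lower_lipschitz k f| <= M.
Proof.
move=> k0; rewrite ler_norml; apply/andP; split.
  apply: lower_lipschitz_ge => // g.
  have := FM g; rewrite ler_norml => /andP[h _].
  by rewrite (le_trans h)// lerDl mulr_ge0// dist1_ge0.
apply: (le_trans (lower_lipschitz_le f k0)).
by apply: le_trans (FM f); exact: ler_norm.
Qed.

Lemma lower_lipschitzP k : 0 <= k -> lipschitzC01 k (lower_lipschitz k).
Proof.
move=> k0.
have H (f g : C01 R) e : (forall t, `|f t - g t| <= e) ->
    lower_lipschitz k f - k * e <= lower_lipschitz k g.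
  move=> fg; apply: lower_lipschitz_ge => // h; rewrite lerBlDr.
  apply: (@le_trans _ _ (F h + k * dist1 f h)).
    by apply: ge_inf; [exact: (low_has_inf f k0).2|exists h].
  by rewrite -addrA lerD2l -mulrDr ler_wpM2l// addrC dist1_triangle.
move=> f g e fg; rewrite ler_norml; apply/andP; split.
  have gf t : `|g t - f t| <= e by rewrite distrC.
  by have := H g f e gf; lra.
by have := H f g e fg; lra.
Qed.

Lemma cvg_lower_lipschitz f : continuous F ->
  lower_lipschitz k%:R f @[k --> \oo] --> F f.
Proof.
move=> cF; apply/cvgrPdist_le => e e0.
have FF : Filter (nbhs f) := @nbhs_filter _ f.
have /(@cvgrPdist_le _ _ _ (nbhs f) FF) /(_ _ e0) /nbhs_ballP[dl /= dl0 hdl] := cF f.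
pose dm := Num.min 1 dl.
have dm0 : 0 < dm by rewrite lt_min ltr01.
near=> k.
have kdm : 2 * M <= k%:R * dm.
  rewrite -ler_pdivrMr//; near: k; exact: nbhs_infty_ger.
have k0 : 0 <= k%:R :> R by [].
rewrite ger0_norm ?subr_ge0 ?lower_lipschitz_le//.
rewrite lerBlDr addrC -lerBlDr; apply: lower_lipschitz_ge => // g.
have [fg|/existsNP[t /negP]] := pselect (forall t, `|f t - g t| < dl).
  have := hdl g fg => /= h.
  rewrite (@le_trans _ _ (F g))// ?lerDl ?mulr_ge0 ?dist1_ge0//.
  by rewrite lerBlDr addrC -lerBlDr (le_trans (ler_norm _) h).
rewrite -leNgt => tg.
have dmd : dm <= dist1 f g.
  by apply: le_trans (dist1_ge f g t); rewrite le_min !ge_min lexx tg !orbT.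
have h1 : 2 * M <= k%:R * dist1 f g by apply: (le_trans kdm); rewrite ler_wpM2l.
have := FM g; have := FM f; rewrite !ler_norml => /andP[_ h2] /andP[h3 _].
lra.
Unshelve. all: end_near. Qed.

End lipschitz_approximation.

(** * Weak convergence *)

Section law_mean.
Context (R : realType) d (T : measurableType d) (P : probability T R).
Variable X : cprocess R T.

Lemma measurable_functional (F : C01 R -> R) : continuous F ->
  measurable_fun setT (F \o (cprocess_path X : T -> C01 R)).
Proof.
move=> cF; have mF := measurable_continuousC01 cF.
exact: (measurableT_comp mF (@measurable_funPT _ _ _ _ (cprocess_path X))).
Qed.

Lemma integral_law (F : C01 R -> R) M : continuous F -> (forall f, `|F f| <= M) ->
  (\int[law P X]_f (F f)%:E = (mean P (F \o (cprocess_path X : T -> C01 R)))%:E)%E.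
Proof.
move=> cF FM; have iF := bounded_integrable P (measurable_functional cF) (fun x => FM _).
rewrite -(meanE iF).
apply: (@integral_distribution _ _ _ _ _ P (cprocess_path X) (fun f => (F f)%:E)).
  by apply/measurable_EFinP; exact: measurable_continuousC01.
exact: iF.
Qed.

End law_mean.

(** Convergence of bounded Lipschitz functionals gives one half of the
    convergence of continuous ones, by approximation from below. *)
Lemma liminf_continuous (R : realType)
    d (T : measurableType d) (P : probability T R) (X : nat -> cprocess R T)
    d' (T' : measurableType d') (P' : probability T' R) (Y : cprocess R T') :
  (forall k M (F : C01 R -> R), 0 <= k -> lipschitzC01 k F -> (forall f, `|F f| <= M) ->
    mean P (F \o (cprocess_path (X n) : T -> C01 R)) @[n --> \oo] -->
    mean P' (F \o (cprocess_path Y : T' -> C01 R))) ->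
  forall M (F : C01 R -> R) e, continuous F -> (forall f, `|F f| <= M) -> 0 < e ->
  \forall n \near \oo, mean P' (F \o (cprocess_path Y : T' -> C01 R)) - e <=
    mean P (F \o (cprocess_path (X n) : T -> C01 R)).
Proof.
move=> lip M F e cF FM e0; have e2 : 0 < e / 2 by rewrite divr_gt0.
pose G k := lower_lipschitz F k%:R.
have GL k : lipschitzC01 k%:R (G k) by exact: lower_lipschitzP FM _ (ler0n _ _).
have GM k f : `|G k f| <= M by exact: lower_lipschitz_norm.
have cG k : continuous (G k) by exact: lipschitzC01_continuous (GL k).
have /cvgrPdist_le/(_ _ e2) [k _ /(_ k (leqnn k)) Hk] :
    mean P' (G k \o (cprocess_path Y : T' -> C01 R)) @[k --> \oo] -->
    mean P' (F \o (cprocess_path Y : T' -> C01 R)).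
  apply: (@cvg_mean _ _ _ P' (fun k => G k \o _) _ (cst M)).
  - by move=> k; exact: measurable_functional.
  - exact: measurable_functional.
  - by apply: aeW => x; exact: cvg_lower_lipschitz.
  - exact: finite_measure_integrable_cst.
  - by move=> k x; exact: GM.
have /cvgrPdist_le/(_ _ e2) := lip _ _ _ (ler0n R k) (GL k) (GM k).
apply: filterS => n Hn.
have le : mean P (G k \o (cprocess_path (X n) : T -> C01 R)) <=
    mean P (F \o (cprocess_path (X n) : T -> C01 R)).
  apply: le_mean => [||x].
  - by apply: bounded_integrable => [|x]; [exact: measurable_functional|exact: GM].
  - by apply: bounded_integrable => [|x]; [exact: measurable_functional|exact: FM].
  - by apply: lower_lipschitz_le FM _ _ (ler0n _ _).
by move: Hk Hn; rewrite !ler_norml => /andP[_ ?] /andP[_ ?]; lra.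
Qed.

Theorem theorem1p3 (R : realType) (H : \bar R) (hH : (H <= (2^-1)%:E)%E)
    (d : measure_display) (T : measurableType d) (P : probability T R)
    (eps : seq bool -> {RV P >-> R}) (heps : iid_signs H eps)
    (d' : measure_display) (T' : measurableType d') (P' : probability T' R)
    (W : R -> {RV P' >-> R}) (hW : standard_brownian_motion W) :
  cvg_in_law P (fun n => Xproc eps H n) P' (sbm01 hW).
Proof.
move=> F cF [M FM]; rewrite (integral_law P' _ cF FM).
under eq_fun do rewrite (integral_law P _ cF FM).
apply: cvg_EFin; first exact: nearW.
have lip := liminf_continuous (@cvg_lipschitz _ _ hH _ _ _ _ heps _ _ _ _ hW).
apply/cvgrPdist_le => e e0.
have NFM f : `|- F f| <= M by rewrite normrN.
have cNF : continuous (fun f => - F f) by move=> f; exact: cvgN (cF f).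
have meanN d0 (T0 : measurableType d0) (P0 : probability T0 R) (Z : cprocess R T0) :
    mean P0 ((fun f => - F f) \o (cprocess_path Z : T0 -> C01 R)) =
    - mean P0 (F \o (cprocess_path Z : T0 -> C01 R)).
  rewrite -mulN1r -meanZ; last first.
    by apply: bounded_integrable => [|x]; [exact: measurable_functional|exact: FM].
  by congr mean; apply/funext => x /=; rewrite mulN1r.
have h1 := lip M F e cF FM e0; have h2 := lip M _ e cNF NFM e0.
apply: filterS2 h1 h2 => n; rewrite !meanN /= ler_norml => h1 h2.
by apply/andP; split; lra.
Qed.
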